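(* Let $1<p<\infty$ and $1/p+1/q=1$. A curve network $F\in\mathcal{C}_p(E)$ solves the extremal problem $(P_p)$, i.e. satisfies $$\|F''\|_p=\inf_{H\in\mathcal{C}_p(E)}\|H''\|_p ,$$ if and only if $$F''=\Bigl(\sum_{is\in N_B}\alpha_{is}B_{is}\Bigr)^{q-1}_{\pm}$$ (almost everywhere on every edge of $E$) for some real numbers $\alpha_{is}$, $is\in N_B$. The coefficients $\alpha_{is}$ are the unique solution to the system of equations $$\int_E\Bigl(\sum_{is\in N_B}\alpha_{is}B_{is}\Bigr)^{q-1}_{\pm}B_{kl}\,dt=d_{kl},\qquad kl\in N_B .$$
   Context: Data and triangulation. Let $n\ge 3$ and let $P_i=(x_i,y_i,z_i)\in\mathbb{R}^3$, $i=1,\dots,n$, be points whose projections $V_i=(x_i,y_i)\in\mathbb{R}^2$ are pairwise different and not all on one line. A triangulation of $V_1,\dots,V_n$ is a collection of non-degenerate, non-overlapping triangles in the plane (two distinct triangles intersect, if at all, only in a common vertex or a common full edge) such that the set of all vertices of the triangles is exactly $\{V_1,\dots,V_n\}$. A triangulation $T$ is fixed. $D\subset\mathbb{R}^2$ is the union of the (closed) triangles of $T$ (in general a collection of polygons with holes), and $E$ is the set of edges of the triangles of $T$. The edge between $V_i$ and $V_j$ is denoted $e_{ij}$ or $e$, and $\|e\|$ is its Euclidean length. Curve networks. A curve network is a family $\{f_e\}_{e\in E}$ of real-valued univariate functions, $f_e$ being defined on the edge $e$, i.e. on $[0,\|e\|]$ via the arc-length parametrization of $e$. A function $F:D\to\mathbb{R}$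 induces the curve network given for $e=e_{ij}$ by $$f_e(t)=F\Bigl(\bigl(1-\tfrac{t}{\|e\|}\bigr)x_i+\tfrac{t}{\|e\|}x_j,\ \bigl(1-\tfrac{t}{\|e\|}\bigr)y_i+\tfrac{t}{\|e\|}y_j\Bigr),\quad 0\le t\le\|e\| .$$ The direction in which an edge is parametrized is immaterial (networks are compared and multiplied as functions on the edges themselves). Smooth interpolation curve networks. $\mathcal{F}_p$ is the set of functions $F:D\to\mathbb{R}$ with $F(x_i,y_i)=z_i$ for $i=1,\dots,n$, with $\partial F/\partial x,\ \partial F/\partial y\in C(D)$ (i.e. $F$ is differentiable relative to $D$ with gradient continuous on $D$), and such that for every $e\in E$ the function $f_e'$ is absolutely continuous on $[0,\|e\|]$ and $f_e''\in L_p[0,\|e\|]$. $\mathcal{C}_p(E)$ is the set of curve networks $\{f_e\}_{e\in E}$ induced on $E$ by functions $F\in\mathcal{F}_p$. Geometrically, the smoothness of such a network means that at every vertex $V_i$ the graphs of the $f_e$, for the edges $e$ incident to $V_i$, have a common tangent plane: there is $(a_i,b_i)\in\mathbb{R}^2$ such that for every edge $e$ at $V_i$ with unit direction vector $(u,v)$ pointing away from $V_i$, the derivative of $f_e$ at $V_i$ in that direction equals $a_iu+b_iv$. For networks $F=\{f_e\}_{e\in E}$, $G=\{g_e\}_{e\in E}$: $F''=\{f_e''\}_{e\in E}$, $\int_E FG\,dt=\sum_{e\in E}\int_0^{\|e\|}f_e(t)g_e(t)\,dt$, and $\|G\|_p=\bigl(\sum_{e\in E}\int_0^{\|e\|}|g_e(t)|^p\,dt\bigr)^{1/p}$.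 Basic curve networks. Let $m_i$ be the number of edges of $E$ incident to $V_i$, and let $e_{ii_1},\dots,e_{ii_{m_i}}$ be these edges listed in clockwise order around $V_i$ ($e_{ii_r}$ joins $V_i$ to $V_{i_r}$). For $s=1,\dots,m_i-2$, the coefficients $\lambda^{(s)}_{1,i},\lambda^{(s)}_{2,i},\lambda^{(s)}_{3,i}$ are the unique real numbers with sum $1$ such that $\sum_{r=1}^3\lambda^{(s)}_{r,i}u_r=0$, where $u_r$ is the unit vector starting at $V_i$ along the edge $e_{ii_{s+r-1}}$. The first edge $e_{ii_1}$ is chosen so that $\lambda^{(s)}_{1,i}\ne 0$ for $s=1,\dots,m_i-2$ (this is always possible). Put $N_B=\{is : m_i\ge 3,\ i=1,\dots,n,\ s=1,\dots,m_i-2\}$ (here $is$ denotes the pair of indices $(i,s)$). For $is\in N_B$ the basic curve network $B_{is}$ is defined by $$B_{is}=\lambda^{(s)}_{r,i}\Bigl(1-\frac{t}{\|e_{ii_{s+r-1}}\|}\Bigr)\ \text{ on } e_{ii_{s+r-1}},\ r=1,2,3,\ 0\le t\le\|e_{ii_{s+r-1}}\|,$$ where $t$ is the distance from $V_i$ along the edge, and $B_{is}=0$ on all other edges of $E$. With $B_{is}$ is associated the number $$d_{is}=\frac{\lambda^{(s)}_{1,i}}{\|e_{ii_s}\|}(z_{i_s}-z_i)+\frac{\lambda^{(s)}_{2,i}}{\|e_{ii_{s+1}}\|}(z_{i_{s+1}}-z_i)+\frac{\lambda^{(s)}_{3,i}}{\|e_{ii_{s+2}}\|}(z_{i_{s+2}}-z_i).$$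 Notation: $(x)^r_{\pm}=|x|^r\operatorname{sign}(x)$ for real $x,r$, applied pointwise to networks. *)

(* Defs.v *)
From HB Require Import structures.
From mathcomp Require Export all_boot all_order all_algebra.
From mathcomp Require Export all_classical all_reals all_analysis.
Export Order.TTheory GRing.Theory Num.Theory.
Export numFieldNormedType.Exports.

Set Implicit Arguments.
Unset Strict Implicit.
Unset Printing Implicit Defensive.

Open Scope classical_set_scope.
Open Scope ring_scope.

(* The vertices are [V i : R * R] for [i : 'I_n]; a set of vertices, in
   particular a triangle, is represented by the set of its indices. *)

(* The norm [`|_|] of the library on [R * R] is the maximum norm. *)
Definition enorm (R : realType) (P : R * R) : R :=
  Num.sqrt (P.1 ^+ 2 + P.2 ^+ 2).

Definition collinear (R : realType) (n : nat) (V : 'I_n -> R * R)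
    (A : {set 'I_n}) : Prop :=
  exists a b c : R, (a, b) <> (0, 0) /\
    forall i, i \in A -> a * (V i).1 + b * (V i).2 = c.

Definition hull (R : realType) (n : nat) (V : 'I_n -> R * R)
    (A : {set 'I_n}) : set (R * R) :=
  [set Q | exists w : 'I_n -> R,
     [/\ forall i, 0 <= w i, forall i, i \notin A -> w i = 0,
         \sum_i w i = 1 & Q = \sum_i w i *: V i]].

Definition triangulation (R : realType) (n : nat) (V : 'I_n -> R * R)
    (T : {set {set 'I_n}}) : Prop :=
  [/\ forall A, A \in T -> #|A| = 3%N /\ ~ collinear V A,
      forall A B, A \in T -> B \in T -> A <> B ->
        [\/ hull V A `&` hull V B = set0,
            exists2 i, i \in A :&: B & hull V A `&` hull V B = [set V i]
          | exists i j, [/\ i \in A :&: B, j \in A :&: B, i <> j &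
              hull V A `&` hull V B = hull V [set i; j]%SET]] &
      forall i, exists2 A, A \in T & i \in A].

Definition domain (R : realType) (n : nat) (V : 'I_n -> R * R)
    (T : {set {set 'I_n}}) : set (R * R) :=
  [set Q | exists2 A, A \in T & hull V A Q].

Definition adj (n : nat) (T : {set {set 'I_n}}) : rel 'I_n :=
  fun i j => (i != j) && [exists A in T, (i \in A) && (j \in A)].

(* The edge joining [V i] and [V j], [i < j], is represented by the pair
   [(i, j)] and parametrized by arc length from [V i] to [V j]. *)
Definition edges (n : nat) (T : {set {set 'I_n}}) : {set 'I_n * 'I_n} :=
  [set e : 'I_n * 'I_n | (e.1 < e.2)%N && adj T e.1 e.2]%SET.

Definition mkedge (n : nat) (i j : 'I_n) : 'I_n * 'I_n :=
  if (i < j)%N then (i, j) else (j, i).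

Definition len (R : realType) (n : nat) (V : 'I_n -> R * R)
    (e : 'I_n * 'I_n) : R := enorm (V e.2 - V e.1).

Definition epoint (R : realType) (n : nat) (V : 'I_n -> R * R)
    (e : 'I_n * 'I_n) (t : R) : R * R :=
  (1 - t / len V e) *: V e.1 + (t / len V e) *: V e.2.

(* Only the edges [e] of the triangulation and the arguments in
   [`[0, len V e]] are relevant. *)

Definition network (R : realType) (n : nat) : Type :=
  'I_n * 'I_n -> R -> R.

Definition induced (R : realType) (n : nat) (V : 'I_n -> R * R)
    (F : R * R -> R) : network R n := fun e t => F (epoint V e t).

(* On the open interval [`]0, len V e[] the library derivative does not depend
   on the values outside [`[0, len V e]]; the end points form a null set. *)
Definition deriv2 (R : realType) (n : nat) (f : network R n) : network R n :=
  fun e => derive1n 2 (f e).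

Definition network_int (R : realType) (n : nat) (V : 'I_n -> R * R)
    (T : {set {set 'I_n}}) (f : network R n) : \bar R :=
  (\sum_(e in edges T)
     \int[lebesgue_measure]_(t in `[0%R, len V e]) (f e t)%:E)%E.

Definition network_norm (R : realType) (n : nat) (V : 'I_n -> R * R)
    (T : {set {set 'I_n}}) (p : R) (f : network R n) : \bar R :=
  poweR (network_int V T (fun e t => `|f e t| `^ p)) p^-1.

Definition network_aeq (R : realType) (n : nat) (V : 'I_n -> R * R)
    (T : {set {set 'I_n}}) (f g : network R n) : Prop :=
  forall e, e \in edges T ->
    {ae lebesgue_measure, forall t : R, t \in `[0, len V e] -> f e t = g e t}.

(* [g] is the derivative of [f] on [`[a, b]], one-sided at the end points. *)
Definition derivative_on (R : realType) (a b : R) (f g : R -> R) : Prop :=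
  forall t, t \in `[a, b] ->
    (f s - f t) / (s - t) @[s --> within `[a, b] t^'] --> g t.

Definition absolutely_continuous (R : realType) (a b : R) (g : R -> R) : Prop :=
  forall eps : R, 0 < eps -> exists2 delta : R, 0 < delta &
    forall (N : nat) (c d : 'I_N -> R),
      (forall k, [/\ a <= c k, c k <= d k & d k <= b]) ->
      (forall k l, k != l -> d k <= c l \/ d l <= c k) ->
      \sum_k (d k - c k) < delta ->
      \sum_k `|g (d k) - g (c k)| < eps.

(* [F] is differentiable relative to [D], with gradient continuous on [D]. *)
Definition C1_on (R : realType) (D : set (R * R)) (F : R * R -> R) : Prop :=
  exists Fx Fy : R * R -> R,
    [/\ {within D, continuous Fx}, {within D, continuous Fy} &
        forall P, D P ->
          (F Q - F P - (Fx P * (Q.1 - P.1) + Fy P * (Q.2 - P.2)))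
            / enorm (Q - P) @[Q --> within D P^'] --> (0 : R)].

Definition Fp (R : realType) (n : nat) (V : 'I_n -> R * R) (z : 'I_n -> R)
    (T : {set {set 'I_n}}) (p : R) : set (R * R -> R) :=
  [set F | [/\ forall i, F (V i) = z i,
      C1_on (domain V T) F &
      forall e, e \in edges T ->
        (exists2 g, derivative_on 0 (len V e) (induced V F e) g &
           absolutely_continuous 0 (len V e) g) /\
        deriv2 (induced V F) e \_ `[0, len V e]
          \in Lfun lebesgue_measure p%:E]].

Definition Cp (R : realType) (n : nat) (V : 'I_n -> R * R) (z : 'I_n -> R)
    (T : {set {set 'I_n}}) (p : R) : set (network R n) :=
  [set f | exists2 F, Fp V z T p F &
     forall e (t : R), e \in edges T -> t \in `[0, len V e] ->
       f e t = induced V F e t].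

Definition solves (R : realType) (n : nat) (V : 'I_n -> R * R) (z : 'I_n -> R)
    (T : {set {set 'I_n}}) (p : R) (f : network R n) : Prop :=
  network_norm V T p (deriv2 f) =
  ereal_inf [set network_norm V T p (deriv2 h) | h in Cp V z T p].

Definition udir (R : realType) (n : nat) (V : 'I_n -> R * R) (i j : 'I_n) :
    R * R := (enorm (V j - V i))^-1 *: (V j - V i).

(* The polar angles decrease along [l], within less than one full turn. *)
Definition clockwise (R : realType) (n : nat) (V : 'I_n -> R * R) (i : 'I_n)
    (l : seq 'I_n) : Prop :=
  exists theta : nat -> R,
    (forall r, (r < size l)%N ->
       udir V i (nth i l r) = (cos (theta r), sin (theta r))) /\
    (forall r r', (r < r')%N -> (r' < size l)%N ->
       theta r' < theta r /\ theta r < theta r' + 2 * pi).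

(* [nb i] lists the other end points of the edges at [V i]. *)
Definition edge_listing (R : realType) (n : nat) (V : 'I_n -> R * R)
    (T : {set {set 'I_n}}) (nb : 'I_n -> seq 'I_n) : Prop :=
  forall i, [/\ uniq (nb i), forall j, (j \in nb i) = adj T i j &
                clockwise V i (nb i)].

(* The index [s] is counted from 0; the subtraction is truncated, so that there
   is no index at vertices with fewer than three edges. *)
Definition NB (n : nat) (nb : 'I_n -> seq 'I_n) : finType :=
  {i : 'I_n & 'I_(size (nb i) - 2)}.

(* The other end point of the [r]-th of the three edges of the index [k]. *)
Definition nbr (n : nat) (nb : 'I_n -> seq 'I_n) (k : NB nb) (r : 'I_3) : 'I_n :=
  nth (tag k) (nb (tag k)) (tagged k + r).

Definition basic_coefs (R : realType) (n : nat) (V : 'I_n -> R * R)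
    (nb : 'I_n -> seq 'I_n) (lam : NB nb -> 'I_3 -> R) : Prop :=
  forall k, \sum_r lam k r = 1 /\
            \sum_r lam k r *: udir V (tag k) (nbr k r) = 0.

(* Distance from [V i] to [epoint V e t], for [i] an end point of [e]. *)
Definition dist_from (R : realType) (n : nat) (V : 'I_n -> R * R) (i : 'I_n)
    (e : 'I_n * 'I_n) (t : R) : R := if e.1 == i then t else len V e - t.

Definition basic (R : realType) (n : nat) (V : 'I_n -> R * R)
    (nb : 'I_n -> seq 'I_n) (lam : NB nb -> 'I_3 -> R) (k : NB nb) :
    network R n :=
  fun e t => \sum_(r | e == mkedge (tag k) (nbr k r))
               lam k r * (1 - dist_from V (tag k) e t / len V e).

Definition basic_d (R : realType) (n : nat) (V : 'I_n -> R * R)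
    (z : 'I_n -> R) (nb : 'I_n -> seq 'I_n) (lam : NB nb -> 'I_3 -> R)
    (k : NB nb) : R :=
  \sum_r lam k r / enorm (V (nbr k r) - V (tag k)) * (z (nbr k r) - z (tag k)).

Definition spow (R : realType) (r x : R) : R := `|x| `^ r * Num.sg x.

Definition basic_pow (R : realType) (n : nat) (V : 'I_n -> R * R)
    (nb : 'I_n -> seq 'I_n) (lam : NB nb -> 'I_3 -> R) (q : R)
    (alpha : {ffun NB nb -> R}) : network R n :=
  fun e t => spow (q - 1) (\sum_k alpha k * basic V lam k e t).

Definition basic_system (R : realType) (n : nat) (V : 'I_n -> R * R)
    (z : 'I_n -> R) (T : {set {set 'I_n}}) (nb : 'I_n -> seq 'I_n)
    (lam : NB nb -> 'I_3 -> R) (q : R) (alpha : {ffun NB nb -> R}) : Prop :=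
  forall l : NB nb,
    network_int V T (fun e t => basic_pow V lam q alpha e t * basic V lam l e t)
    = (basic_d V z lam l)%:E.

(* Main.v *)
(* Integration by parts on each edge and the common tangent plane at each vertex
   give [int_E F'' B_is = d_is] for every interpolating network [F]. Put
   [S = sum alpha_is B_is] and [phi = (S)^(q-1)_pm], so that [(phi)^(p-1)_pm = S].
   The system for [alpha] is the Euler equation of the strictly convex coercive
   function [1/q int_E |S|^q - sum alpha_is d_is], hence has a unique solution. For
   this solution [phi] is the second derivative of some interpolating network:
   integrating twice along the edges gives slopes that satisfy the linear relation
   of every [B_is], that is, common tangent planes, and the resulting network
   extends to a C^1 function on the plane. For every interpolating network [F] the
   strict convexity of [|x|^p] gives
   [int_E |F''|^p >= int_E |phi|^p + p int_E S (F'' - phi) = int_E |phi|^p],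
   with equality only if [F'' = phi] almost everywhere. *)
From HB Require Import structures.
Require Import Defs.
From mathcomp Require Import measurable_realfun zify ring lra.

Set Implicit Arguments.
Unset Strict Implicit.
Unset Printing Implicit Defensive.

(** * Absolutely continuous functions *)

(** Absolute continuity is given in its elementary form, so integration by parts first needs a
    fundamental theorem for such functions. It comes from the Jordan decomposition, Stieltjes
    measures of the monotone parts and Lebesgue differentiation of their densities. The identity for
    [int f'' B_is] is proved with a defect term, the relation of [B_is] evaluated at the end slopes
    of [f]. It is then read in both directions: a gradient at the vertex makes the defect vanish,
    and the system makes it vanish for the twice integrated network, which yields the tangent
    planes. The condition that the first coefficient is nonzero has two effects. It makes the basic
    networks at a vertex triangular with respect to the edges, hence independent, and it lets the
    last two slopes at a vertex determine all the others. The extension to the plane does not work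
    triangle by triangle. The triangulation enters only through two facts: distinct edges do not
    cross, and every vertex has two edges with independent directions. *)

Section IntervalFamilies.
Context {R : realType}.
Implicit Types (s : seq (R * R)) (I J K : R * R).

Definition apart I J := (I.2 <= J.1) || (J.2 <= I.1).

Lemma apartC : symmetric apart.
Proof. by move=> I J; rewrite /apart orbC. Qed.

Definition iord I := I.1 <= I.2.

Definition ilen s : R := \sum_(I <- s) (I.2 - I.1).

(** Finite families are lists, which can be merged and refined. The bound is [<= eps] because a
    strict one would not survive the supremum in the total variation. *)
Definition ac_seq (v : R -> R) := forall eps, 0 < eps ->
  exists2 delta, 0 < delta & forall s, all iord s -> pairwise apart s ->
    ilen s < delta -> \sum_(I <- s) `|v I.2 - v I.1| <= eps.

Fixpoint merge_itv I s : seq (R * R) :=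
  if s is J :: s' then
    if apart I J then J :: merge_itv I s'
    else merge_itv (Num.min I.1 J.1, Num.max I.2 J.2) s'
  else [:: I].

(** Two overlapping intervals are replaced by their hull, which is no longer than both together. The
    fourth clause is the invariant of the induction: an interval apart from two overlapping ones
    cannot lie between them, so it is apart from their hull. *)
Lemma merge_itv_prop I s : iord I -> all iord s -> pairwise apart s ->
  [/\ all iord (merge_itv I s), pairwise apart (merge_itv I s),
      ilen (merge_itv I s) <= I.2 - I.1 + ilen s,
      forall K, iord K -> apart K I -> all (apart K) s ->
        all (apart K) (merge_itv I s) &
      forall x, has (fun J => x \in `]J.1, J.2]) (I :: s) ->
        has (fun J => x \in `]J.1, J.2]) (merge_itv I s)].
Proof.
rewrite /ilen; elim: s I => [|J s IH] I oI.
  move=> _ _; split => //=; first by rewrite andbT.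
    by rewrite big_nil big_cons big_nil.
  by move=> K _ ->.
move=> /= /andP[oJ os] /andP[aJ ps].
have [aIJ|nIJ] := boolP (apart I J).
  have [h1 h2 h3 h4 h5] := IH I oI os ps.
  split => /=.
  - by rewrite oJ.
  - by rewrite h2 h4 // apartC.
  - by rewrite !big_cons; lra.
  - by move=> K oK aKI /andP[-> aKs]; rewrite h4.
  - move=> x /or3P[xI|->//|xs].
      by rewrite h5 ?orbT//= xI.
    by rewrite h5 ?orbT//= xs orbT.
set I' := (_, _).
have oI' : iord I' by move: oI; rewrite /iord /= ge_min !le_max => ->.
have [h1 h2 h3 h4 h5] := IH I' oI' os ps.
move: nIJ; rewrite /apart negb_or -!ltNge => /andP[ij ji].
split => //.
- apply: (le_trans h3); rewrite big_cons /I' /=; move: oI oJ; rewrite /iord.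
  rewrite /Num.min /Num.max; case: ifP => ?; case: ifP => ?; lra.
- move=> K oK aKI /= /andP[aKJ aKs]; apply: h4 => //.
  move: oK aKI aKJ; rewrite /apart /I' /iord /= => oK.
  rewrite le_min ge_max => /orP[h|h] /orP[h'|h']; rewrite ?h ?h' ?orbT//; exfalso; lra.
- move=> x hx; apply: h5; move: hx => /= /or3P[xI|xJ|->]; last by rewrite orbT.
    move: xI; rewrite !in_itv /= => /andP[? ?]; rewrite gt_min le_max.
    by apply/orP; left; apply/andP; split; apply/orP; left.
  move: xJ; rewrite !in_itv /= => /andP[? ?]; rewrite gt_min le_max.
  by apply/orP; left; apply/andP; split; apply/orP; right.
Qed.

Lemma merge_all s : all iord s -> exists s',
  [/\ all iord s', pairwise apart s', ilen s' <= ilen s &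
      forall x, has (fun J => x \in `]J.1, J.2]) s ->
        has (fun J => x \in `]J.1, J.2]) s'].
Proof.
elim: s => [|I s IH] /=; first by exists [::].
move=> /andP[oI /IH[s' [h1 h2 h3 h4]]].
have [g1 g2 g3 _ g5] := merge_itv_prop oI h1 h2.
exists (merge_itv I s'); split => //.
  by rewrite (le_trans g3)// {2}/ilen big_cons lerD2l.
by move=> x /orP[xI|/h4 xs]; apply: g5 => /=; rewrite ?xI ?xs ?orbT.
Qed.

Definition pieces (a : R) (l : seq R) : seq (R * R) := zip (a :: l) l.

Lemma pieces_prop a b l : itv_partition a b l ->
  [/\ all iord (pieces a l), pairwise apart (pieces a l),
      ilen (pieces a l) = b - a,
      forall K, apart K (a, b) -> all (apart K) (pieces a l) &
      forall f : R -> R,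
        variation a b f l = \sum_(I <- pieces a l) `|f I.2 - f I.1|].
Proof.
move=> pl; rewrite /ilen.
suff H : [/\ all iord (pieces a l), pairwise apart (pieces a l),
      ilen (pieces a l) = b - a &
      forall K, apart K (a, b) -> all (apart K) (pieces a l)].
  case: H => *; split=> // f.
  rewrite variation_zip// /pieces.
  elim: (l) (a) => [|x l' IH] a'; first by rewrite !big_nil.
  by rewrite /= !big_cons/= IH.
rewrite /ilen.
elim: l a pl => [|x l IH] a pl.
  rewrite /= big_nil; split => //.
  by rewrite (itv_partition_nil pl) subrr.
have xl := itv_partition_cons pl.
have [h1 h2 h3 h4] := IH _ xl.
have ax : a < x by case: pl => /= /andP[].
have xb := itv_partition_le xl.
split => /=.
- by rewrite {1}/iord/= (ltW ax).
- by rewrite h2 andbT; apply: h4; rewrite /apart/= lexx.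
- by rewrite big_cons h3 /=; lra.
- move=> K aK; rewrite -/(pieces x l) h4 ?andbT.
    move: aK; rewrite /apart/= => /orP[->//|h]; apply/orP; right; lra.
  move: aK; rewrite /apart/= => /orP[h|->]; rewrite ?orbT//; apply/orP; left; lra.
Qed.

End IntervalFamilies.

(** * Total variation and Jordan decomposition *)

Section AbsolutelyContinuous.
Context {R : realType}.
Implicit Types (s : seq (R * R)) (I J K : R * R).

(** Composition with [clamp a b] extends a function on [[a, b]] by constants. Clamping does not
    lengthen intervals and keeps them ordered and apart, so absolute continuity carries over to the
    whole line. *)
Definition clamp (a b x : R) : R := Num.max a (Num.min b x).

Lemma clamp_itv a b x : a <= b -> a <= clamp a b x <= b.
Proof. by move=> ab; rewrite /clamp le_max lexx ge_max ab ge_min lexx. Qed.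

Lemma clamp_id a b x : a <= x <= b -> clamp a b x = x.
Proof. by move=> /andP[ax xb]; rewrite /clamp (min_idPr xb) (max_idPr ax). Qed.

Lemma clamp_homo a b : {homo clamp a b : x y / x <= y}.
Proof.
move=> x y xy; rewrite /clamp ge_max !le_max lexx /=.
by rewrite le_min !ge_min lexx xy !orbT.
Qed.

Lemma clamp_lip a b x y : x <= y -> clamp a b y - clamp a b x <= y - x.
Proof.
move=> xy; rewrite /clamp.
rewrite !maxEle !minEle.
by repeat (case: ifP); move=> *; lra.
Qed.

Definition clamp_seq a b s := [seq (clamp a b J.1, clamp a b J.2) | J <- s].

Lemma clamp_seq_prop a b s : all (@iord R) s -> pairwise apart s ->
  [/\ all (@iord R) (clamp_seq a b s), pairwise apart (clamp_seq a b s) &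
      ilen (clamp_seq a b s) <= ilen s].
Proof.
move=> os ps; split.
- rewrite all_map; apply: sub_all os => I /= /clamp_homo; exact.
- rewrite pairwise_map; apply: sub_pairwise ps => I J /=.
  by rewrite /apart /= => /orP[/clamp_homo->//|/clamp_homo->]; rewrite orbT.
rewrite /ilen big_map /= !big_seq ler_sum // => I Is.
by apply: clamp_lip; exact: (allP os).
Qed.

Lemma ac_seq_clamp (v : R -> R) a b : ac_seq v -> ac_seq (v \o clamp a b).
Proof.
move=> acv e /acv[d d0 H]; exists d => // s os ps sd.
have [h1 h2 h3] := clamp_seq_prop a b os ps.
by have := H _ h1 h2 (le_lt_trans h3 sd); rewrite big_map.
Qed.

Lemma absolutely_continuous_seq a b (phi : R -> R) : a <= b ->
  absolutely_continuous a b phi -> ac_seq (phi \o clamp a b).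
Proof.
move=> ab ac e e0; have [d d0 H] := ac e e0; exists d => // s os ps sd.
have [h1 h2 h3] := clamp_seq_prop a b os ps.
set s' := clamp_seq a b s in h1 h2 h3.
have -> : \sum_(I <- s) `|(phi \o clamp a b) I.2 - (phi \o clamp a b) I.1| =
    \sum_(I <- s') `|phi I.2 - phi I.1| by rewrite big_map.
have sub I : I \in s' -> a <= I.1 /\ I.2 <= b.
  by move=> /mapP[J _ ->] /=; have /andP[-> _] := clamp_itv J.1 ab;
    have /andP[_ ->] := clamp_itv J.2 ab.
apply/ltW; rewrite big_tnth.
apply: (H _ (fun k => (tnth (in_tuple s') k).1)
             (fun k => (tnth (in_tuple s') k).2)).
- move=> k; have [? ?] := sub _ (mem_tnth k (in_tuple s')).
  by split => //; exact: (allP h1 _ (mem_tnth k (in_tuple s'))).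
- move=> k l kl.
  suff : apart (tnth (in_tuple s') k) (tnth (in_tuple s') l).
    by move=> /orP[]; [left|right].
  have P := pairwiseP (0, 0) h2.
  rewrite !(tnth_nth (0, 0)) /=.
  have [lkl|llk|/ord_inj eq_kl] := ltngtP k l; last by rewrite eq_kl eqxx in kl.
    exact: (P _ _ (ltn_ord k) (ltn_ord l) lkl).
  by rewrite apartC; exact: (P _ _ (ltn_ord l) (ltn_ord k) llk).
by have := le_lt_trans h3 sd; rewrite /ilen big_tnth.
Qed.

Lemma ac_seqB (v w : R -> R) : ac_seq v -> ac_seq w -> ac_seq (v \- w).
Proof.
move=> acv acw e e0.
have e2 : 0 < e / 2 by lra.
have [d1 d10 H1] := acv _ e2; have [d2 d20 H2] := acw _ e2.
exists (Num.min d1 d2); first by rewrite lt_min d10.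
move=> s os ps; rewrite lt_min => /andP[s1 s2].
rewrite (_ : e = e / 2 + e / 2); last by field.
apply: (le_trans _ (lerD (H1 _ os ps s1) (H2 _ os ps s2))).
rewrite -big_split /=; apply: ler_sum => I _.
have -> : (v \- w) I.2 - (v \- w) I.1 = v I.2 - v I.1 - (w I.2 - w I.1).
  by rewrite /=; ring.
exact: ler_normB.
Qed.

Lemma ac_seq_continuous (v : R -> R) : ac_seq v -> continuous v.
Proof.
move=> acv x; apply/cvgrPdist_le => /= e e0.
have [d d0 H] := acv _ e0.
near=> y.
have yx : `|x - y| < d by near: y; exists d => /=.
move: yx; have [xy|yx] := leP x y; rewrite distrC => yx'.
  have := H [:: (x, y)]; rewrite /ilen !big_cons !big_nil !addr0 /= /iord /= xy.
  rewrite distrC; apply => //.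
  by rewrite -[ltLHS]ger0_norm// subr_ge0.
have := H [:: (y, x)]; rewrite /ilen !big_cons !big_nil !addr0 /= /iord /= ltW//.
apply => //.
by rewrite -[ltLHS]ger0_norm ?subr_ge0 1?ltW// distrC.
Unshelve. all: by end_near. Qed.

Section TotalVariation.
Variables (v : R -> R) (eps delta : R).
Hypothesis H : forall s, all (@iord R) s -> pairwise apart s ->
  ilen s < delta -> \sum_(I <- s) `|v I.2 - v I.1| <= eps.

(** Induction on [s1]: the total variation over its first interval is a supremum over partitions,
    and the pieces of each partition are moved to [s2] without changing the total length. The list
    [s2] is there for this induction. *)
Lemma ac_sum_total_variation s1 s2 :
  all (@iord R) (s1 ++ s2) -> pairwise apart (s1 ++ s2) ->
  ilen (s1 ++ s2) < delta ->
  (\sum_(I <- s1) total_variation I.1 I.2 v +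
    (\sum_(I <- s2) `|v I.2 - v I.1|)%:E <= eps%:E)%E.
Proof.
elim: s1 s2 => [|I s1 IH] s2.
  by move=> os ps ls; rewrite big_nil add0e lee_fin; exact: H.
move=> /= /andP[oI os] /andP[aI ps]; rewrite /ilen => ls.
rewrite big_cons in ls.
set X := (\sum_(I <- s1) total_variation I.1 I.2 v +
    (\sum_(I <- s2) `|v I.2 - v I.1|)%:E)%E.
have X0 : (0 <= X)%E.
  rewrite adde_ge0 // ?lee_fin ?sumr_ge0 // big_seq_cond sume_ge0 //.
  move=> J /andP[Js _]; apply: total_variation_ge0.
  by apply: (allP os); rewrite mem_cat Js.
have Xe : (X <= eps%:E)%E.
  apply: IH => //; apply: le_lt_trans ls.
  by move: oI; rewrite /iord /ilen -subr_ge0 => oI; rewrite lerDr.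
have Xfin : X \is a fin_num.
  by rewrite ge0_fin_numE // (le_lt_trans Xe) // ltry.
rewrite big_cons -addeA -/X -leeBrDr //.
apply: ub_ereal_sup => _ [_ [l pl <-] <-].
rewrite leeBrDr // /X.
have [p1 p2 p3 p4 ->] := pieces_prop pl.
rewrite addeCA -EFinD -big_cat.
apply: IH.
- rewrite !all_cat p1.
  by move: os; rewrite all_cat => /andP[-> ->].
- rewrite pairwise_cat allrel_catr pairwise_cat p2.
  move: ps; rewrite pairwise_cat => /and3P[-> -> ->].
  move: aI; rewrite all_cat => /andP[aI1 aI2].
  rewrite !andbT /=; apply/andP; split; apply/allrelP => J K Js Ks.
    have aJ : apart J (I.1, I.2) by rewrite apartC; exact: (allP aI1 _ Js).
    exact: (allP (p4 _ aJ) _ Ks).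
  have aK : apart K (I.1, I.2) by rewrite apartC; exact: (allP aI2 _ Ks).
  by rewrite apartC; exact: (allP (p4 _ aK) _ Js).
move: ls; rewrite /ilen !big_cat /=; move: p3; rewrite /ilen => ->; lra.
Qed.

End TotalVariation.

(** An interval shorter than [d] has total variation at most 1, and finitely many steps of length
    [d / 2] exhaust [[a, b]]. *)
Lemma ac_seq_total_variation_fin (v : R -> R) a b : ac_seq v -> a <= b ->
  total_variation a b v \is a fin_num.
Proof.
move=> acv ab; have [d d0 H] := acv 1 ltr01.
have step c e : c <= e -> e - c < d -> total_variation c e v \is a fin_num.
  move=> ce cd; rewrite ge0_fin_numE ?total_variation_ge0//.
  have := @ac_sum_total_variation v 1 d H [:: (c, e)] [::].
  rewrite /ilen !big_cons !big_nil /= addr0 !adde0 /iord /= ce.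
  by move=> h; rewrite (le_lt_trans (h _ _ _)) // ltry.
have steps (n : nat) : forall e, a <= e -> e - a < d / 2 *+ n ->
    total_variation a e v \is a fin_num.
  elim: n => [|n IH] e ae; first by rewrite mulr0n => ?; exfalso; lra.
  rewrite mulrSr => h.
  have [ed|ed] := leP e (a + d / 2); first by apply: step; lra.
  have a1 : a <= e - d / 2 by lra.
  have a2 : e - d / 2 <= e by lra.
  rewrite (total_variationD _ a1 a2) fin_numD IH ?step//; lra.
have [n nP] : exists n : nat, (b - a) / (d / 2) < n%:R.
  by exists (Num.bound ((b - a) / (d / 2))); rewrite archi_boundP// divr_ge0; lra.
apply: (steps n) => //.
by rewrite -mulr_natl -ltr_pdivrMr//; lra.
Qed.

Definition tvar (a : R) (v : R -> R) (x : R) : R :=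
  fine (total_variation a x v).

Lemma ac_tvarB (v : R -> R) a c d : ac_seq v -> a <= c -> c <= d ->
  (tvar a v d - tvar a v c)%:E = total_variation c d v.
Proof.
move=> acv ac cd; rewrite /tvar (total_variationD _ ac cd).
rewrite fineD ?ac_seq_total_variation_fin // addrAC subrr add0r.
by rewrite fineK // ac_seq_total_variation_fin.
Qed.

Lemma ac_seq_tvar (v : R -> R) a b : ac_seq v -> a <= b ->
  ac_seq (tvar a v \o clamp a b).
Proof.
move=> acv ab e e0; have [d d0 H] := acv e e0; exists d => // s os ps sd.
have [h1 h2 h3] := clamp_seq_prop a b os ps.
have := @ac_sum_total_variation v e d H (clamp_seq a b s) [::].
rewrite cats0 => /(_ h1 h2 (le_lt_trans h3 sd)).
rewrite big_nil adde0 -lee_fin; apply: le_trans.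
rewrite -sumEFin big_map big_seq [leRHS]big_seq; apply: lee_sum => I Is /=.
have /clamp_homo oI : I.1 <= I.2 by exact: (allP os).
have /andP[c1 c2] := clamp_itv I.1 ab.
rewrite -(@ac_tvarB v a)// lee_fin ger0_norm//.
by rewrite -lee_fin ac_tvarB// total_variation_ge0.
Qed.

Lemma ac_tvar_homo (v : R -> R) a b : ac_seq v -> a <= b ->
  {homo tvar a v \o clamp a b : x y / x <= y}.
Proof.
move=> acv ab x y /(clamp_homo a b) xy /=.
have /andP[c1 c2] := clamp_itv x ab.
by rewrite -subr_ge0 -lee_fin ac_tvarB // total_variation_ge0.
Qed.

(** An increment of [v] is at most its variation. With [ac_tvar_homo] this is the Jordan
    decomposition of [v] as [tvar] minus [tvar - v]. *)
Lemma ac_tvarB_homo (v : R -> R) a b : ac_seq v -> a <= b ->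
  {homo (tvar a v \- v) \o clamp a b : x y / x <= y}.
Proof.
move=> acv ab x y /(clamp_homo a b) xy /=.
have /andP[c1 c2] := clamp_itv x ab.
have : ((v (clamp a b y) - v (clamp a b x))%:E <=
    (tvar a v (clamp a b y) - tvar a v (clamp a b x))%:E)%E.
  rewrite ac_tvarB//; apply: le_trans (total_variation_ge _ xy).
  by rewrite lee_fin ler_norm.
by rewrite lee_fin; lra.
Qed.

End AbsolutelyContinuous.

(** * Densities of Lebesgue-Stieltjes measures *)

Section StieltjesAC.
Context {R : realType}.
Variable w : cumulative R R.
Hypothesis acw : ac_seq w.

Notation lambda := (@lebesgue_measure R).
Notation muw := (lebesgue_stieltjes_measure w).

Lemma stieltjes_itv a b : a <= b -> muw `]a, b] = (w b - w a)%:E.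
Proof.
move=> ab; rewrite /lebesgue_stieltjes_measure /measure_extension.
rewrite measurable_mu_extE/=; last exact: is_ocitv.
by rewrite wlength_itv_bnd.
Qed.

Lemma measurable_has (s : seq (R * R)) :
  measurable ([set x | has (fun J => x \in `]J.1, J.2]) s] : set (measurableTypeR R)).
Proof.
elim: s => [|I s IH] /=.
  have -> : [set x : R | false] = set0 by apply/seteqP; split.
  exact: measurable0.
have -> : [set x | (x \in `]I.1, I.2]) || has (fun J => x \in `]J.1, J.2]) s] =
    `]I.1, I.2]%classic `|` [set x | has (fun J => x \in `]J.1, J.2]) s].
  apply/seteqP; split => x /=; first by move=> /orP[]; [left|right].
  by move=> [->//|->]; rewrite orbT.
by apply: measurableU => //; exact: measurable_itv.
Qed.

Lemma stieltjes_has_le (s : seq (R * R)) : all (@iord R) s ->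
  (muw [set x | has (fun J => x \in `]J.1, J.2]) s] <=
   (\sum_(J <- s) `|w J.2 - w J.1|)%:E)%E.
Proof.
elim: s => [|I s IH] /=.
  have -> : [set x : R | false] = set0 by apply/seteqP; split.
  by rewrite big_nil measure0.
move=> /andP[oI /IH {}IH].
rewrite big_cons EFinD; apply: (le_trans _ (leeD _ IH)).
  apply: (le_trans _ (measureU2 _ _ _)).
  - apply: le_measure; rewrite ?inE.
    + exact: (measurable_has (I :: s)).
    + apply: measurableU; [exact: (measurable_itv `]I.1, I.2])|].
      exact: measurable_has.
    + by move=> x /= /orP[h|h]; [left|right].
  - exact: measurable_itv.
  - exact: measurable_has.
rewrite [X in (X <= _)%E](_ : _ = (w I.2 - w I.1)%:E); last exact: stieltjes_itv.
by rewrite lee_fin ler_norm.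
Qed.

(* A null set has a countable cover by intervals of small total length; any
   finitely many of them merge into disjoint ones, to which absolute continuity
   of [w] applies. *)
Lemma stieltjes_dominates : muw `<< lambda.
Proof.
apply/null_content_dominatesP => A mA A0.
apply/eqP; rewrite eq_le measure_ge0 andbT.
apply/lee_addgt0Pr => e e0; rewrite add0e.
have [d d0 H] := acw e0.
have : (lambda A < d%:E)%E by rewrite A0 lte_fin.
move=> /ereal_inf_lt[_ [C [mC AC] <-] Cd].
have /choice[J JP] : forall k, exists J : R * R,
    iord J /\ C k = `]J.1, J.2]%classic.
  move=> k; have /ocitvP[->|[J J12 ->]] := mC k.
    by exists (0, 0); rewrite /iord /= set_itvoc0.
  by exists J; rewrite /iord (ltW J12).
apply: (@le_trans _ _ (muw (\bigcup_k C k))).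
  by apply: le_measure => //; rewrite ?inE//; apply: bigcup_measurable => k _;
    have [_ ->] := JP k; exact: measurable_itv.
rewrite -bigcup_bigsetU_bigcup.
have mCn n : measurable (\big[setU/set0]_(i < n.+1) C i : set (measurableTypeR R)).
  apply: bigsetU_measurable => i _.
  by have [_ ->] := JP i; exact: measurable_itv.
have cv := @nondecreasing_cvg_mu _ _ _ muw
  (fun n => \big[setU/set0]_(i < n.+1) C i) mCn.
have {}cv := cv (bigcup_measurable (fun k _ => mCn k)) _.
rewrite -(cvg_lim _ (cv _))//; last first.
  by apply/nondecreasing_seqP => n; rewrite [in leRHS]big_ord_recr; exact/subsetPset/subsetUl.
apply: lime_le.
  apply/cvg_ex; eexists; apply: cv.
  by apply/nondecreasing_seqP => n; rewrite [in leRHS]big_ord_recr; exact/subsetPset/subsetUl.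
near=> n => /=.
pose s := [seq J k | k <- iota 0 n.+1].
have os : all (@iord R) s by rewrite all_map; apply/allP => k _ /=; have [] := JP k.
have lC k : wlength idfun (C k) = ((J k).2 - (J k).1)%:E.
  by have [oJ CJ] := JP k; rewrite CJ; exact: (wlength_itv_bnd idfun false false oJ).
have ls : ilen s < d.
  rewrite -lte_fin; apply: le_lt_trans Cd.
  rewrite /ilen big_map -sumEFin.
  rewrite -[iota 0 n.+1]/(index_iota 0 n.+1).
  apply: (le_trans _ (@nneseries_lim_ge R (fun k => wlength idfun (C k)) xpredT 0%N n.+1 _)).
    by apply: lee_sum => k _; rewrite lC.
  by move=> k _ _; rewrite lC lee_fin subr_ge0; have [] := JP k.
have [s' [h1 h2 h3 h4]] := merge_all os.
have := H s' h1 h2 (le_lt_trans h3 ls); rewrite -lee_fin.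
apply: le_trans.
apply: (le_trans _ (stieltjes_has_le h1)).
apply: le_measure; rewrite ?inE; [exact: mCn|exact: measurable_has|].
move=> x; rewrite -bigcup_mkord => -[k /= kn Ckx].
apply: h4; apply/hasP; exists (J k); last by have [_ CJ] := JP k; rewrite CJ in Ckx.
by apply/mapP; exists k => //; rewrite mem_iota.
Unshelve. all: by end_near. Qed.

(** Radon-Nikodym is applied to the restriction of the measure to []a, b]], which is finite; this
    also makes the density integrable over the whole line. A single point is Lebesgue null, hence
    the closed interval in the integral. *)
Lemma stieltjes_density a b : a <= b -> exists2 h : R -> R,
  lambda.-integrable setT (EFin \o h) &
  forall x, a <= x <= b -> (w x - w a)%:E = (\int[lambda]_(t in `[a, x]) (h t)%:E)%E.
Proof.
move=> ab.
have fin : (muw `]a, b] < +oo)%E by rewrite stieltjes_itv// ltry.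
have mab : measurable (`]a, b]%classic : set (measurableTypeR R)).
  exact: measurable_itv.
pose nu : {finite_measure set _ -> \bar R} := mfrestr mab fin.
have nul : nu `<< lambda.
  apply/null_content_dominatesP => A mA A0.
  apply/eqP; rewrite eq_le measure_ge0 andbT /nu /= /mfrestr /mrestr.
  have /null_content_dominatesP/(_ _ mA A0) <- := stieltjes_dominates.
  apply: le_measure; rewrite ?inE//; exact: measurableI.
have [f [f0 ffin fint fE]] := radon_nikodym_sigma_finite nul.
exists (fine \o f).
  by apply: eq_integrable fint => // x _; rewrite /= fineK.
move=> x /andP[ax xb].
have max : measurable (`]a, x]%classic : set (measurableTypeR R)).
  exact: measurable_itv.
have := fE _ max; rewrite /nu /= /mfrestr /mrestr.
rewrite (_ : _ `&` _ = `]a, x]%classic); last first.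
  apply/seteqP; split=> y /=; first by case.
  by rewrite !in_itv /= => /andP[-> yx]; rewrite yx (le_trans yx).
rewrite stieltjes_itv// => ->.
rewrite -integral_itv_obnd_cbnd.
  by apply: eq_integral => t _; rewrite /= fineK.
apply/measurable_EFinP; apply: measurable_funTS.
by apply: measurableT_comp => //; exact: measurable_int fint.
Qed.

End StieltjesAC.

(** * The fundamental theorem for absolutely continuous functions *)

Section FundamentalTheorem.
Context {R : realType}.
Notation lambda := (@lebesgue_measure R).

Lemma ae_imp (P Q : R -> Prop) : (forall t, P t -> Q t) ->
  {ae lambda, forall t, P t} -> {ae lambda, forall t, Q t}.
Proof.
move=> PQ; apply: filterS; first exact: (ae_filter_ringOfSetsType lambda).
exact: PQ.
Qed.

Lemma ae_and (P Q : R -> Prop) :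
  {ae lambda, forall t, P t} -> {ae lambda, forall t, Q t} ->
  {ae lambda, forall t, P t /\ Q t}.
Proof. by apply: filterI; exact: (ae_filter_ringOfSetsType lambda). Qed.

(* Radon-Nikodym applied to the Lebesgue-Stieltjes measure of [w]. *)
Lemma nondecreasing_ac_density (w : R -> R) a b : a <= b ->
  {homo w : x y / x <= y} -> ac_seq w -> exists2 h : R -> R,
  lambda.-integrable setT (EFin \o h) &
  forall x, a <= x <= b -> w x - w a = \int[lambda]_(t in `[a, x]) h t.
Proof.
move=> ab hw acw.
pose W : cumulative R R := HB.pack w
  (isCumulative.Build R _ R w hw (right_continuousW (ac_seq_continuous acw))).
have [h hi hE] := @stieltjes_density R W acw a b ab.
by exists h => // x /hE; rewrite /Rintegral /= => <-.
Qed.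

(** The density is the difference of the densities of the two monotone parts of the Jordan
    decomposition. *)
Lemma ac_density a b (phi : R -> R) : a <= b ->
  absolutely_continuous a b phi -> exists2 h : R -> R,
  lambda.-integrable setT (EFin \o h) &
  forall x, a <= x <= b -> phi x - phi a = \int[lambda]_(t in `[a, x]) h t.
Proof.
move=> ab ac; pose v := phi \o clamp a b.
have acv : ac_seq v := absolutely_continuous_seq ab ac.
have vE x : a <= x <= b -> v x = phi x by move=> ?; rewrite /v /= clamp_id.
have [h1 hi1 hE1] := nondecreasing_ac_density ab (ac_tvar_homo acv ab)
  (ac_seq_tvar acv ab).
have ac2 : ac_seq ((tvar a v \- v) \o clamp a b).
  exact: (ac_seqB (ac_seq_tvar acv ab) (ac_seq_clamp a b acv)).
have [h2 hi2 hE2] := nondecreasing_ac_density ab (ac_tvarB_homo acv ab) ac2.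
exists (h1 \- h2); first by exact: (integrableB measurableT hi1 hi2).
have aab : a <= a <= b by rewrite lexx.
move=> x axb; rewrite -vE// -(vE a)//.
have mi : measurable (`[a, x]%classic : set (measurableTypeR R)) by exact: measurable_itv.
have := RintegralB mi (integrableS measurableT mi (@subsetT _ _) hi1)
  (integrableS measurableT mi (@subsetT _ _) hi2).
move=> ->; rewrite -hE1 // -hE2 //= (clamp_id axb) (clamp_id aab); ring.
Qed.

Lemma integrable_locallyT (h : R -> R) :
  lambda.-integrable setT (EFin \o h) -> locally_integrable setT h.
Proof. by move=> hi; apply: open_integrable_locally => //; exact: openT. Qed.

Lemma ac_FTC a b (phi : R -> R) : a <= b -> absolutely_continuous a b phi ->
  exists h : R -> R, [/\ lambda.-integrable setT (EFin \o h),
    forall x, a <= x <= b -> phi x - phi a = \int[lambda]_(t in `[a, x]) h t &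
    {ae lambda, forall t, a < t < b -> is_derive t 1 phi (h t)}].
Proof.
move=> ab ac; have [h hi hE] := ac_density ab ac.
exists h; split => //.
have hib y : lambda.-integrable [set` Interval (BLeft a) (BRight y)] (EFin \o h).
  by apply: integrableS hi => //; exact: measurable_itv.
(* Lebesgue differentiation applies to the primitive of [h] from [a], which agrees with
   [phi - phi a] near every interior point. *)
have := FTC1 hib (integrable_locallyT hi); apply: ae_imp => t Ht /andP[at' tb].
have [|d e] := Ht _; first by rewrite lte_fin.
set F := (F in derivable F _ _) in d e.
have nF : \forall x \near t, F x + phi a = phi x.
  have tab : t \in `]a, b[ by rewrite in_itv /= at'.
  apply: filterS (near_in_itvoo tab) => x; rewrite in_itv /= => /andP[ax xb].
  by rewrite /F -hE ?subrK// !ltW.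
have dF : is_derive t (1 : R) (fun x => F x + phi a) (h t).
  rewrite -[h t]addr0; apply: is_deriveD; split => //.
  by rewrite -derive1E.
exact: near_eq_is_derive dF.
Qed.

End FundamentalTheorem.

(** * Integration by parts on one edge *)

Section EdgeCalculus.
Context {R : realType}.
Notation lambda := (@lebesgue_measure R).
Notation mR := (measurableTypeR R).
Implicit Types (f g : R -> R).

Lemma is_derive_cvg f t l :
  (f s - f t) / (s - t) @[s --> t^'] --> l -> is_derive t 1 f l.
Proof.
move=> H.
have H' : h^-1 *: ((f \o shift t) (h *: 1) - f t) @[h --> 0^'] --> l.
  apply/cvgrPdist_lt => e e0; move/cvgrPdist_lt : H => /(_ _ e0).
  rewrite /= !near_withinE => -[d d0 H]; exists d => //= h /=.
  rewrite sub0r normrN => hd h0.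
  have := H (h + t); rewrite /= opprD addrCA subrr addr0 normrN => /(_ hd).
  rewrite addrK mulrC scaler1; apply.
  by apply: contra_neq h0 => ht; apply: (addIr t); rewrite ht add0r.
split; first by apply/cvg_ex; exists l.
exact: cvg_lim H'.
Qed.

Lemma derivative_on_inner a b f g t : derivative_on a b f g -> a < t < b ->
  is_derive t 1 f (g t).
Proof.
move=> D /andP[at' tb]; apply: is_derive_cvg.
have tab : t \in `[a, b] by rewrite in_itv /= !ltW.
apply/cvgrPdist_lt => e e0; have /cvgrPdist_lt/(_ _ e0) := D _ tab.
rewrite !near_withinE => H.
have tab' : t \in `]a, b[ by rewrite in_itv /= at'.
apply: filterS2 H (near_in_itvoo tab') => x {}H xab xt; apply: H => //.
exact: subset_itv_oo_cc xab.
Qed.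

Lemma derivative_on_continuous a b f g : derivative_on a b f g ->
  {within `[a, b], continuous f}.
Proof.
move=> D; apply/subspace_continuousP => t tab.
have H := D _ tab.
have H2 : (f s - f t) / (s - t) * (s - t) @[s --> within `[a, b] t^'] --> g t * 0.
  apply: cvgM => //.
  have hc : s - t @[s --> t] --> (0 : R).
    by rewrite -(subrr t); apply: cvgB; [exact: cvg_id|exact: cvg_cst].
  exact: (cvg_within_filter _ (cvg_within_filter _ hc)).
apply/cvgrPdist_lt => e e0; move/cvgrPdist_lt : H2 => /(_ _ e0).
rewrite !near_withinE; apply: filterS => s Hs sab.
have [->|st] := eqVneq s t; first by rewrite subrr normr0.
have := Hs st sab; rewrite divfK ?subr_eq0// mulr0 sub0r opprB => h.
by rewrite distrC -normrN opprB.
Qed.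

Lemma ac_bounded a b g : a <= b -> absolutely_continuous a b g ->
  exists2 M, 0 <= M & forall t, a <= t <= b -> `|g t| <= M.
Proof.
move=> ab ac.
have cg : {within `[a, b], continuous (Num.norm \o (g \o clamp a b))}.
  apply: continuous_subspaceT => x; apply: continuous_comp.
    exact: (ac_seq_continuous (absolutely_continuous_seq ab ac)).
  exact: norm_continuous.
have [c cab cmax] := EVT_max ab cg.
exists `|g (clamp a b c)| => // t tab; have := cmax t.
by rewrite in_itv /= (clamp_id tab) => /(_ tab).
Qed.

(** Serves the integration by parts, where a Lipschitz part is added to a multiple of [g], and, with
    [g] constant, Lipschitz functions themselves. *)
Lemma ac_perturb a b g psi K : absolutely_continuous a b g -> 0 <= K ->
  (forall c d, a <= c -> c <= d -> d <= b ->
     `|psi d - psi c| <= `|g d - g c| + K * (d - c)) ->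
  absolutely_continuous a b psi.
Proof.
move=> ac K0 H e e0.
have e2 : 0 < e / 2 by lra.
have [d d0 Hd] := ac _ e2.
(* The denominator is [K + 1] because [K] may be zero. *)
have dK : 0 < e / 2 / (K + 1) by rewrite divr_gt0//; lra.
exists (Num.min d (e / 2 / (K + 1))); first by rewrite lt_min d0.
move=> N c d' cd dis; rewrite lt_min => /andP[s1 s2].
apply: (@le_lt_trans _ _ (\sum_k `|g (d' k) - g (c k)| + K * \sum_k (d' k - c k))).
  rewrite mulr_sumr -big_split /=; apply: ler_sum => k _.
  by have [? ? ?] := cd k; exact: H.
have := Hd N c d' cd dis s1.
have : K * \sum_k (d' k - c k) <= e / 2; last by move=> *; lra.
move: s2; rewrite ltr_pdivlMr; last by lra.
have : 0 <= \sum_k (d' k - c k).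
  by apply: sumr_ge0 => k _; have [_ ? _] := cd k; rewrite subr_ge0.
set S := \sum_k _ => S0; nra.
Qed.

Lemma derivative_on_MVT a b f g c d : derivative_on a b f g ->
  a <= c -> c <= d -> d <= b ->
  exists2 x, a <= x <= b & f d - f c = g x * (d - c).
Proof.
move=> D ac; rewrite le_eqVlt => /predU1P[<- cb|cd db].
  by exists c; rewrite ?ac// !subrr mulr0.
have [x xcd e] : exists2 x, x \in `]c, d[ & f d - f c = g x * (d - c).
  apply: MVT => //.
    move=> x; rewrite in_itv /= => /andP[cx xd].
    by apply: derivative_on_inner D _; apply/andP; split; lra.
  apply: continuous_subspaceW (derivative_on_continuous D).
  by apply: subset_itvScc; rewrite bnd_simp.
exists x => //; move: xcd; rewrite in_itv /= => /andP[cx xd].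
by apply/andP; split; lra.
Qed.

Lemma ac_parts L f g : 0 < L -> derivative_on 0 L f g ->
  absolutely_continuous 0 L g ->
  absolutely_continuous 0 L (fun t => g t * (1 - t / L) + f t / L).
Proof.
move=> L0 D ac; have [M M0 HM] := ac_bounded (ltW L0) ac.
(* Apart from the increment of [g], two terms occur, one from the change of [1 - t / L] and one from
   the mean value theorem for [f / L]; each is at most [M * (d - c) / L]. *)
have K0 : 0 <= (M + M) / L by rewrite divr_ge0//; lra.
apply: (ac_perturb ac K0) => c d c0 cd dL.
have [x x0L e] := derivative_on_MVT D c0 cd dL.
rewrite (_ : _ - _ = (g d - g c) * (1 - d / L) - g c * ((d - c) / L) +
    g x * ((d - c) / L)); last first.
  have -> : f d = f c + g x * (d - c) by lra.
  by field; rewrite gt_eqF.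
have dc0 : 0 <= (d - c) / L by rewrite divr_ge0//; lra.
rewrite (le_trans (ler_normD _ _))// (le_trans (lerD (ler_normB _ _) (lexx _)))//.
have nE u : `|u * ((d - c) / L)| = `|u| * ((d - c) / L) by rewrite normrM (ger0_norm dc0).
rewrite !nE normrM.
have d1 : 0 <= 1 - d / L <= 1.
  rewrite subr_ge0 ler_pdivrMr// mul1r dL /= gerBl divr_ge0//; lra.
have -> : (M + M) / L * (d - c) = M * ((d - c) / L) + M * ((d - c) / L) by ring.
have h1 : `|g c| <= M by apply: HM; rewrite c0 (le_trans cd).
have h2 : `|g x| <= M by apply: HM.
rewrite -addrA; apply: lerD; last by apply: lerD; apply: ler_wpM2r.
by case/andP: d1 => d1 d2; rewrite (ger0_norm d1) ler_piMr.
Qed.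

Lemma derive1n2_inner a b f g t h : derivative_on a b f g -> a < t < b ->
  is_derive t 1 g h -> derive1n 2 f t = h.
Proof.
move=> D tab gh; rewrite derive1nS derive1n1 derive1E.
rewrite (@near_eq_derive _ _ _ _ g); first exact: derive_val.
have tab' : t \in `]a, b[ by rewrite in_itv.
apply: filterS (near_in_itvoo tab') => x; rewrite in_itv /= => xab.
rewrite derive1E; by have H := derivative_on_inner D xab; rewrite derive_val.
Qed.

Lemma ae_open_closed (P : R -> Prop) a b : {ae lambda, forall t, a < t < b -> P t} ->
  {ae lambda, forall t, t \in `[a, b] -> P t}.
Proof.
have n0 (c : R) : {ae lambda, forall t : R, t != c}.
  exists [set c]; split; [exact: measurable_set1|exact: lebesgue_measure_set1|].
  by move=> t /= /negP; rewrite negbK => /eqP.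
move=> H; have := ae_and H (ae_and (n0 a) (n0 b)); apply: ae_imp => t [E [t0 tL]].
rewrite in_itv /= !le_eqVlt eq_sym (negbTE t0) (negbTE tL) /= => tt.
exact: E.
Qed.

(** The function [k] will be built from a library second derivative, which at the end points depends
    on values outside the edge. Hence measurability and equality are asked for on the open interval
    only. *)
Lemma Rintegral_open_ae_eq L (k h : R -> R) :
  measurable_fun (`]0, L[%classic : set mR) k ->
  lambda.-integrable `[0, L] (EFin \o h) ->
  {ae lambda, forall t, 0 < t < L -> k t = h t} ->
  lambda.-integrable `[0, L] (EFin \o k) /\
  \int[lambda]_(t in `[0, L]) k t = \int[lambda]_(t in `[0, L]) h t.
Proof.
move=> mk hi kh.
have mi : measurable (`[0, L]%classic : set mR) by exact: measurable_itv.
have mk' : measurable_fun (`[0, L]%classic : set mR) k by exact: measurable_fun_itv_cc mk.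
have mh' := measurable_int _ hi.
have kh' : ae_eq lambda (`[0, L]%classic : set mR) (EFin \o k) (EFin \o h).
  by have := ae_open_closed kh; apply: ae_imp => t E tL /=; rewrite E.
have mk2 : measurable_fun (`[0, L]%classic : set mR) (EFin \o k).
  exact/measurable_EFinP.
split; last first.
  by rewrite /Rintegral; congr fine; exact: ae_eq_integral mi mk2 mh' kh'.
apply/integrableP; split => //; have /integrableP[_] := hi.
rewrite (@ae_eq_integral _ _ _ lambda _ (fun t => `|(k t)%:E|%E)) //.
- exact: measurableT_comp.
- exact: measurableT_comp.
by move: kh'; apply: ae_imp => t E tL /=; have /= [->] := E tL.
Qed.

(* The third formula integrates the derivative [f'' (1 - t / L)] of the
   absolutely continuous function [f' (1 - t / L) + f / L]. *)
Lemma second_derivative_parts L f g : 0 < L -> derivative_on 0 L f g ->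
  absolutely_continuous 0 L g ->
  measurable_fun (`]0, L[%classic : set mR) (derive1n 2 f) ->
  [/\ lambda.-integrable `[0, L] (EFin \o derive1n 2 f),
      lambda.-integrable `[0, L] (EFin \o (fun t => derive1n 2 f t * (1 - t / L))),
      \int[lambda]_(t in `[0, L]) (derive1n 2 f t) = g L - g 0 &
      \int[lambda]_(t in `[0, L]) (derive1n 2 f t * (1 - t / L)) =
        (f L - f 0) / L - g 0].
Proof.
move=> L0 D ac mf.
have [h [hi hE hD]] := ac_FTC (ltW L0) ac.
have [k [ki kE kD]] := ac_FTC (ltW L0) (ac_parts L0 D ac).
have L00 : 0 <= L <= L by rewrite lexx ltW.
have fh : {ae lambda, forall t, 0 < t < L -> derive1n 2 f t = h t}.
  by move: hD; apply: ae_imp => t H tL; apply: (derive1n2_inner D tL); exact: H.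
have fk : {ae lambda, forall t, 0 < t < L -> derive1n 2 f t * (1 - t / L) = k t}.
  have := ae_and fh (ae_and hD kD); apply: ae_imp => t [E [Hh Hk]] tL.
  rewrite E //.
  have {}Hh := Hh tL; have {}Hk := Hk tL.
  have Df := derivative_on_inner D tL.
  rewrite -[RHS](derive_val (is_derive := Hk)).
  have -> : (fun t0 => g t0 * (1 - t0 / L) + f t0 / L) =
     g * (cst 1 - (L^-1 *: id)) + (L^-1 *: f).
    by apply/funext => x; rewrite !fctE /= /GRing.scale /=; ring.
  have d1 := is_deriveB (is_derive_cst (1 : R) t 1) (is_deriveZ L^-1 (is_derive_id t (1 : R))).
  have d2 := is_deriveD (is_deriveM Hh d1) (is_deriveZ L^-1 Df).
  rewrite (derive_val (is_derive := d2)) /GRing.scale /= !fctE /= /GRing.scale /=; ring.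
have m1 : measurable_fun (`]0, L[%classic : set mR) (fun t => derive1n 2 f t * (1 - t / L)).
  apply: measurable_funM => //; apply: measurable_funB => //.
  by apply: measurable_funM => //.
have closed (w : R -> R) : lambda.-integrable setT (EFin \o w) ->
    lambda.-integrable `[0, L] (EFin \o w).
  by apply: integrableS => //; exact: measurable_itv.
have [i1 e1] := Rintegral_open_ae_eq mf (closed _ hi) fh.
have [i2 e2] := Rintegral_open_ae_eq m1 (closed _ ki) fk.
split => //; first by rewrite e1 -hE.
rewrite e2 -kE // divff ?gt_eqF// subrr mulr0 mul0r subr0; ring.
Qed.

End EdgeCalculus.

(** * The nonlinear system *)

Section SignedPower.
Context {R : realType}.
Implicit Types (x y a b r p q : R).

Lemma spow_ge0E r x : 0 < r -> 0 <= x -> spow r x = x `^ r.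
Proof.
move=> r0; rewrite /spow le_eqVlt => /predU1P[<-|x0].
  by rewrite sgr0 mulr0 powR0 ?gt_eqF.
by rewrite gtr0_sg// mulr1 gtr0_norm.
Qed.

Lemma spowN r x : spow r (- x) = - spow r x.
Proof. by rewrite /spow normrN sgrN mulrN. Qed.

Lemma spow0 r : spow r 0 = 0.
Proof. by rewrite /spow sgr0 mulr0. Qed.

Lemma norm_spow r x : 0 < r -> `|spow r x| = `|x| `^ r.
Proof.
move=> r0; have [->|x0] := eqVneq x 0.
  by rewrite spow0 !normr0 powR0// gt_eqF.
rewrite /spow normrM normr_sg x0 mulr1 ger0_norm// powR_ge0//.
Qed.

Lemma sg_spow r x : Num.sg (spow r x) = Num.sg x.
Proof.
have [->|x0] := eqVneq x 0; first by rewrite spow0.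
by rewrite /spow sgrM gtr0_sg ?powR_gt0 ?normr_gt0// mul1r sgr_id.
Qed.

Lemma spow_spow r s x : 0 < r -> spow s (spow r x) = spow (r * s) x.
Proof. by move=> r0; rewrite {1}/spow sg_spow norm_spow// -powRrM. Qed.

Lemma spow1 x : spow 1 x = x.
Proof. by rewrite /spow powRr1// mulrC -numEsg. Qed.

Lemma spowK r x : 0 < r -> spow r (spow r^-1 x) = x.
Proof. by move=> r0; rewrite spow_spow ?invr_gt0// mulVf ?gt_eqF// spow1. Qed.

Lemma spow_lt r x y : 0 < r -> x < y -> spow r x < spow r y.
Proof.
move=> r0 xy; have [x0|x0] := leP 0 x.
  have y0 : 0 <= y by lra.
  by rewrite !spow_ge0E//; apply: gt0_ltr_powR.
have sx : spow r x < 0.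
  by rewrite -oppr_gt0 -spowN spow_ge0E; [rewrite powR_gt0|..]; lra.
have [y0|y0] := leP 0 y.
  by apply: (lt_le_trans sx); rewrite spow_ge0E// powR_ge0.
rewrite -ltrN2 -!spowN !spow_ge0E; [|lra..].
apply: gt0_ltr_powR => //; rewrite ?nnegrE; lra.
Qed.

(** Strict monotonicity suffices: the inverse [spow r^-1] maps the ends of an interval around
    [spow r x] to the ends of a neighbourhood of [x]. *)
Lemma spow_continuous r : 0 < r -> continuous (spow r : R -> R).
Proof.
move=> r0 x; apply/cvgrPdist_lt => /= e e0.
have r10 : 0 < r^-1 by rewrite invr_gt0.
have tx : x \in `]spow r^-1 (spow r x - e), spow r^-1 (spow r x + e)[.
  have e1 : x = spow r^-1 (spow r x) by rewrite -{1}(spowK x r10) invrK.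
  by rewrite in_itv /=; apply/andP; split; [rewrite [ltRHS]e1|rewrite [ltLHS]e1]; apply: spow_lt; lra.
apply: filterS (near_in_itvoo tx) => y; rewrite in_itv /= => /andP[y1 y2].
have := spow_lt r0 y1; have := spow_lt r0 y2; rewrite !spowK// => h1 h2.
by rewrite ltr_norml; apply/andP; split; lra.
Qed.

Lemma powR_normE p x : 1 < p -> `|x| `^ p = spow (p - 1) x * x.
Proof.
by move=> p1; rewrite /spow -mulrA -normrEsg mulrC mulr_powRB1//; lra.
Qed.

Lemma powR_norm_continuous p : 1 < p -> continuous (fun x => `|x| `^ p).
Proof.
move=> p1; rewrite (_ : (fun x => _) = (fun x => spow (p - 1) x * x)); last first.
  by apply/funext => x; exact: powR_normE.
move=> x; apply: cvgM; last exact: cvg_id.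
by apply: spow_continuous; lra.
Qed.

Lemma conjugate_gt1 p q : 1 < p -> p^-1 + q^-1 = 1 ->
  [/\ 1 < q, p * (q - 1) = q, q * (p - 1) = p & (p - 1) * (q - 1) = 1].
Proof.
move=> p1 pq.
have p0 : p != 0 by rewrite gt_eqF//; lra.
have qV : q^-1 = (p - 1) / p by rewrite mulrBl divff// mul1r; lra.
have p10 : p - 1 != 0 by rewrite gt_eqF//; lra.
have qE : q = p / (p - 1) by rewrite -[q]invrK qV invf_div.
have q1 : q - 1 = (p - 1)^-1 by rewrite qE; field.
have : 0 < q - 1 by rewrite q1 invr_gt0; lra.
split; [lra|rewrite q1 qE|rewrite qE|rewrite q1]; by field.
Qed.

(** The tangent line inequality at [b], obtained from Young's inequality for [|a|] and
    [|b| ^ (p - 1)]; the conjugate power of the latter is [|b| ^ p]. *)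
Lemma powR_convex p a b : 1 < p ->
  p * (spow (p - 1) b * (a - b)) <= `|a| `^ p - `|b| `^ p.
Proof.
move=> p1.
have p0 : 0 < p by lra.
pose q := p / (p - 1).
have pp : p - 1 != 0 by rewrite gt_eqF//; lra.
have pq : p^-1 + q^-1 = 1 by rewrite /q; field; rewrite pp gt_eqF.
have [q1 e1 e2 e3] := conjugate_gt1 p1 pq.
have := @conjugate_powR R `|a| (`|b| `^ (p - 1)) p q (normr_ge0 _) (powR_ge0 _ _)
  p0 (lt_trans ltr01 q1) pq.
rewrite -powRrM (mulrC (p - 1)) e2 => Y.
have h : spow (p - 1) b * a <= `|a| * `|b| `^ (p - 1).
  rewrite (le_trans (ler_norm _))// normrM norm_spow; last lra.
  by rewrite mulrC.
rewrite mulrBr -powR_normE//.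
have : p * (spow (p - 1) b * a) <= `|a| `^ p + `|b| `^ p * (p / q).
  rewrite -(@ler_pM2l _ p)// in h; apply: (le_trans h).
  rewrite -(@ler_pM2l _ p)// in Y; apply: (le_trans Y).
  by rewrite le_eqVlt; apply/orP; left; apply/eqP; field; rewrite !gt_eqF//; lra.
have -> : p / q = p - 1 by rewrite /q; field; rewrite pp gt_eqF.
lra.
Qed.

(** The tangent inequalities from [b] to the midpoint [c] and from [c] to [a] are added. The second
    uses the slope at [c], and strict monotonicity of [spow] makes its contribution strictly larger
    than with the slope at [b]. *)
Lemma powR_strictly_convex p a b : 1 < p -> a != b ->
  p * (spow (p - 1) b * (a - b)) < `|a| `^ p - `|b| `^ p.
Proof.
move=> p1 ab; pose c := (a + b) / 2.
have h1 := powR_convex a c p1; have h2 := powR_convex c b p1.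
have p10 : 0 < p - 1 by lra.
have h3 : spow (p - 1) b * (a - b) < spow (p - 1) c * (a - b).
  have [lab|lba|e] := ltgtP a b; last by rewrite e eqxx in ab.
    rewrite ltr_nM2r ?subr_lt0//; apply: spow_lt => //; rewrite /c; lra.
  rewrite ltr_pM2r ?subr_gt0//; apply: spow_lt => //; rewrite /c; lra.
have e1 : a - c = (a - b) / 2 by rewrite /c; field.
have e2 : c - b = (a - b) / 2 by rewrite /c; field.
rewrite e1 in h1; rewrite e2 in h2.
rewrite -(@ltr_pM2l _ (p / 2)) in h3; last by lra.
have -> : p * (spow (p - 1) b * (a - b)) =
  p / 2 * (spow (p - 1) b * (a - b)) + p / 2 * (spow (p - 1) b * (a - b)) by field.
have e3 : p * (spow (p - 1) c * ((a - b) / 2)) = p / 2 * (spow (p - 1) c * (a - b)) by field.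
have e4 : p * (spow (p - 1) b * ((a - b) / 2)) = p / 2 * (spow (p - 1) b * (a - b)) by field.
rewrite e3 in h1; rewrite e4 in h2; lra.
Qed.

End SignedPower.

(** * Real-valued integrals over a finite family of edges *)

Section NetworkIntegral.
Context {R : realType} {I : finType}.
Variables (E : {set I}) (L : I -> R).
Hypothesis L0 : forall e, e \in E -> 0 < L e.
Notation lambda := (@lebesgue_measure R).
Notation mR := (measurableTypeR R).
Implicit Types (f g : I -> R -> R).

Definition net_integrable f := forall e, e \in E ->
  lambda.-integrable `[0, L e] (EFin \o f e).

Definition net_continuous f := forall e, continuous (f e).

Definition net_integral f : R :=
  \sum_(e in E) \int[lambda]_(t in `[0, L e]) f e t.

Lemma measurable_itv_mR (a b : R) : measurable (`[a, b]%classic : set mR).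
Proof. exact: measurable_itv. Qed.
Hint Resolve measurable_itv_mR : core.

Lemma continuous_integrable_itv (f : R -> R) a b : continuous f ->
  lambda.-integrable `[a, b] (EFin \o f).
Proof.
move=> cf; apply: continuous_compact_integrable; first exact: segment_compact.
exact: continuous_subspaceT.
Qed.

Lemma net_continuous_integrable f : net_continuous f -> net_integrable f.
Proof. by move=> cf e _; exact: continuous_integrable_itv. Qed.

Lemma net_integralD f g : net_integrable f -> net_integrable g ->
  net_integral (fun e t => f e t + g e t) = net_integral f + net_integral g.
Proof.
move=> fi gi; rewrite /net_integral -big_split /=; apply: eq_bigr => e eE.
by rewrite RintegralD//; [exact: fi|exact: gi].
Qed.

Lemma net_integralZ c f : net_integrable f ->
  net_integral (fun e t => c * f e t) = c * net_integral f.
Proof.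
move=> fi; rewrite /net_integral mulr_sumr; apply: eq_bigr => e eE.
by rewrite RintegralZl//; exact: fi.
Qed.

Lemma net_integrableZ c f : net_integrable f ->
  net_integrable (fun e t => c * f e t).
Proof.
move=> fi e eE.
by have := integrableZl (measurable_itv_mR 0 (L e)) c (fi e eE).
Qed.

Lemma net_integrableD f g : net_integrable f -> net_integrable g ->
  net_integrable (fun e t => f e t + g e t).
Proof.
move=> fi gi e eE.
by have := integrableD (measurable_itv_mR 0 (L e)) (fi e eE) (gi e eE).
Qed.

Lemma net_integral_sum (K : finType) (c : K -> R) (f : K -> I -> R -> R) :
  (forall k, net_integrable (f k)) ->
  net_integrable (fun e t => \sum_k c k * f k e t) /\
  net_integral (fun e t => \sum_k c k * f k e t) = \sum_k c k * net_integral (f k).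
Proof.
move=> fi.
have H (s : seq K) : net_integrable (fun e t => \sum_(k <- s) c k * f k e t) /\
  net_integral (fun e t => \sum_(k <- s) c k * f k e t) = \sum_(k <- s) c k * net_integral (f k).
  elim: s => [|k s [IH1 IH2]].
    have -> : (fun e t => \sum_(k <- [::]) c k * f k e t) = (fun _ _ => 0) :> (I -> R -> R).
      by apply/funext => e; apply/funext => t; rewrite big_nil.
    split; first by apply: net_continuous_integrable => e; exact: cst_continuous.
    by rewrite big_nil /net_integral big1// => e _; rewrite Rintegral_cst// mul0r.
  have -> : (fun e t => \sum_(j <- k :: s) c j * f j e t) =
      (fun e t => c k * f k e t + \sum_(j <- s) c j * f j e t) :> (I -> R -> R).
    by apply/funext => e; apply/funext => t; rewrite big_cons.
  split; first by apply: net_integrableD => //; apply: net_integrableZ.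
  rewrite net_integralD//; last exact: net_integrableZ.
  by rewrite big_cons IH2 net_integralZ.
exact: H.
Qed.

Lemma eq_net_integral f g :
  (forall e t, e \in E -> 0 <= t <= L e -> f e t = g e t) ->
  net_integral f = net_integral g.
Proof.
move=> fg; apply: eq_bigr => e eE; apply: eq_Rintegral => t.
by rewrite inE /= in_itv /=; exact: fg.
Qed.

Lemma le_net_integral f g : net_integrable f -> net_integrable g ->
  (forall e t, e \in E -> 0 <= t <= L e -> f e t <= g e t) ->
  net_integral f <= net_integral g.
Proof.
move=> fi gi fg; apply: ler_sum => e eE; apply: le_Rintegral => //.
- exact: fi.
- exact: gi.
by move=> t; rewrite /= in_itv /=; exact: fg.
Qed.

Lemma net_integral_cst c :
  net_integral (fun _ _ => c) = c * \sum_(e in E) L e.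
Proof.
rewrite /net_integral mulr_sumr; apply: eq_bigr => e eE.
rewrite Rintegral_cst//; congr (_ * _).
have := @lebesgue_measure_itv R `[0, L e].
by rewrite /= lte_fin L0// -EFinB subr0 => ->.
Qed.

(** On each edge the primitive from 0 is nonnegative and bounded by the integral over the edge, so
    it is constantly 0; its derivative is [f e]. *)
Lemma net_integral_eq0 f : net_continuous f ->
  (forall e t, e \in E -> 0 <= t <= L e -> 0 <= f e t) -> net_integral f = 0 ->
  forall e t, e \in E -> 0 < t < L e -> f e t = 0.
Proof.
move=> cf f0 /eqP; rewrite psumr_eq0; last first.
  move=> e eE; apply: Rintegral_ge0 => t; rewrite /= in_itv /=; exact: f0.
move=> /allP H e t eE /andP[t0 tL].
have {H}/implyP/(_ eE)/eqP fE := H e (mem_index_enum e).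
have fi a b := @continuous_integrable_itv (f e) a b (cf e).
pose F x := \int[lambda]_(s in `[0, x]) f e s.
have F0 x : 0 <= x <= L e -> F x = 0.
  move=> /andP[x0 xL]; apply/eqP; rewrite eq_le; apply/andP; split; last first.
    apply: Rintegral_ge0 => s; rewrite /= in_itv /= => /andP[s0 sx].
    by apply: f0 => //; rewrite s0 (le_trans sx).
  rewrite -fE -subr_ge0 /F (@Rintegral_itvB _ (f e) (BLeft 0) (BRight (L e)) x)//.
  apply: Rintegral_ge0 => s; rewrite /= in_itv /= => /andP[s0 sx].
  by apply: f0 => //; rewrite sx (le_trans x0)//= ltW.
have [_ <-] := continuous_FTC1_closed tL (fi 0 (L e)) t0 (cf e t).
rewrite derive1E (@near_eq_derive _ _ _ _ (cst 0)) ?derive_cst//.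
have tE : t \in `]0, L e[ by rewrite in_itv /= t0.
apply: filterS (near_in_itvoo tE) => x; rewrite in_itv /= => /andP[x0 xL].
by rewrite -/(F x) F0// !ltW.
Qed.

End NetworkIntegral.

Lemma cvg_sumr (R : realType) (T : Type) (K : finType) (F : set_system T)
    (FF : Filter F) (f : K -> T -> R) (l : K -> R) :
  (forall k, f k x @[x --> F] --> l k) ->
  \sum_k f k x @[x --> F] --> \sum_k l k.
Proof.
by move=> fl; apply: cvg_big => //; exact: add_continuous.
Qed.

(** * Unique solvability of the nonlinear system for independent continuous functions *)

Section NonlinearSystem.
Context {R : realType} {I K : finType}.
Variables (E : {set I}) (L : I -> R) (B : K -> I -> R -> R) (q : R).
Hypothesis L0 : forall e, e \in E -> 0 < L e.
Hypothesis cB : forall k, net_continuous (B k).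
Hypothesis q1 : 1 < q.
Hypothesis freeB : forall c : K -> R,
  (forall e t, e \in E -> 0 < t < L e -> \sum_k c k * B k e t = 0) ->
  forall k, c k = 0.

Let q10 : 0 < q - 1. Proof. by rewrite subr_gt0. Qed.

Let q0 : 0 < q. Proof. exact: lt_trans ltr01 q1. Qed.

Notation lambda := (@lebesgue_measure R).
Notation netI := (net_integral E L).
Notation comb c := (fun e t => \sum_k c k * B k e t).

Lemma comb_continuous (c : K -> R) : net_continuous (comb c).
Proof.
move=> e t; rewrite /continuous_at.
apply: (@cvg_sumr _ _ _ _ _ (fun k x => c k * B k e x) (fun k => c k * B k e t)) => k.
by apply: cvgM; [exact: cvg_cst|exact: cB].
Qed.

Lemma spow_comb_continuous (c : K -> R) :
  net_continuous (fun e t => spow (q - 1) (\sum_k c k * B k e t)).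
Proof.
move=> e t; apply: (@continuous_comp _ _ _ (comb c e) (spow (q - 1))).
  exact: comb_continuous.
exact: spow_continuous.
Qed.

Lemma spow_combM_continuous (c : K -> R) l :
  net_continuous (fun e t => spow (q - 1) (\sum_k c k * B k e t) * B l e t).
Proof.
by move=> e t; apply: cvgM; [exact: spow_comb_continuous|exact: cB].
Qed.

Lemma powR_comb_continuous (c : K -> R) :
  net_continuous (fun e t => `|\sum_k c k * B k e t| `^ q).
Proof.
move=> e t; apply: (@continuous_comp _ _ _ (comb c e) (fun x => `|x| `^ q)).
  exact: comb_continuous.
exact: powR_norm_continuous.
Qed.

(** Monotonicity: combining the equations with the coefficients [a k - b k] gives integral 0 for the
    product of the differences of the signed powers and of their arguments. This product is
    nonnegative and vanishes only where the two combinations agree, so independence applies. *)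
Lemma nonlinear_system_unique (a b : K -> R) :
  (forall l, netI (fun e t => spow (q - 1) (comb a e t) * B l e t) =
             netI (fun e t => spow (q - 1) (comb b e t) * B l e t)) ->
  forall k, a k = b k.
Proof.
move=> H k; apply/eqP; rewrite -subr_eq0; apply/eqP; move: k.
pose h e t := (spow (q - 1) (comb a e t) - spow (q - 1) (comb b e t)) *
  (comb a e t - comb b e t).
have ch : net_continuous h.
  move=> e t; apply: cvgM; apply: cvgB;
    by [exact: spow_comb_continuous|exact: comb_continuous].
have h_gt0 e t : comb a e t != comb b e t -> 0 < h e t.
  rewrite /h; have [xy|xy|//] := ltgtP (comb a e t) (comb b e t) => _.
    by rewrite nmulr_rgt0 subr_lt0//; apply: spow_lt.
  by rewrite pmulr_rgt0 subr_gt0//; apply: spow_lt.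
have h0 e t : 0 <= h e t.
  have [ab|/h_gt0/ltW//] := eqVneq (comb a e t) (comb b e t).
  by rewrite /h ab !subrr mulr0.
have ia c l : net_integrable E L (fun e t => spow (q - 1) (comb c e t) * B l e t).
  by apply: net_continuous_integrable; exact: spow_combM_continuous.
have [i1 e1] := net_integral_sum (fun k => a k - b k) (ia a).
have [i2 e2] := net_integral_sum (fun k => a k - b k) (ia b).
have hI : netI h = 0.
  transitivity (netI (fun e t =>
     \sum_k (a k - b k) * (spow (q - 1) (comb a e t) * B k e t) +
     (-1) * \sum_k (a k - b k) * (spow (q - 1) (comb b e t) * B k e t))).
    apply: eq_net_integral => e t _ _; rewrite /h mulN1r -sumrB -sumrB mulr_sumr.
    by apply: eq_bigr => k _; ring.
  rewrite net_integralD//; last exact: net_integrableZ.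
  rewrite net_integralZ// e1 e2 mulN1r -sumrB big1// => k _.
  by rewrite H subrr.
have hz := net_integral_eq0 ch (fun e t _ _ => h0 e t) hI.
apply: freeB => e t eE tL.
have /eqP : comb a e t = comb b e t.
  by apply/eqP; apply: contraT => /h_gt0; rewrite hz// ltxx.
rewrite -subr_eq0 -sumrB => /eqP; under eq_bigr do rewrite -mulrBl.
by [].
Qed.

(** Coefficients become row vectors so that bounded closed sets of them are compact. *)
Let N := #|K|.
Let co (x : 'rV[R]_N) (k : K) : R := x ord0 (enum_rank k).
(* Locked because conversion checks that unfold it do not terminate in practice. *)
Fact powI_key : unit. Proof. by []. Qed.
Let P : 'rV[R]_N -> R :=
  locked_with powI_key (fun x => netI (fun e t => `|comb (co x) e t| `^ q)).

Lemma PE x : P x = netI (fun e t => `|comb (co x) e t| `^ q).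
Proof. by rewrite /P unlock. Qed.

Lemma comb_bound : exists2 C, 0 < C & forall x e t, e \in E -> 0 <= t <= L e ->
  `|comb (co x) e t| <= C * `|x|.
Proof.
have bk (ke : K * I) : exists M, forall t, 0 <= t <= L ke.2 -> `|B ke.1 ke.2 t| <= M.
  case: (leP 0 (L ke.2)) => L2; last first.
    by exists 0 => t /andP[t0 tL]; exfalso; lra.
  have cn : {within `[0, L ke.2], continuous (Num.norm \o B ke.1 ke.2)}.
    apply: continuous_subspaceT => t; apply: continuous_comp; first exact: cB.
    exact: norm_continuous.
  have [s _ sM] := EVT_max L2 cn.
  by exists `|B ke.1 ke.2 s| => t tL; apply: sM; rewrite in_itv.
have [M MP] := choice bk.
exists (1 + \sum_k \sum_(e in E) `|M (k, e)|).
  by rewrite ltr_pwDl// sumr_ge0// => k _; rewrite sumr_ge0.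
move=> x e t eE tL.
apply: (@le_trans _ _ (\sum_k `|x| * `|M (k, e)|)).
  apply: (le_trans (ler_norm_sum _ _ _)); apply: ler_sum => k _.
  rewrite normrM ler_pM//.
    rewrite /co /Num.norm /= mx_normrE.
    exact: (@le_bigmax _ _ _ 0 (fun ij : 'I_1 * 'I_N => `|x ij.1 ij.2|) (ord0, enum_rank k)).
  by apply: (le_trans (MP (k, e) t tL)); exact: ler_norm.
rewrite -mulr_sumr mulrC ler_wpM2r// ler_wpDl//.
apply: ler_sum => k _; rewrite (bigD1 e)//= lerDl sumr_ge0//.
Qed.

(** The tangent inequality bounds [|u| ^ q - |v| ^ q] by [q * |u| ^ (q - 1) * |u - v|]. Here
    [|u| <= C * r] and [|u - v| <= C * |x - y|], which explains the constant [D]. *)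
Lemma P_lip r : 0 < r -> exists2 M, 0 <= M & forall x y, `|x| <= r -> `|y| <= r ->
  P x - P y <= M * `|x - y|.
Proof.
move=> r0; have [C C0 HC] := comb_bound.
pose D := q * ((C * r) `^ (q - 1) * C).
have D0 : 0 <= D by rewrite !mulr_ge0 ?powR_ge0// ltW.
have SL : 0 <= \sum_(e in E) L e by apply: sumr_ge0 => e /L0/ltW.
exists (D * \sum_(e in E) L e); first by rewrite mulr_ge0.
move=> x y xr yr.
have fi c : net_integrable E L (fun e t => `|comb c e t| `^ q).
  by apply: net_continuous_integrable; exact: powR_comb_continuous.
have -> : D * (\sum_(e in E) L e) * `|x - y| = netI (fun _ _ => D * `|x - y|).
  by rewrite net_integral_cst//; ring.
rewrite !PE -mulN1r -net_integralZ// -net_integralD//; last exact: net_integrableZ.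
apply: le_net_integral.
- by apply: net_integrableD => //; apply: net_integrableZ.
- by apply: net_continuous_integrable => e; exact: cst_continuous.
move=> e t eE tL.
have cxy : comb (co x) e t - comb (co y) e t = comb (co (x - y)) e t.
  by rewrite -sumrB; apply: eq_bigr => k _; rewrite /co !mxE mulrBl.
have key (u v : R) : `|u| `^ q + -1 * `|v| `^ q <= q * (spow (q - 1) u * (u - v)).
  have := powR_convex v u q1; rewrite -(opprB u v) !mulrN; lra.
apply: (le_trans (key _ _)).
rewrite /D -mulrA -mulrA ler_pM2l//.
rewrite (le_trans (ler_norm _))// normrM norm_spow// cxy.
apply: ler_pM; rewrite ?powR_ge0 ?normr_ge0//; last exact: HC.
apply: ge0_ler_powR; rewrite ?nnegrE ?(ltW q10)//; first by rewrite mulr_ge0// ltW.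
by rewrite (le_trans (HC _ _ _ eE tL))// ler_pM2l.
Qed.

Lemma P_continuous : continuous P.
Proof.
move=> x; have r0 : 0 < `|x| + 1 by rewrite ltr_pwDr.
have [M M0 HM] := P_lip r0.
apply/(@cvgrPdist_lt _ _ _ (nbhs x) (nbhs_filter x) P (P x)) => e e0.
have d0 : 0 < e / (M + 1) by rewrite divr_gt0//; lra.
have m0 : 0 < Num.min 1 (e / (M + 1)) by rewrite lt_min ltr01.
apply: filterS (nbhsx_ballx x _ m0) => y; rewrite -ball_normE /= lt_min => /andP[y1 yx].
have yr : `|y| <= `|x| + 1.
  have := ler_distD x y 0; rewrite !subr0 => /le_trans; apply.
  by rewrite distrC addrC lerD2l ltW.
have xr : `|x| <= `|x| + 1 by rewrite lerDl.
have h1 := HM _ _ xr yr; have h2 := HM _ _ yr xr.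
rewrite (distrC y x) in h2.
move: h1 h2 yx; move: (P x) (P y) `|x - y| (normr_ge0 (x - y)) => a b c c0 h1 h2 yx.
apply: (@le_lt_trans _ _ (M * c)); first by rewrite ler_norml; apply/andP; split; lra.
move: yx; rewrite ltr_pdivlMr; last by lra.
nra.
Qed.

Lemma PZ c x : P (c *: x) = `|c| `^ q * P x.
Proof.
rewrite !PE -net_integralZ; last first.
  by apply: net_continuous_integrable; exact: powR_comb_continuous.
apply: eq_net_integral => e t _ _; rewrite -powRM// -normrM mulr_sumr.
by congr (`|_| `^ _); apply: eq_bigr => k _; rewrite /co mxE mulrA.
Qed.

(** By independence the minimum of [P] on the unit sphere is positive, and homogeneity of degree [q]
    spreads this bound to all vectors. *)
Lemma P_coercive : exists2 m, 0 < m & forall x, m * `|x| `^ q <= P x.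
Proof.
have P0 x : 0 <= P x.
  by rewrite PE; apply: sumr_ge0 => e _; apply: Rintegral_ge0 => t _; exact: powR_ge0.
pose A := [set x : 'rV[R]_N | `|x| = 1].
(* The sphere is empty only if there are no unknowns; then [x = 0] is the only vector. *)
have [A0|/set0P An] := eqVneq A set0.
  exists 1; first exact: ltr01.
  move=> x; have [->|x0] := eqVneq x 0.
    by rewrite normr0 powR0 ?gt_eqF// mulr0 P0.
  suff : A (`|x|^-1 *: x) by rewrite A0.
  by rewrite /A /= normrZ normfV normr_id mulVf// normr_eq0.
have cA : compact A.
  apply: bounded_closed_compact.
    by exists 1; split => // M M1 x /= ->; exact: ltW.
  rewrite (_ : A = (fun x => `|x|) @^-1` [set 1])//.
  by apply: closed_comp => [x _|]; [exact: norm_continuous|exact: closed_eq].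
have [c /set_mem/= cA1 cmin] := compact_EVT_min An cA (continuous_subspaceT P_continuous).
have Pc : 0 < P c.
  rewrite lt_neqAle P0 andbT; apply/negP => /eqP; rewrite PE => Pc0.
  have z := net_integral_eq0 (@powR_comb_continuous (co c))
    (fun e t _ _ => powR_ge0 _ _) (esym Pc0).
  have c0 : c = 0.
    apply/rowP => i; rewrite mxE -(enum_valK i).
    apply: (freeB (c := co c)) => e t eE tL; apply/normr0_eq0.
    exact: powR_eq0_eq0 (z e t eE tL).
  by move: cA1; rewrite /A /= c0 normr0 => /eqP; rewrite eq_sym oner_eq0.
exists (P c); first exact: Pc.
move=> x; have [->|x0] := eqVneq x 0.
  by rewrite normr0 powR0 ?gt_eqF// mulr0 P0.
have nx : `|x| != 0 by rewrite normr_eq0.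
have -> : P x = `|x| `^ q * P (`|x|^-1 *: x).
  by have := PZ `|x| (`|x|^-1 *: x); rewrite normr_id scalerA divff// scale1r.
rewrite mulrC; apply: ler_wpM2l; first exact: powR_ge0.
by apply: cmin; rewrite inE /A /= normrZ normfV normr_id mulVf.
Qed.

(* The system is the Euler equation of this coercive functional. *)
Lemma J_minimum (d : K -> R) : exists x0, forall x,
  P x0 / q - \sum_k co x0 k * d k <= P x / q - \sum_k co x k * d k.
Proof.
have [m m0 Hm] := P_coercive.
pose D := \sum_k `|d k|.
have D0 : 0 <= D by apply: sumr_ge0.
(* Chosen so that [m * r ^ (q - 1) = (D + 1) * q]. For [|x| >= r] the term [P x / q] is then at
   least [(D + 1) * |x|] and dominates the linear term, so [J x >= 0 = J 0] and the minimum over the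
   ball is global. *)
pose r := ((D + 1) * q / m) `^ (q - 1)^-1.
have r0 : 0 < r by rewrite powR_gt0// divr_gt0// mulr_gt0// ltr_wpDl.
pose J x := P x / q - \sum_k co x k * d k.
have Jbig x : r <= `|x| -> 0 <= J x.
  move=> rx.
  have x0 : 0 < `|x| by rewrite (lt_le_trans r0).
  have h1 : \sum_k co x k * d k <= `|x| * D.
    rewrite mulr_sumr; apply: ler_sum => k _.
    rewrite (le_trans (ler_norm _))// normrM ler_wpM2r//.
    rewrite /co /Num.norm /= mx_normrE.
    exact: (@le_bigmax _ _ _ 0 (fun ij : 'I_1 * 'I_N => `|x ij.1 ij.2|) (ord0, enum_rank k)).
  have h2 : (D + 1) * q / m <= `|x| `^ (q - 1).
    have -> : (D + 1) * q / m = r `^ (q - 1).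
      by rewrite /r -powRrM mulVf ?gt_eqF// powRr1// divr_ge0 ?mulr_ge0 ?addr_ge0// ltW.
    by apply: (ge0_ler_powR (ltW q10)); rewrite ?nnegrE// ltW.
  have h3 := Hm x.
  rewrite -mulr_powRB1// in h3.
  rewrite ler_pdivrMr// in h2.
  rewrite /J subr_ge0 (le_trans h1)// ler_pdivlMr//.
  apply: le_trans h3.
  have -> : m * (`|x| * `|x| `^ (q - 1)) = `|x| * (`|x| `^ (q - 1) * m) by ring.
  by rewrite -mulrA ler_pM2l//; apply: le_trans h2; rewrite ler_pM2r// lerDl.
pose A := [set x : 'rV[R]_N | `|x| <= r].
have cA : compact A.
  apply: bounded_closed_compact.
    exists r; split; first by rewrite num_real.
    by move=> M M1 x /= xr; rewrite (le_trans xr)// ltW.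
  rewrite (_ : A = (fun x => `|x|) @^-1` [set y | y <= r])//.
  by apply: closed_comp => [x _|]; [exact: norm_continuous|exact: closed_le].
have cJ : continuous J.
  move=> x; pose S (y : 'rV[R]_N) := \sum_k co y k * d k.
  have FF : Filter (nbhs x) := nbhs_filter x.
  have c1 : P y / q @[y --> x] --> P x / q.
    exact: (@cvgM R _ (nbhs x) FF P (cst q^-1) (P x) q^-1 (@P_continuous x) (@cvg_cst _ _ _ _ FF)).
  have c2 : S y @[y --> x] --> S x.
    apply: (@cvg_sumr _ _ _ _ (nbhs_filter x) (fun k y => co y k * d k) (fun k => co x k * d k)) => k.
    exact: (cvgM (@coord_continuous _ _ _ _ _ x) (cvg_cst _)).
  exact: (@cvgB R R^o _ (nbhs x) FF (fun y => P y / q) S (P x / q) (S x) c1 c2).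
have A0 : A 0 by rewrite /A /= normr0 ltW.
have J0 : J 0 = 0.
  rewrite /J PE (_ : netI _ = 0) ?mul0r ?sub0r.
    by rewrite big1 ?oppr0// => k _; rewrite /co mxE mul0r.
  rewrite /net_integral big1// => e _.
  rewrite (@eq_Rintegral _ _ _ _ _ (cst 0)).
    by rewrite Rintegral_cst ?mul0r//; exact: measurable_itv.
  move=> t _ /=; rewrite big1 ?normr0 ?powR0 ?gt_eqF// => k _.
  by rewrite /co mxE mul0r.
have [c cA1 cmin] := compact_EVT_min (ex_intro _ _ A0) cA (continuous_subspaceT cJ).
exists c => x; rewrite -!/(J _).
have [xr|rx] := leP `|x| r; first by apply: cmin; rewrite inE.
apply: (@le_trans _ _ 0); last by apply: Jbig; exact: ltW.
by rewrite -J0; apply: cmin; rewrite inE.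
Qed.

Lemma shifted_continuous (a : K -> R) l : continuous (fun s : R =>
  netI (fun e t => spow (q - 1) (comb a e t + s * B l e t) * B l e t)).
Proof.
have cst' s : net_continuous (fun e t => spow (q - 1) (comb a e t + s * B l e t)).
  move=> e t; apply: (@continuous_comp _ _ _ (fun t => comb a e t + s * B l e t) (spow (q - 1))).
    apply: cvgD; first exact: comb_continuous.
    by apply: cvgM; [exact: cvg_cst|exact: cB].
  exact: spow_continuous.
move=> s0; rewrite /net_integral.
have H e : e \in E -> {for s0, continuous (fun s : R =>
    \int[lambda]_(t in `[0, L e]) (spow (q - 1) (comb a e t + s * B l e t) * B l e t))}.
  move=> eE.
  have s0I : s0 \in `]s0 - 1, s0 + 1[%classic.
    by rewrite inE /= in_itv /=; apply/andP; split; lra.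
  (* The dominating function for [s] between [s0 - 1] and [s0 + 1], where [|s| <= |s0| + 1]. *)
  pose bd t := spow (q - 1) (`|comb a e t| + (`|s0| + 1) * `|B l e t|) * `|B l e t|.
  apply: (@continuity_under_integral R _ _ lambda
    (fun s t => spow (q - 1) (comb a e t + s * B l e t) * B l e t) _ _ (s0 - 1) (s0 + 1) _ _ bd) => //.
  - move=> s _; apply: continuous_integrable_itv => t.
    by apply: cvgM; [exact: cst'|exact: cB].
  - apply: aeW => t _ s _.
    have c1 : {for s, continuous (fun s : R => spow (q - 1) (comb a e t + s * B l e t))}.
      apply: (@continuous_comp _ _ _ (fun s : R => comb a e t + s * B l e t) (spow (q - 1))).
        by apply: cvgD; [exact: cvg_cst|apply: cvgM; [exact: cvg_id|exact: cvg_cst]].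
      exact: spow_continuous.
    exact: (cvgM c1 (cvg_cst _)).
  - apply: continuous_integrable_itv => t.
    have c2 : {for t, continuous (fun t : R => `|B l e t|)}.
      by apply: cvg_norm; exact: cB.
    have c1 : {for t, continuous (fun t : R => `|comb a e t| + (`|s0| + 1) * `|B l e t|)}.
      apply: cvgD; first by apply: cvg_norm; exact: comb_continuous.
      by apply: cvgM; [exact: cvg_cst|exact: c2].
    have c3 := continuous_comp c1 (@spow_continuous _ _ q10 _).
    exact: (cvgM c3 c2).
  move=> s sI; apply: aeW => t _; rewrite normrM norm_spow// /bd.
  rewrite spow_ge0E; [|exact: q10|by rewrite addr_ge0// mulr_ge0// addr_ge0].
  apply: ler_wpM2r => //; apply: ge0_ler_powR; rewrite ?nnegrE//; first exact: ltW.
  rewrite (le_trans (ler_normD _ _))// lerD2l normrM ler_wpM2r//.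
  move: sI; rewrite /= in_itv /= => /andP[s1 s2].
  have := ler_norm s0; have := ler_norm (- s0); rewrite normrN ler_norml => *.
  by apply/andP; split; lra.
rewrite /continuous_at.
have {}H : forall e, (if e \in E then \int[lambda]_(t in `[0, L e])
    (spow (q - 1) (comb a e t + s * B l e t) * B l e t) else 0) @[s --> s0] -->
   (if e \in E then \int[lambda]_(t in `[0, L e])
    (spow (q - 1) (comb a e t + s0 * B l e t) * B l e t) else 0).
  by move=> e; case: ifPn => [/H//|_]; exact: cvg_cst.
under eq_cvg do rewrite big_mkcond /=.
rewrite big_mkcond /=.
exact: (cvg_sumr (nbhs_filter s0) H).
Qed.

(** The functional is not differentiated. The tangent inequality at the point shifted by [s] in the
    coordinate [l] bounds the increase of the functional by [s * (G s - d l)], and minimality makes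
    this nonnegative for every [s]. *)
Lemma nonlinear_system_exists (d : K -> R) : exists a : K -> R, forall l,
  netI (fun e t => spow (q - 1) (comb a e t) * B l e t) = d l.
Proof.
have [x0 Hx0] := J_minimum d; exists (co x0) => l.
pose G (s : R) := netI (fun e t => spow (q - 1) (comb (co x0) e t + s * B l e t) * B l e t).
have -> : netI (fun e t => spow (q - 1) (comb (co x0) e t) * B l e t) = G 0.
  by apply: eq_net_integral => e t _ _; rewrite mul0r addr0.
have cE s e t : comb (co (x0 + s *: delta_mx ord0 (enum_rank l))) e t =
    comb (co x0) e t + s * B l e t.
  rewrite -[s * B l e t](_ : \sum_k s * (k == l)%:R * B k e t = _).
    rewrite -big_split /=; apply: eq_bigr => k _.
    by rewrite /co !mxE eqxx /= (inj_eq enum_rank_inj) mulrDl.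
  rewrite (bigD1 l)//= eqxx mulr1 big1 ?addr0// => k /negbTE ->.
  by rewrite mulr0 mul0r.
have HG s : 0 <= s * (G s - d l).
  have := Hx0 (x0 + s *: delta_mx ord0 (enum_rank l)).
  have -> : \sum_k co (x0 + s *: delta_mx ord0 (enum_rank l)) k * d k =
      \sum_k co x0 k * d k + s * d l.
    rewrite -[s * d l](_ : \sum_k s * (k == l)%:R * d k = _).
      rewrite -big_split /=; apply: eq_bigr => k _.
      by rewrite /co !mxE eqxx /= (inj_eq enum_rank_inj) mulrDl.
    rewrite (bigD1 l)//= eqxx mulr1 big1 ?addr0// => k /negbTE ->.
    by rewrite mulr0 mul0r.
  have : P (x0 + s *: delta_mx ord0 (enum_rank l)) - P x0 <= (q * s) * G s.
    have fi c : net_integrable E L (fun e t => `|comb c e t| `^ q).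
      by apply: net_continuous_integrable; exact: powR_comb_continuous.
    have fG : net_integrable E L (fun e t => spow (q - 1) (comb (co x0) e t + s * B l e t) * B l e t).
      apply: net_continuous_integrable => e t; apply: cvgM; last exact: cB.
      apply: (@continuous_comp _ _ _ (fun t => comb (co x0) e t + s * B l e t) (spow (q - 1))).
        apply: cvgD; first exact: comb_continuous.
        by apply: cvgM; [exact: cvg_cst|exact: cB].
      exact: spow_continuous.
    rewrite !PE -[- net_integral _ _ _]mulN1r /G -!net_integralZ// -net_integralD//; last exact: net_integrableZ.
    apply: le_net_integral.
    - by apply: net_integrableD => //; exact: net_integrableZ.
    - exact: net_integrableZ.
    move=> e t _ _; rewrite cE.
    have := powR_convex (comb (co x0) e t) (comb (co x0) e t + s * B l e t) q1.
    set u := comb (co x0) e t + _; set v := comb (co x0) e t.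
    have -> : v - u = - (s * B l e t) by rewrite /u /v opprD addrA subrr sub0r.
    rewrite !mulrN => h.
    have -> : q * s * (spow (q - 1) u * B l e t) = q * (spow (q - 1) u * (s * B l e t)) by ring.
    lra.
  set P1 := P (_ + _); set P2 := P x0; set D := \sum_k _ => h1 h2.
  have h3 : P2 / q - D <= P1 / q - (D + s * d l) by [].
  have h4 : (P1 - P2) / q <= s * G s.
    by rewrite ler_pdivrMr// (_ : s * G s * q = q * s * G s)//; ring.
  rewrite mulrBr subr_ge0; apply: le_trans h4; rewrite mulrBl; lra.
have cG : G s @[s --> 0] --> G 0 := @shifted_continuous (co x0) l 0.
(* [HG] gives [G s >= d l] for [s > 0] and [G s <= d l] for [s < 0]. If [G 0] differed from [d l],
   continuity would contradict this at [- (r / 2)] or at [r / 2]. *)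
apply/eqP; rewrite eq_le; apply/andP; split; rewrite leNgt; apply/negP => lt0.
  have e0 : 0 < G 0 - d l by rewrite subr_gt0.
  have /cvgrPdist_lt/(_ _ e0) [r /= r0 Hr] := cG.
  have := Hr (- (r / 2)); rewrite /= sub0r opprK ger0_norm; last lra.
  have r2 : r / 2 < r by lra.
  move=> /(_ r2); rewrite ltr_norml => /andP[_ h].
  have := HG (- (r / 2)); rewrite mulNr oppr_ge0 pmulr_rle0; lra.
have e0 : 0 < d l - G 0 by rewrite subr_gt0.
have /cvgrPdist_lt/(_ _ e0) [r /= r0 Hr] := cG.
have := Hr (r / 2); rewrite /= sub0r normrN ger0_norm; last lra.
have r2 : r / 2 < r by lra.
move=> /(_ r2); rewrite ltr_norml => /andP[h _].
have := HG (r / 2); rewrite pmulr_rge0; lra.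
Qed.

End NonlinearSystem.

(** * C^1 functions on the plane *)

Section PlaneCalculus.
Context {R : realType}.
Implicit Types (F G : R * R -> R) (P Q : R * R) (f g : R -> R).

Lemma is_derive_cvgE f x l : is_derive x (1 : R) f l ->
  (f s - f x) / (s - x) @[s --> x^'] --> l.
Proof.
move=> [/cvg_ex[l' H]]; rewrite /derive (cvg_lim _ H)// => <-.
apply/cvgrPdist_lt => e e0; have /cvgrPdist_lt/(_ _ e0) := H.
rewrite /= !near_withinE => -[d d0 {}H]; exists d => //= s /= xs sx.
have := H (s - x); rewrite /= sub0r normrN distrC => /(_ xs).
by rewrite subr_eq0 => /(_ sx); rewrite scaler1 subrK mulrC.
Qed.

Lemma is_deriveP f x l : is_derive x (1 : R) f l <->
  forall e, 0 < e -> \forall s \near x, `|f s - f x - l * (s - x)| <= e * `|s - x|.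
Proof.
have E s : s != x -> `|l - (f s - f x) / (s - x)| * `|s - x| =
    `|f s - f x - l * (s - x)|.
  rewrite -subr_eq0 => sx; rewrite -normrM -normrN.
  by congr `|_|; field.
split=> [/is_derive_cvgE H e e0|H].
  have /cvgrPdist_le/(_ _ e0) := H; rewrite near_withinE; apply: filterS => s Hs.
  have [->|sx] := eqVneq s x; first by rewrite !subrr mulr0 subr0 normr0 mulr0.
  by rewrite -E// ler_wpM2r// Hs.
apply: is_derive_cvg; apply/cvgrPdist_le => e e0.
rewrite near_withinE; apply: filterS (H e e0) => s + sx.
by rewrite -E// ler_pM2r// normr_gt0 subr_eq0.
Qed.

(** Differentiability at a point of the plane with a non-strict error bound in the maximum norm. The
    bound holds trivially at [Q = P], so no punctured neighbourhood is needed. *)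
Definition grad_at F P (a b : R) := forall e, 0 < e ->
  \forall Q \near P,
    `|F Q - F P - (a * (Q.1 - P.1) + b * (Q.2 - P.2))| <= e * `|Q - P|.

Lemma norm_fst_le P : `|P.1| <= `|P|.
Proof. by rewrite [`|P|]prod_normE le_max lexx. Qed.

Lemma norm_snd_le P : `|P.2| <= `|P|.
Proof. by rewrite [`|P|]prod_normE le_max lexx orbT. Qed.

Lemma grad_eq F P a b a' b' : grad_at F P a b -> a = a' -> b = b' ->
  grad_at F P a' b'.
Proof. by move=> H <- <-. Qed.

Lemma grad_affine (a b c : R) P : grad_at (fun Q => a * Q.1 + b * Q.2 + c) P a b.
Proof.
move=> e e0; apply: (@nearW _ (nbhs P)) => Q.
rewrite [X in `|X|](_ : _ = 0); last by ring.
by rewrite normr0 mulr_ge0// ltW.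
Qed.

Lemma gradD F G P a b c d : grad_at F P a b -> grad_at G P c d ->
  grad_at (fun Q => F Q + G Q) P (a + c) (b + d).
Proof.
move=> HF HG e e0; have e2 : 0 < e / 2 by lra.
apply: filterS2 (HF _ e2) (HG _ e2) => Q h1 h2.
rewrite (_ : F Q + G Q - _ - _ =
  (F Q - F P - (a * (Q.1 - P.1) + b * (Q.2 - P.2))) +
  (G Q - G P - (c * (Q.1 - P.1) + d * (Q.2 - P.2)))); last by ring.
rewrite (le_trans (ler_normD _ _))// (le_trans (lerD h1 h2))//.
by rewrite -mulrDl -splitr.
Qed.

Lemma grad_lip F P a b : grad_at F P a b ->
  \forall Q \near P, `|F Q - F P| <= (`|a| + `|b| + 1) * `|Q - P|.
Proof.
move=> /(_ 1 ltr01); apply: filterS => Q h.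
have h1 : `|a * (Q.1 - P.1)| <= `|a| * `|Q - P|.
  by rewrite normrM ler_wpM2l//; exact: (norm_fst_le (Q - P)).
have h2 : `|b * (Q.2 - P.2)| <= `|b| * `|Q - P|.
  by rewrite normrM ler_wpM2l//; exact: (norm_snd_le (Q - P)).
rewrite -[F Q - F P](subrK (a * (Q.1 - P.1) + b * (Q.2 - P.2))).
rewrite (le_trans (ler_normD _ _))// !mulrDl addrC lerD//.
by rewrite (le_trans (ler_normD _ _))// lerD.
Qed.

Lemma grad_continuous F P a b : grad_at F P a b -> {for P, continuous F}.
Proof.
move=> /grad_lip H; apply/cvgrPdist_lt => e e0.
have d0 : 0 < e / (`|a| + `|b| + 1) by rewrite divr_gt0// ltr_wpDl// addr_ge0.
apply: filterS2 H (nbhsx_ballx P _ d0) => Q h; rewrite -ball_normE /= => PQ.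
rewrite distrC (le_lt_trans h)// distrC mulrC -ltr_pdivlMr//.
Qed.

Lemma grad_comp f l F P a b : is_derive (F P) (1 : R) f l -> grad_at F P a b ->
  grad_at (f \o F) P (l * a) (l * b).
Proof.
move=> /is_deriveP Hf HF e e0.
pose K := `|a| + `|b| + 1.
have K0 : 0 < K by rewrite ltr_wpDl// addr_ge0.
have e1 : 0 < e / 2 / K by rewrite !divr_gt0.
have e2 : 0 < e / 2 / (`|l| + 1) by rewrite !divr_gt0// ltr_wpDl.
have cF := grad_continuous HF.
have n1 : \forall Q \near P, `|f (F Q) - f (F P) - l * (F Q - F P)| <=
    e / 2 / K * `|F Q - F P| := cF _ (Hf _ e1).
apply: filterS3 n1 (HF _ e2) (grad_lip HF) => Q /= h1 h2 h3.
rewrite (_ : _ - _ - _ = (f (F Q) - f (F P) - l * (F Q - F P)) +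
  l * (F Q - F P - (a * (Q.1 - P.1) + b * (Q.2 - P.2)))); last by ring.
rewrite (le_trans (ler_normD _ _))// normrM.
have g1 : e / 2 / K * `|F Q - F P| <= e / 2 * `|Q - P|.
  rewrite (_ : e / 2 * `|Q - P| = e / 2 / K * (K * `|Q - P|)).
    by rewrite ler_pM2l.
  by field; rewrite gt_eqF.
rewrite [leRHS](_ : _ = e / 2 * `|Q - P| + e / 2 * `|Q - P|); last by field.
apply: lerD; first by rewrite (le_trans h1).
rewrite (le_trans (ler_wpM2l (normr_ge0 l) h2))// mulrA ler_wpM2r//.
rewrite mulrCA ler_piMr//; first by lra.
by rewrite ler_pdivrMr ?mul1r ?lerDl// ltr_wpDl.
Qed.

End PlaneCalculus.

(** * Sums, products and compositions of C^1 functions *)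

Section PlaneC1.
Context {R : realType}.
Implicit Types (F G : R * R -> R) (P Q : R * R) (f g : R -> R).

Lemma is_derive_quad f x l K :
  (forall s, `|f s - f x - l * (s - x)| <= K * (s - x) ^+ 2) ->
  is_derive x (1 : R) f l.
Proof.
move=> H; apply/is_deriveP => e e0.
have d0 : 0 < e / (`|K| + 1) by rewrite divr_gt0// ltr_wpDl.
apply: filterS (nbhsx_ballx x _ d0) => s; rewrite -ball_normE /= => sx.
rewrite (le_trans (H s))// -real_normK ?num_real// expr2 mulrA ler_wpM2r//.
rewrite ltr_pdivlMr in sx; last by rewrite ltr_wpDl.
apply: le_trans (ltW sx); rewrite (distrC x) mulrC ler_wpM2l//.
by rewrite (le_trans (ler_norm K))// lerDl.
Qed.

Lemma is_derive_sqr x : is_derive x (1 : R) (fun u => u ^+ 2) (2 * x).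
Proof.
apply: (@is_derive_quad _ _ _ 1) => s.
rewrite (_ : _ - _ - _ = (s - x) ^+ 2); last by ring.
by rewrite mul1r ger0_norm// sqr_ge0.
Qed.

Lemma is_derive_affine x (a b : R) : is_derive x (1 : R) (fun u => a * u + b) a.
Proof.
apply: (@is_derive_quad _ _ _ 0) => s.
rewrite (_ : _ - _ - _ = 0); last by ring.
by rewrite mul0r normr0.
Qed.

(** A C^1 truncated square. The bump profile is [sqpos (1 - t ^+ 2)], which is 1 at [t = 0] and 0
    for [|t| >= 1]. *)
Definition sqpos (u : R) : R := Num.max 0 u ^+ 2.

Lemma is_derive_sqpos x : is_derive x (1 : R) sqpos (2 * Num.max 0 x).
Proof.
apply: (@is_derive_quad _ _ _ 1) => s; rewrite /sqpos mul1r.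
have := sqr_ge0 (s - x); rewrite ler_norml.
by case: (leP 0 s) => s0; case: (leP 0 x) => x0 sx; apply/andP; split; nra.
Qed.

(** Up to the factor 4, the second and third bounds concern the derivative of the profile and [t]
    times that derivative. They hold for all [t], which is needed where [t] has no limit. *)
Lemma sqpos_bound (t : R) :
  [/\ 0 <= sqpos (1 - t ^+ 2) <= 1, `|t * Num.max 0 (1 - t ^+ 2)| <= 1 &
      `|t * (t * Num.max 0 (1 - t ^+ 2))| <= 1].
Proof.
rewrite /sqpos; case: (leP 0 (1 - t ^+ 2)) => h; last first.
  by rewrite !mulr0 normr0 expr0n /= lexx ler01; split.
have t1 : `|t| <= 1 by rewrite -(@ler_pXn2r _ 2) ?nnegrE// expr1n real_normK ?num_real// -subr_ge0.
split.
- by apply/andP; split; nra.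
- by rewrite ler_norml; move: t1; rewrite ler_norml => /andP[? ?]; apply/andP; split; nra.
- by rewrite ler_norml; move: t1; rewrite ler_norml => /andP[? ?]; apply/andP; split; nra.
Qed.

Lemma sqpos_continuous : continuous sqpos.
Proof.
move=> x; apply: differentiable_continuous; apply/derivable1_diffP.
by have [] := is_derive_sqpos x.
Qed.

Lemma grad_ext F G P a b : F =1 G -> grad_at F P a b -> grad_at G P a b.
Proof. by move=> /funext ->. Qed.

(** Polarization: a product is a quarter of the difference of the squares of [F + G] and [F - G], so
    sums and compositions suffice. *)
Lemma gradM F G P a b c d : grad_at F P a b -> grad_at G P c d ->
  grad_at (fun Q => F Q * G Q) P (F P * c + G P * a) (F P * d + G P * b).
Proof.
move=> HF HG.
have q4 (k x : R) : is_derive x (1 : R) (fun u => k * u ^+ 2) (k * (2 * x)).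
  apply: (@is_derive_quad _ _ _ `|k|) => s.
  rewrite (_ : _ - _ - _ = k * (s - x) ^+ 2); last by ring.
  by rewrite normrM (ger0_norm (sqr_ge0 _)).
have HN : grad_at (fun Q => - G Q) P (- c) (- d).
  have := grad_comp (is_derive_affine (G P) (-1) 0) HG.
  rewrite !mulN1r; apply: grad_ext => Q /=; by rewrite mulN1r addr0.
have h1 := grad_comp (q4 4^-1 _) (gradD HF HG).
have h2 := grad_comp (q4 (- 4^-1) _) (gradD HF HN).
have E : (fun Q => ((fun u => 4^-1 * u ^+ 2) \o (fun Q => F Q + G Q)) Q +
    ((fun u => - 4^-1 * u ^+ 2) \o (fun Q => F Q - G Q)) Q) =1 (fun Q => F Q * G Q).
  by move=> Q /=; field.
by apply: (grad_eq (grad_ext E (gradD h1 h2))) => /=; field.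
Qed.

Definition C1plane F Fx Fy := [/\ continuous Fx, continuous Fy &
  forall P, grad_at F P (Fx P) (Fy P)].

Lemma C1_ext F Fx Fy G Gx Gy : F =1 G -> Fx =1 Gx -> Fy =1 Gy ->
  C1plane F Fx Fy -> C1plane G Gx Gy.
Proof. by move=> /funext -> /funext -> /funext ->. Qed.

Lemma C1_cst (c : R) : C1plane (cst c) (cst 0) (cst 0).
Proof.
split; [exact: cst_continuous|exact: cst_continuous|] => P.
have := grad_affine 0 0 c P; apply: grad_ext => Q /=.
by rewrite !mul0r !add0r.
Qed.

Lemma C1_affine (a b c : R) :
  C1plane (fun Q => a * Q.1 + b * Q.2 + c) (cst a) (cst b).
Proof.
split; [exact: cst_continuous|exact: cst_continuous|] => P.
exact: grad_affine.
Qed.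

Lemma C1_continuous F Fx Fy : C1plane F Fx Fy -> continuous F.
Proof. by move=> [_ _ H] P; exact: grad_continuous (H P). Qed.

Lemma C1D F Fx Fy G Gx Gy : C1plane F Fx Fy -> C1plane G Gx Gy ->
  C1plane (fun Q => F Q + G Q) (fun Q => Fx Q + Gx Q) (fun Q => Fy Q + Gy Q).
Proof.
move=> [c1 c2 H1] [c3 c4 H2]; split.
- by move=> P; apply: cvgD; [exact: c1|exact: c3].
- by move=> P; apply: cvgD; [exact: c2|exact: c4].
by move=> P; apply: gradD.
Qed.

Lemma C1_sum (K : finType) (F Fx Fy : K -> R * R -> R) :
  (forall k, C1plane (F k) (Fx k) (Fy k)) ->
  C1plane (fun Q => \sum_k F k Q) (fun Q => \sum_k Fx k Q) (fun Q => \sum_k Fy k Q).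
Proof.
move=> H; elim: (index_enum K) => [|k s IH].
  by have := C1_cst 0; apply: C1_ext => Q /=; rewrite big_nil.
by have := C1D (H k) IH; apply: C1_ext => Q /=; rewrite big_cons.
Qed.

Lemma C1M F Fx Fy G Gx Gy : C1plane F Fx Fy -> C1plane G Gx Gy ->
  C1plane (fun Q => F Q * G Q) (fun Q => F Q * Gx Q + G Q * Fx Q)
    (fun Q => F Q * Gy Q + G Q * Fy Q).
Proof.
move=> HF HG; have cF := C1_continuous HF; have cG := C1_continuous HG.
move: HF HG => [c1 c2 H1] [c3 c4 H2]; split.
- by move=> P; apply: cvgD; apply: cvgM; [exact: cF|exact: c3|exact: cG|exact: c1].
- by move=> P; apply: cvgD; apply: cvgM; [exact: cF|exact: c4|exact: cG|exact: c2].
by move=> P; apply: gradM.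
Qed.

Lemma C1_comp f f' F Fx Fy : (forall x, is_derive x (1 : R) f (f' x)) ->
  continuous f' -> C1plane F Fx Fy ->
  C1plane (f \o F) (fun Q => f' (F Q) * Fx Q) (fun Q => f' (F Q) * Fy Q).
Proof.
move=> df cf HF; have cF := C1_continuous HF; move: HF => [c1 c2 H1].
have c3 P : {for P, continuous (f' \o F)}.
  by apply: continuous_comp; [exact: cF|exact: cf].
split.
- by move=> P; apply: cvgM; [exact: c3|exact: c1].
- by move=> P; apply: cvgM; [exact: c3|exact: c2].
by move=> P; apply: grad_comp.
Qed.

Lemma C1plane_on (D : set (R * R)) F Fx Fy : C1plane F Fx Fy -> C1_on D F.
Proof.
move=> [c1 c2 H]; exists Fx, Fy; split.
- exact: continuous_subspaceT.
- exact: continuous_subspaceT.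
move=> P _; apply/cvgrPdist_le => e e0.
rewrite !near_withinE; apply: filterS (H P e e0) => Q h QP _.
rewrite sub0r normrN normrM normfV.
have q0 : 0 < enorm (Q - P).
  rewrite /enorm sqrtr_gt0 lt_neqAle addr_ge0 ?sqr_ge0// andbT eq_sym.
  rewrite paddr_eq0 ?sqr_ge0// !sqrf_eq0; apply: contra QP => /andP[/eqP h1 /eqP h2].
  by rewrite -subr_eq0; apply/eqP; case: (Q - P) h1 h2 => u v /= -> ->.
rewrite (gtr0_norm q0) ler_pdivrMr// (le_trans h)// ler_wpM2l//; first exact: ltW.
rewrite /enorm [leLHS]prod_normE ge_max; apply/andP; split.
  by rewrite -sqrtr_sqr ler_wsqrtr// lerDl sqr_ge0.
by rewrite -sqrtr_sqr ler_wsqrtr// lerDr sqr_ge0.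
Qed.

End PlaneC1.

(** * Hermite interpolation at the vertices *)

Section Hermite.
Context {R : realType} {n : nat}.
Variable V : 'I_n -> R * R.
Hypothesis Vinj : injective V.
Implicit Types (P Q : R * R).

Definition sqdist (P Q : R * R) : R := (Q.1 - P.1) ^+ 2 + (Q.2 - P.2) ^+ 2.

Lemma sqdist_eq0 P Q : sqdist P Q = 0 -> P = Q.
Proof.
rewrite /sqdist => /eqP; rewrite paddr_eq0 ?sqr_ge0// !sqrf_eq0 !subr_eq0.
by case: P Q => [? ?] [? ?] /= /andP[/eqP -> /eqP ->].
Qed.

Lemma C1_sqdist P : C1plane (sqdist P) (fun Q => 2 * (Q.1 - P.1))
  (fun Q => 2 * (Q.2 - P.2)).
Proof.
have c2 : continuous (fun x : R => 2 * x).
  by move=> x; apply: cvgM; [exact: cvg_cst|exact: cvg_id].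
have h1 := C1_comp (@is_derive_sqr R) c2 (C1_affine 1 0 (- P.1)).
have h2 := C1_comp (@is_derive_sqr R) c2 (C1_affine 0 1 (- P.2)).
by apply: C1_ext (C1D h1 h2) => Q; rewrite /sqdist /=; ring.
Qed.

Lemma C1_switch P Q : P != Q -> exists F Fx Fy, [/\ C1plane F Fx Fy,
  F P = 1 /\ F Q = 0 & [/\ Fx P = 0, Fy P = 0, Fx Q = 0 & Fy Q = 0]].
Proof.
move=> PQ; pose d := sqdist Q P.
have d0 : d != 0 by apply: contra PQ => /eqP /sqdist_eq0 ->.
(* A parabola with [f 0 = 0], [f d = 1] and [f' d = 0]. Composed with the squared distance to [Q],
   its gradient vanishes at [P] because [f' d = 0], and at [Q] because the squared distance is
   stationary there. *)
pose f (u : R) := 1 - (1 - u / d) ^+ 2.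
have df x : is_derive x (1 : R) f (2 * (1 - x / d) / d).
  apply: (@is_derive_quad _ _ _ _ (d^-1 ^+ 2)) => s.
  rewrite /f (_ : _ - _ - _ = - (d^-1 ^+ 2 * (s - x) ^+ 2)); last by field.
  by rewrite normrN ger0_norm// mulr_ge0// sqr_ge0.
have cf : continuous (fun x : R => 2 * (1 - x / d) / d).
  move=> x; apply: cvgM; last exact: cvg_cst; apply: cvgM; first exact: cvg_cst.
  by apply: cvgB; [exact: cvg_cst|apply: cvgM; [exact: cvg_id|exact: cvg_cst]].
have H := C1_comp df cf (C1_sqdist Q).
have dP : 1 - sqdist Q P / d = 0 by rewrite divff// subrr.
have dQ : sqdist Q Q = 0 by rewrite /sqdist !subrr expr0n /= addr0.
do 3 eexists; split; first exact: H.
  by rewrite /f /= dP dQ mul0r expr0n /= !subr0 expr1n subrr.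
by split; rewrite /= ?dP ?subrr ?(mulr0, mul0r).
Qed.

(** A product of switches. Each factor has zero gradient at both of its points, so the product is 1
    with zero gradient at [V i], and one vanishing factor suffices at every other point. *)
Lemma C1_cutoff (i : 'I_n) (s : seq 'I_n) : i \notin s ->
  exists F Fx Fy, [/\ C1plane F Fx Fy,
    [/\ F (V i) = 1, Fx (V i) = 0 & Fy (V i) = 0] &
    forall j, j \in s -> [/\ F (V j) = 0, Fx (V j) = 0 & Fy (V j) = 0]].
Proof.
elim: s => [|j s IH]; first by move=> _; do 3 eexists; split; [exact: (C1_cst 1)| |].
rewrite inE negb_or => /andP[ij /IH[F [Fx [Fy [HF [F1 F2 F3] Fs]]]]].
have Vij : V i != V j by apply: contra ij => /eqP/Vinj ->.
have [G [Gx [Gy [HG [G1 G2] [G3 G4 G5 G6]]]]] := C1_switch Vij.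
do 3 eexists; split; first exact: (C1M HF HG).
  by rewrite /= F1 F2 F3 G1 G3 G4 !mulr0 addr0 mulr1.
move=> k; rewrite inE => /predU1P[->|/Fs[-> -> ->]].
  by rewrite /= G2 G5 G6 !mulr0 !mul0r !addr0.
by rewrite /= !mulr0 !mul0r !addr0.
Qed.

(** Each prescribed tangent plane is multiplied by the cutoff of its vertex; to first order the
    product is that plane at its own vertex and 0 at the others. *)
Lemma C1_hermite (z a b : 'I_n -> R) : exists G Gx Gy, C1plane G Gx Gy /\
  forall i, [/\ G (V i) = z i, Gx (V i) = a i & Gy (V i) = b i].
Proof.
have /choice[F /choice[Fx /choice[Fy H]]] : forall i, exists F Fx Fy,
  [/\ C1plane F Fx Fy, [/\ F (V i) = 1, Fx (V i) = 0 & Fy (V i) = 0] &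
    forall j, j != i -> [/\ F (V j) = 0, Fx (V j) = 0 & Fy (V j) = 0]].
  move=> i; have : i \notin rem i (enum 'I_n) by rewrite mem_rem_uniqF// enum_uniq.
  move=> /C1_cutoff[F [Fx [Fy [h1 h2 h3]]]]; exists F, Fx, Fy; split => // j ji.
  by apply: h3; rewrite mem_rem_uniq ?enum_uniq// inE ji mem_enum.
have HA i := C1M (let: And3 h _ _ := H i in h)
  (C1_affine (a i) (b i) (z i - a i * (V i).1 - b i * (V i).2)).
do 3 eexists; split; first exact: (C1_sum HA).
move=> j; have [_ [h1 h2 h3] _] := H j.
split; rewrite (bigD1 j)//= h1 ?h2 ?h3 big1 ?addr0.
- by ring.
- by move=> i ij; have [_ _ /(_ j)[]] := H i; rewrite 1?eq_sym// => -> _ _; rewrite mul0r.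
- by ring.
- move=> i ij; have [_ _ /(_ j)[]] := H i; rewrite 1?eq_sym// => -> -> _.
  by rewrite mul0r mulr0 addr0.
- by ring.
- move=> i ij; have [_ _ /(_ j)[]] := H i; rewrite 1?eq_sym// => -> _ ->.
  by rewrite mul0r mulr0 addr0.
Qed.

End Hermite.

(** * Bumps supported in a lens around a segment *)

Section Lens.
Context {R : realType}.
Variables (psi psi' : R -> R) (L c : R).
Hypothesis L0 : 0 < L.
Hypothesis c0 : 0 < c.
Hypothesis dpsi : forall x, 0 <= x <= L -> is_derive x (1 : R) psi (psi' x).
Hypothesis cpsi' : forall x, 0 <= x <= L -> {for x, continuous psi'}.
Hypothesis psi0 : psi 0 = 0 /\ psi' 0 = 0.
Hypothesis psiL : psi L = 0 /\ psi' L = 0.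

Definition cut (g : R -> R) (x : R) : R := if 0 < x < L then g x else 0.

Let w (x : R) : R := c * (x * (L - x)).
Let w' (x : R) : R := c * (L - 2 * x).

Lemma near_inside x : 0 < x < L -> \forall s \near x, 0 < s < L.
Proof.
move=> xL; have xL' : x \in `]0, L[ by rewrite in_itv.
by apply: filterS (near_in_itvoo xL') => s; rewrite in_itv.
Qed.

Lemma outside_cases x : ~~ (0 < x < L) ->
  (\forall s \near x, ~~ (0 < s < L)) \/ x = 0 \/ x = L.
Proof.
rewrite negb_and -!leNgt => xL.
have [->|x0] := eqVneq x 0; first by right; left.
have [->|xl] := eqVneq x L; first by right; right.
left; case/orP: xL => h.
  have h' : x < 0 by rewrite lt_neqAle x0.
  have d0 : 0 < - x by lra.
  apply: filterS (nbhsx_ballx x _ d0) => s; rewrite -ball_normE /= ltr_norml.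
  by move=> /andP[h1 h2]; rewrite negb_and -!leNgt; apply/orP; left; lra.
have h' : L < x by rewrite lt_neqAle eq_sym xl.
have d0 : 0 < x - L by lra.
apply: filterS (nbhsx_ballx x _ d0) => s; rewrite -ball_normE /= ltr_norml.
by move=> /andP[h1 h2]; rewrite negb_and -!leNgt; apply/orP; right; lra.
Qed.

Lemma psi_end x : x = 0 \/ x = L -> psi x = 0 /\ psi' x = 0.
Proof. by case: psi0 psiL => a b [? ?] [] ->. Qed.

Lemma end_itv x : x = 0 \/ x = L -> 0 <= x <= L.
Proof. by case=> ->; rewrite lexx (ltW L0). Qed.

Lemma cut_psi_small x e : ~~ (0 < x < L) -> 0 < e ->
  \forall s \near x, `|cut psi s| <= e * `|s - x|.
Proof.
move=> xL e0; have [|xe] := outside_cases xL.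
  apply: filterS => s /negbTE sL; rewrite /cut sL normr0 mulr_ge0//; exact: ltW.
have [p0 p1] := psi_end xe.
have /is_deriveP/(_ e e0) := dpsi (end_itv xe).
apply: filterS => s; rewrite p0 p1 mul0r !subr0 /cut; case: ifP => // _ _.
by rewrite normr0 mulr_ge0// ltW.
Qed.

Lemma cut_psi'_small x e : ~~ (0 < x < L) -> 0 < e ->
  \forall s \near x, `|cut psi' s| <= e.
Proof.
move=> xL e0; have [|xe] := outside_cases xL.
  apply: filterS => s /negbTE sL; rewrite /cut sL normr0; exact: ltW.
have [p0 p1] := psi_end xe.
have /cvgrPdist_le/(_ e e0) := cpsi' (end_itv xe).
apply: filterS => s; rewrite p1 sub0r normrN /cut; case: ifP => // _ _.
by rewrite normr0 ltW.
Qed.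

(** At a tip [psi] vanishes to second order in the sense of being small compared with the distance,
    while [w] vanishes only linearly. *)
Lemma cut_quot_small x e : ~~ (0 < x < L) -> 0 < e ->
  \forall s \near x, `|cut (fun s => psi s / w s) s| <= e.
Proof.
move=> xL e0; have [|xe] := outside_cases xL.
  apply: filterS => s /negbTE sL; rewrite /cut sL normr0; exact: ltW.
(* Within [L / 2] of a tip, [w] is at least [c * L / 2] times the distance to the tip. *)
have e1 : 0 < e * c * L / 2 by rewrite divr_gt0// !mulr_gt0.
have L2 : 0 < L / 2 by rewrite divr_gt0.
apply: filterS2 (cut_psi_small xL e1) (nbhsx_ballx x _ L2) => s.
rewrite -ball_normE /= /cut; case: ifP => [/andP[s0 sL]|_ _ _]; last first.
  by rewrite normr0 ltW.
move=> h1 h2; have ws : 0 < w s by rewrite /w !mulr_gt0// subr_gt0.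
rewrite normrM normfV (gtr0_norm ws) ler_pdivrMr//; apply: (le_trans h1).
rewrite /w; case: xe => xE; rewrite xE in h2 *.
  rewrite subr0 gtr0_norm//; move: h2; rewrite sub0r normrN gtr0_norm// => h2.
  rewrite (_ : e * (c * (s * (L - s))) = (e * c * (L - s)) * s); last by ring.
  apply: ler_wpM2r; first exact: ltW.
  by rewrite -(mulrA (e * c) L) ler_pM2l ?mulr_gt0//; lra.
move: h2; rewrite distrC !ltr0_norm ?subr_lt0// opprB => h2.
rewrite (_ : e * (c * (s * (L - s))) = (e * c * s) * (L - s)); last by ring.
apply: ler_wpM2r; first by rewrite subr_ge0 ltW.
by rewrite -(mulrA (e * c) L) ler_pM2l ?mulr_gt0//; lra.
Qed.

Lemma near_cut (g : R -> R) x : 0 < x < L -> \forall s \near x, g s = cut g s.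
Proof. by move=> /near_inside; apply: filterS => s sL; rewrite /cut sL. Qed.

Lemma continuous_cut (g : R -> R) (x : R) : {for x, continuous g} -> 0 < x < L ->
  {for x, continuous (cut g)}.
Proof.
move=> cg xL; have e : cut g x = g x by rewrite /cut xL.
rewrite /prop_for /continuous_at e.
by apply: cvg_trans cg; apply: near_eq_cvg; exact: near_cut.
Qed.

Lemma is_derive_w x : is_derive x (1 : R) w (w' x).
Proof.
apply: (@is_derive_quad _ _ _ _ c) => s.
rewrite (_ : _ - _ - _ = - (c * (s - x) ^+ 2)); last by rewrite /w /w'; ring.
by rewrite normrN ger0_norm// mulr_ge0 ?sqr_ge0// ltW.
Qed.

Lemma continuous_derivable (f : R -> R) x l : is_derive x (1 : R) f l ->
  {for x, continuous f}.
Proof.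
by move=> [d _]; apply: differentiable_continuous; apply/derivable1_diffP.
Qed.

Lemma w_neq0 x : 0 < x < L -> w x != 0.
Proof. by move=> /andP[x0 xL]; rewrite gt_eqF// !mulr_gt0// subr_gt0. Qed.

Lemma is_derive_winv x : 0 < x < L ->
  is_derive x (1 : R) (fun s => (w s)^-1) (- w' x / w x ^+ 2).
Proof.
move=> /w_neq0 wx; have dw := is_derive_w x.
have := is_deriveV wx dw; move/is_derive_eq; apply.
by rewrite /GRing.scale /=; field.
Qed.

Variables (Xa Xb Xc Ya Yb Yc : R).
Let X (P : R * R) := Xa * P.1 + Xb * P.2 + Xc.
Let Y (P : R * R) := Ya * P.1 + Yb * P.2 + Yc.
Let tau (P : R * R) := Y P * (w (X P))^-1.
(** With [tau = Y / w], the functions [A] and [B] are the partial derivatives of the bump in the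
    coordinates [X] and [Y], and [chi'] is the derivative of [sqpos (1 - t ^+ 2)]. The quotient
    [psi / w] is kept together in [h] because [1 / w] alone blows up at the tips. *)
Let h := cut (fun s => psi s / w s).
Let chi' (t : R) := - 4 * (t * Num.max 0 (1 - t ^+ 2)).
Let A (P : R * R) := cut psi' (X P) * sqpos (1 - tau P ^+ 2) -
  h (X P) * w' (X P) * (tau P * chi' (tau P)).
Let B (P : R * R) := h (X P) * chi' (tau P).

(* Continues [psi], placed on the segment [Y = 0], [0 < X < L], to the plane; the
   support [|Y| <= c X (L - X)] is a lens with the segment as its axis. The
   double zeros of [psi] at the ends make the extension C^1 at the tips. *)
Definition lens (P : R * R) : R := cut psi (X P) * sqpos (1 - tau P ^+ 2).

Lemma gradX P : grad_at X P Xa Xb. Proof. exact: grad_affine. Qed.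
Lemma gradY P : grad_at Y P Ya Yb. Proof. exact: grad_affine. Qed.

Lemma grad_tau P : 0 < X P < L -> grad_at tau P
  (Ya / w (X P) - w' (X P) / w (X P) * tau P * Xa)
  (Yb / w (X P) - w' (X P) / w (X P) * tau P * Xb).
Proof.
move=> XP; have wX := w_neq0 XP.
have h1 := gradM (gradY P) (grad_comp (is_derive_winv XP) (gradX P)).
by apply: (grad_eq h1); rewrite /tau /=; field.
Qed.

(** In the strip [0 < X < L] this is the chain rule. Elsewhere the gradient is 0, since [cut psi] is
    small compared with the distance and the cutoff factor lies between 0 and 1. *)
Lemma grad_lens P : grad_at lens P (A P * Xa + B P * Ya) (A P * Xb + B P * Yb).
Proof.
have [XP|XP] := boolP (0 < X P < L).
  have wX := w_neq0 XP.
  have XP' : 0 <= X P <= L by case/andP: XP => ? ?; rewrite !ltW.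
  have dc : is_derive (X P) (1 : R) (cut psi) (psi' (X P)).
    by apply: near_eq_is_derive (dpsi XP'); exact: near_cut.
  have h1 := grad_comp dc (gradX P).
  have h2 := grad_comp (is_derive_sqr (tau P)) (grad_tau XP).
  have h3 := grad_comp (is_derive_affine (tau P ^+ 2) (-1) 1) h2.
  have h4 := grad_comp (is_derive_sqpos _) h3.
  have := gradM h1 h4.
  have E : (fun Q => (cut psi \o X) Q * (sqpos \o ((fun u => -1 * u + 1) \o ((fun u => u ^+ 2) \o tau))) Q)
     =1 lens by move=> Q; rewrite /lens /= mulN1r addrC.
  move=> /(grad_ext E) g; apply: (grad_eq g).
    rewrite /A /B /h /chi' /= /cut XP (_ : -1 * tau P ^+ 2 + 1 = 1 - tau P ^+ 2); last by ring.
    by field.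
  rewrite /A /B /h /chi' /= /cut XP (_ : -1 * tau P ^+ 2 + 1 = 1 - tau P ^+ 2); last by ring.
  by field.
have cutz g : cut g (X P) = 0 by rewrite /cut (negbTE XP).
have A0 : A P = 0 by rewrite /A /h !cutz !mul0r subr0.
have B0 : B P = 0 by rewrite /B /h !cutz !mul0r.
rewrite A0 B0 !mul0r addr0 => e e0.
pose K := `|Xa| + `|Xb| + 1.
have K0 : 0 < K by rewrite ltr_wpDl// addr_ge0.
have eK : 0 < e / K by rewrite divr_gt0.
have n1 : \forall Q \near P, `|cut psi (X Q)| <= e / K * `|X Q - X P| :=
  grad_continuous (gradX P) (cut_psi_small XP eK).
apply: filterS2 n1 (grad_lip (gradX P)) => Q h1 h2.
rewrite !mul0r addr0 subr0 /lens cutz mul0r subr0 normrM.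
have [/andP[s0 s1] _ _] := sqpos_bound (tau Q).
rewrite (ger0_norm s0) (le_trans (ler_piMr (normr_ge0 _) s1))// (le_trans h1)//.
rewrite (_ : e * `|Q - P| = e / K * (K * `|Q - P|)).
  by rewrite ler_pM2l.
by field; rewrite gt_eqF.
Qed.

Lemma tau_continuous P : 0 < X P < L -> {for P, continuous tau}.
Proof. by move=> /grad_tau/grad_continuous. Qed.

Lemma chi'_continuous : continuous chi'.
Proof.
have c1 : continuous (fun t : R => 1 - t ^+ 2).
  move=> t; apply: cvgB; first exact: cvg_cst.
  exact: (continuous_derivable (is_derive_sqr t)).
move=> t; apply: cvgM; first exact: cvg_cst.
apply: cvgM; first exact: cvg_id.
apply: (@continuous_comp _ _ _ (fun t : R => 1 - t ^+ 2) (fun u => Num.max 0 u)).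
  exact: c1.
by apply: continuous_max; [exact: cst_continuous|by move=> u; exact: cvg_id].
Qed.

(** The variable [tau] has no limit at the tips. A bound in terms of [X] alone lets the smallness of
    [psi'] and [psi / w] give continuity there. *)
Lemma A_bound P : `|A P| <= `|cut psi' (X P)| + 4 * (c * L) * `|h (X P)|.
Proof.
have [/andP[s0 s1] _ s3] := sqpos_bound (tau P).
rewrite /A (le_trans (ler_normB _ _))// lerD//.
  by rewrite normrM (ger0_norm s0) ler_piMr.
rewrite /h; have [/andP[x0 xL]|/negbTE xL] := boolP (0 < X P < L); last first.
  by rewrite /cut xL !mul0r normr0 mulr0.
have wL : `|w' (X P)| <= c * L.
  by rewrite /w' normrM (gtr0_norm c0) ler_pM2l// ler_norml; apply/andP; split; lra.
have k : `|tau P * chi' (tau P)| <= 4.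
  rewrite /chi' mulrCA normrM normrN (ger0_norm (_ : 0 <= 4))//.
  by rewrite -[leRHS]mulr1 ler_pM2l.
set u := cut _ _; rewrite (_ : 4 * (c * L) * `|u| = `|u| * (c * L) * 4); last by ring.
by rewrite normrM (normrM u); apply: ler_pM => //; apply: ler_wpM2l.
Qed.

Lemma B_bound P : `|B P| <= 4 * `|h (X P)|.
Proof.
have [_ s2 _] := sqpos_bound (tau P).
rewrite /B /chi' normrM (normrM (- 4)) normrN (ger0_norm (_ : 0 <= 4))//.
by rewrite mulrC -mulrA ler_pM2l// ler_piMl.
Qed.

Lemma h_continuous x : 0 < x < L -> {for x, continuous h}.
Proof.
move=> xL; apply: continuous_cut => //.
have xL' : 0 <= x <= L by case/andP: xL => ? ?; rewrite !ltW.
apply: cvgM; first exact: continuous_derivable (dpsi xL').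
exact: continuous_derivable (is_derive_winv xL).
Qed.

Lemma AB_continuous : continuous A /\ continuous B.
Proof.
have cX P : {for P, continuous X} := grad_continuous (gradX P).
have compX (g : R -> R) P : {for X P, continuous g} -> {for P, continuous (g \o X)}.
  by move=> cg; apply: continuous_comp; [exact: cX|exact: cg].
have inside P : 0 < X P < L -> {for P, continuous A} /\ {for P, continuous B}.
  move=> XP; have ct := tau_continuous XP.
  have XP' : 0 <= X P <= L by case/andP: XP => ? ?; rewrite !ltW.
  have c1 := compX _ _ (continuous_cut (cpsi' XP') XP).
  have c2 := compX _ _ (h_continuous XP).
  have c3 : {for P, continuous (chi' \o tau)}.
    by apply: continuous_comp; [exact: ct|exact: chi'_continuous].
  have c4 : {for P, continuous (w' \o X)}.
    apply: compX; apply: cvgM; first exact: cvg_cst.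
    apply: cvgB; first exact: cvg_cst.
    by apply: cvgM; [exact: cvg_cst|exact: cvg_id].
  have c5 : {for P, continuous (fun Q => sqpos (1 - tau Q ^+ 2))}.
    apply: (@continuous_comp _ _ _ (fun Q => 1 - tau Q ^+ 2) sqpos); last exact: sqpos_continuous.
    apply: cvgB; first exact: cvg_cst.
    by apply: cvgM; exact: ct.
  split; last exact: (cvgM c2 c3).
  exact: (cvgB (cvgM c1 c5) (cvgM (cvgM c2 c4) (cvgM ct c3))).
have outside P : ~~ (0 < X P < L) -> {for P, continuous A} /\ {for P, continuous B}.
  move=> XP.
  have cutz g : cut g (X P) = 0 by rewrite /cut (negbTE XP).
  have A0 : A P = 0 by rewrite /A /h !cutz !mul0r subr0.
  have B0 : B P = 0 by rewrite /B /h !cutz !mul0r.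
  have cL0 : 0 < 4 * (c * L) by rewrite !mulr_gt0.
  split; apply/cvgrPdist_le => e e0.
    have e2 : 0 < e / 2 by rewrite divr_gt0.
    have e3 : 0 < e / 2 / (4 * (c * L)) by rewrite divr_gt0.
    have n1 : \forall Q \near P, `|cut psi' (X Q)| <= e / 2 :=
      cX P _ (cut_psi'_small XP e2).
    have n2 : \forall Q \near P, `|h (X Q)| <= e / 2 / (4 * (c * L)) :=
      cX P _ (cut_quot_small XP e3).
    apply: filterS2 n1 n2 => Q h1 h2.
    rewrite A0 sub0r normrN (le_trans (A_bound Q))// (splitr e) lerD//.
    by rewrite mulrC -ler_pdivlMr.
  have e3 : 0 < e / 4 by rewrite divr_gt0.
  have n2 : \forall Q \near P, `|h (X Q)| <= e / 4 := cX P _ (cut_quot_small XP e3).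
  apply: filterS n2 => Q h2.
  by rewrite B0 sub0r normrN (le_trans (B_bound Q))// mulrC -ler_pdivlMr.
by split=> P; have [/inside[]|/outside[]] := boolP (0 < X P < L).
Qed.

Lemma C1_lens : C1plane lens (fun P => A P * Xa + B P * Ya)
  (fun P => A P * Xb + B P * Yb).
Proof.
have [cA cB] := AB_continuous; split; last exact: grad_lens.
- by move=> P; apply: cvgD; apply: cvgM; [exact: cA|exact: cvg_cst|exact: cB|exact: cvg_cst].
- by move=> P; apply: cvgD; apply: cvgM; [exact: cA|exact: cvg_cst|exact: cB|exact: cvg_cst].
Qed.

Lemma lens_axis P : Y P = 0 -> 0 <= X P <= L -> lens P = psi (X P).
Proof.
move=> YP XP; rewrite /lens /tau YP mul0r expr0n /= subr0 /sqpos.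
rewrite (max_idPr ler01) expr1n mulr1 /cut; case: ifPn => //.
rewrite negb_and -!leNgt; case/andP: XP => x0 xL /orP[h'|h'].
  have -> : X P = 0 by apply/eqP; rewrite eq_le h'.
  by case: psi0 => ->.
have -> : X P = L by apply/eqP; rewrite eq_le h' xL.
by case: psiL => ->.
Qed.

Lemma lens_outside P :
  (0 < X P < L -> c * (X P * (L - X P)) <= `|Y P|) -> lens P = 0.
Proof.
rewrite /lens /cut; case: ifP => [XP|_ _]; last by rewrite mul0r.
move=> /(_ isT); rewrite -/(w (X P)) => h1.
have wX : 0 < w (X P) by case/andP: XP => ? ?; rewrite /w !mulr_gt0// subr_gt0.
rewrite /sqpos (_ : Num.max 0 _ = 0) ?expr0n ?mulr0//.
apply/max_idPl; rewrite subr_le0 -(real_normK (num_real (tau P))) exprn_ege1//.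
by rewrite /tau normrM normfV (gtr0_norm wX) ler_pdivlMr// mul1r.
Qed.

End Lens.

(** A segment that does not meet the open axis avoids a thin enough lens. If [Y] has no zero on the
    segment, [|Y|] has a lower bound [m], and [X * (L - X) <= L ^+ 2]. If [Y] vanishes at [s0], then
    [X] lies outside []0, L[] there, so [X] or [L - X] is at most [|x1| * |s - s0|], while
    [|Y| = |y1| * |s - s0|]. This covers segments through a tip, near which the lens narrows
    linearly. *)
Lemma affine_separation (R : realType) (L x0 x1 y0 y1 : R) : 0 < L ->
  (forall s, 0 <= s <= 1 -> y0 + y1 * s = 0 -> ~~ (0 < x0 + x1 * s < L)) ->
  exists2 c, 0 < c & forall s, 0 <= s <= 1 -> 0 < x0 + x1 * s < L ->
    c * ((x0 + x1 * s) * (L - (x0 + x1 * s))) <= `|y0 + y1 * s|.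
Proof.
move=> L0 H.
have far m : 0 < m -> (forall s, 0 <= s <= 1 -> m <= `|y0 + y1 * s|) ->
  exists2 c, 0 < c & forall s, 0 <= s <= 1 -> 0 < x0 + x1 * s < L ->
    c * ((x0 + x1 * s) * (L - (x0 + x1 * s))) <= `|y0 + y1 * s|.
  move=> m0 Hm; exists (m / L ^+ 2); first by rewrite divr_gt0// exprn_gt0.
  move=> s s01 /andP[u0 uL]; apply: le_trans (Hm s s01).
  rewrite mulrAC ler_pdivrMr ?exprn_gt0// ler_pM2l//; nra.
have [y10|y1n] := eqVneq y1 0.
  have [y00|y0n] := eqVneq y0 0.
    exists 1 => // s s01 sL; have := H s s01; rewrite y10 y00 mul0r addr0 sL.
    by move=> /(_ erefl).
  by apply: (far `|y0|) => [|s _]; rewrite ?normr_gt0// y10 mul0r addr0.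
pose s0 := - y0 / y1.
have yE s : y0 + y1 * s = y1 * (s - s0) by rewrite /s0; field.
have y1p : 0 < `|y1| by rewrite normr_gt0.
have [s00|s00] := ltP s0 0.
  apply: (far (`|y1| * - s0)); first by rewrite mulr_gt0// oppr_gt0.
  move=> s /andP[h1 h2]; rewrite yE normrM ler_pM2l//.
  by rewrite ger0_norm; lra.
have [s01|s01] := ltP 1 s0.
  apply: (far (`|y1| * (s0 - 1))); first by rewrite mulr_gt0// subr_gt0.
  move=> s /andP[h1 h2]; rewrite yE normrM ler_pM2l//.
  by rewrite ltr0_norm; lra.
have := H s0; rewrite s00 s01 => /(_ isT); rewrite yE subrr mulr0 => /(_ erefl).
rewrite negb_and -!leNgt => xs0.
exists (`|y1| / (L * (`|x1| + 1))); first by rewrite divr_gt0// mulr_gt0// ltr_wpDl.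
move=> s s01' /andP[u0 uL].
have K0 : 0 < L * (`|x1| + 1) by rewrite mulr_gt0// ltr_wpDl.
rewrite yE normrM mulrAC ler_pdivrMr// -mulrA ler_pM2l//.
have h1 : x1 * (s - s0) <= `|x1| * `|s - s0| by rewrite -normrM ler_norm.
have h2 : - (x1 * (s - s0)) <= `|x1| * `|s - s0| by rewrite -normrM -normrN ler_norm.
have h3 := normr_ge0 (s - s0).
have h4 : x0 + x1 * s = x0 + x1 * s0 + x1 * (s - s0) by ring.
have h5 := mulr_ge0 (ltW L0) h3.
move: u0 uL h4; set u := x0 + x1 * s; set v := x0 + x1 * s0 in xs0 *.
set d := x1 * (s - s0) in h1 h2 *; set a := `|x1| * _ in h1 h2 *.
set b := `|s - s0| in h3 h5 a h1 h2 *.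
move=> u0 uL h4.
have -> : b * (L * (`|x1| + 1)) = L * a + L * b by rewrite /a; ring.
case/orP: xs0 => h.
  have : u <= a by lra.
  move=> ua; have : L * u <= L * a by rewrite ler_pM2l.
  nra.
have : L - u <= a by lra.
move=> ua; have : L * (L - u) <= L * a by rewrite ler_pM2l.
nra.
Qed.

(** * Geometry of the triangulation *)

Section Triangulation.
Context {R : realType} {n : nat}.
Variables (V : 'I_n -> R * R) (T : {set {set 'I_n}}).
Hypothesis Vinj : injective V.
Hypothesis triT : triangulation V T.

(* Twice the signed area of the triangle with vertices V a, V b, V c. *)
Definition area2 (a b c : 'I_n) : R :=
  ((V a).1 - (V c).1) * ((V b).2 - (V c).2) -
  ((V b).1 - (V c).1) * ((V a).2 - (V c).2).

Lemma triangle_area A : A \in T -> exists a b c,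
  [/\ a != b, a != c, b != c, (forall i, (i \in A) = [|| i == a, i == b | i == c]) &
      area2 a b c != 0].
Proof.
move=> AT; have [/(_ A AT)[A3 nc] _ _] := triT.
have : size (enum A) = 3%N by rewrite -cardE.
have := enum_uniq A; have : forall i, (i \in A) = (i \in enum A).
  by move=> i; rewrite mem_enum.
case: (enum A) => [|a [|b [|c [|]]]] //= AE.
rewrite !inE negb_or andbT => /andP[/andP[ab ac] bc] _.
have {}AE i : (i \in A) = [|| i == a, i == b | i == c] by rewrite AE !inE.
exists a, b, c; split => //; apply/negP => /eqP D0; apply: nc.
exists ((V b).2 - (V c).2), (- ((V b).1 - (V c).1)).
exists (((V b).2 - (V c).2) * (V c).1 - ((V b).1 - (V c).1) * (V c).2).
split.
  move=> [h1 h2]; move/negP: bc; apply; apply/eqP/Vinj.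
  by case: (V b) (V c) h1 h2 => [u v] [u' v'] /= h1 h2; congr (_, _); lra.
move: D0; rewrite /area2 => D0.
by move=> i; rewrite AE => /or3P[] /eqP ->; lra.
Qed.

(** The differences of the weights solve a homogeneous linear system whose determinant is the
    nonzero area. *)
Lemma barycentric_unique A (w w' : 'I_n -> R) : A \in T ->
  (forall i, i \notin A -> w i = 0) -> (forall i, i \notin A -> w' i = 0) ->
  \sum_i w i = \sum_i w' i -> \sum_i w i *: V i = \sum_i w' i *: V i ->
  w =1 w'.
Proof.
move=> AT wA wA' s1 s2.
have [a [b [c [ab ac bc AE D0]]]] := triangle_area AT.
pose d i := w i - w' i.
have dA i : i \notin A -> d i = 0 by move=> iA; rewrite /d wA ?wA'// subrr.
have sumA (f : 'I_n -> R) : \sum_i d i * f i = d a * f a + d b * f b + d c * f c.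
  rewrite (bigD1 a)//= (bigD1 b) 1?eq_sym//= (bigD1 c)/=; last first.
    by rewrite eq_sym ac eq_sym bc.
  rewrite big1 ?addr0 ?addrA// => i /andP[/andP[ia ib] ic].
  by rewrite dA ?mul0r// AE !negb_or ia ib.
have e0 : d a + d b + d c = 0.
  have := sumA (fun _ => 1); rewrite !mulr1 => <-.
  by under eq_bigr do rewrite mulr1; rewrite sumrB s1 subrr.
have e1 : d a * (V a).1 + d b * (V b).1 + d c * (V c).1 = 0.
  rewrite -(sumA (fun i => (V i).1)); under eq_bigr do rewrite mulrBl.
  rewrite sumrB; have := congr1 fst s2; rewrite !(raddf_sum fst) /= => ->.
  by rewrite subrr.
have e2 : d a * (V a).2 + d b * (V b).2 + d c * (V c).2 = 0.
  rewrite -(sumA (fun i => (V i).2)); under eq_bigr do rewrite mulrBl.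
  rewrite sumrB; have := congr1 snd s2; rewrite !(raddf_sum snd) /= => ->.
  by rewrite subrr.
have dc : d c = - (d a + d b) by lra.
have f1 : d a * ((V a).1 - (V c).1) + d b * ((V b).1 - (V c).1) = 0.
  by rewrite -[RHS]e1 dc; ring.
have f2 : d a * ((V a).2 - (V c).2) + d b * ((V b).2 - (V c).2) = 0.
  by rewrite -[RHS]e2 dc; ring.
have da0 : d a = 0.
  apply/eqP; rewrite -(mulIr_eq0 _ (mulIf D0)) /area2; apply/eqP.
  transitivity ((d a * ((V a).1 - (V c).1) + d b * ((V b).1 - (V c).1)) * ((V b).2 - (V c).2)
   - (d a * ((V a).2 - (V c).2) + d b * ((V b).2 - (V c).2)) * ((V b).1 - (V c).1)).
    by ring.
  by rewrite f1 f2 !mul0r subrr.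
have db0 : d b = 0.
  apply/eqP; rewrite -(mulIr_eq0 _ (mulIf D0)) /area2; apply/eqP.
  transitivity ((d a * ((V a).2 - (V c).2) + d b * ((V b).2 - (V c).2)) * ((V a).1 - (V c).1)
   - (d a * ((V a).1 - (V c).1) + d b * ((V b).1 - (V c).1)) * ((V a).2 - (V c).2)).
    by ring.
  by rewrite f1 f2 !mul0r subrr.
move=> i; apply/eqP; rewrite -subr_eq0; apply/eqP; rewrite -/(d i).
have [iA|/dA//] := boolP (i \in A); move: iA; rewrite AE.
by move=> /or3P[] /eqP -> //; rewrite dc da0 db0 addr0 oppr0.
Qed.

(** Barycentric coordinates of a point of an edge, written as a weight on all vertices so that they
    can be compared with the weights of any hull. *)
Definition edge_weight (i j : 'I_n) (s : R) (m : 'I_n) : R :=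
  (1 - s) * (m == i)%:R + s * (m == j)%:R.

Lemma edge_weight_sum i j s : \sum_m edge_weight i j s m = 1.
Proof.
rewrite big_split /= -!mulr_sumr.
have D k : \sum_(m < n) (m == k)%:R = 1 :> R.
  by rewrite (bigD1 k)//= eqxx big1 ?addr0// => m /negbTE ->.
by rewrite !D !mulr1 subrK.
Qed.

Lemma edge_weight_point i j s :
  \sum_m edge_weight i j s m *: V m = (1 - s) *: V i + s *: V j.
Proof.
have D k (c : R) : \sum_(m < n) (c * (m == k)%:R) *: V m = c *: V k.
  rewrite (bigD1 k)//= eqxx mulr1 big1 ?addr0// => m /negbTE ->.
  by rewrite mulr0 scale0r.
by under eq_bigr do rewrite /edge_weight scalerDl; rewrite big_split /= !D.
Qed.

Lemma edge_weight_out (A : {set 'I_n}) i j s m : i \in A -> j \in A -> m \notin A ->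
  edge_weight i j s m = 0.
Proof.
move=> iA jA mA; rewrite /edge_weight.
have -> : (m == i) = false by apply: contraNF mA => /eqP ->.
have -> : (m == j) = false by apply: contraNF mA => /eqP ->.
by rewrite !mulr0 addr0.
Qed.

Lemma edge_hull (A : {set 'I_n}) i j s : i \in A -> j \in A -> 0 <= s <= 1 ->
  hull V A ((1 - s) *: V i + s *: V j).
Proof.
move=> iA jA /andP[s0 s1]; exists (edge_weight i j s); split.
- by move=> m; rewrite addr_ge0// mulr_ge0// subr_ge0.
- by move=> m; apply: edge_weight_out.
- exact: edge_weight_sum.
- by rewrite edge_weight_point.
Qed.

Lemma edge_weight_support i j s (w : 'I_n -> R) : i != j -> 0 < s < 1 ->
  edge_weight i j s =1 w -> w i != 0 /\ w j != 0.
Proof.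
move=> ij /andP[s0 s1] E; rewrite -!E /edge_weight !eqxx (negbTE ij).
rewrite (eq_sym j) (negbTE ij) !mulr0 !mulr1 addr0 add0r.
by split; [rewrite subr_eq0 eq_sym lt_eqF|rewrite gt_eqF].
Qed.

(** An inner point of an edge has positive weight at both ends. If the triangles of the two edges
    differ, the point lies in their common vertex, which is impossible, or in a common edge, which
    must then contain both ends of [e]. So both edges lie in one triangle, where the weights are
    unique. *)
Lemma edges_cross (e e' : 'I_n * 'I_n) s t : e \in edges T -> e' \in edges T ->
  0 < s < 1 -> 0 <= t <= 1 ->
  (1 - s) *: V e.1 + s *: V e.2 = (1 - t) *: V e'.1 + t *: V e'.2 -> e = e'.
Proof.
case: e e' => [i j] [k l]; rewrite !inE /=.
move=> /andP[ij /andP[ij' /existsP[A /and3P[AT iA jA]]]].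
move=> /andP[kl /andP[kl' /existsP[B /and3P[BT kB lB]]]] s01 t01 E.
have in2 m a b u : edge_weight a b u m != 0 -> (m == a) || (m == b).
  by rewrite /edge_weight; case: (m == a); case: (m == b); rewrite //= !mulr0 addr0 eqxx.
have same C : C \in T -> i \in C -> j \in C -> k \in C -> l \in C -> (i, j) = (k, l).
  move=> CT iC jC kC lC.
  have := @barycentric_unique C (edge_weight i j s) (edge_weight k l t) CT
    (fun m => edge_weight_out s iC jC) (fun m => edge_weight_out t kC lC).
  rewrite !edge_weight_sum !edge_weight_point => /(_ erefl E).
  move=> /(edge_weight_support ij' s01)[/in2/orP[]/eqP h1 /in2/orP[]/eqP h2]; subst.
  - by rewrite eqxx in ij'.
  - by [].
  - by rewrite ltnNge ltnW in ij.
  - by rewrite eqxx in ij'.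
have s01' : 0 <= s <= 1 by case/andP: s01 => ? ?; rewrite !ltW.
have [AB|/eqP AB] := eqVneq A B; first by subst B; exact: (same A).
have QA := edge_hull iA jA s01'.
have QB := edge_hull kB lB t01; rewrite -E in QB.
have [_ /(_ A B AT BT AB) I _] := triT; case: I.
- by move=> I0; exfalso; rewrite -[False]/(set0 ((1 - s) *: V i + s *: V j)) -I0.
- move=> [m]; rewrite inE => /andP[mA mB] I0.
  have : [set V m] ((1 - s) *: V i + s *: V j) by rewrite -I0.
  move=> /= Q.
  have := @barycentric_unique A (edge_weight i j s) (edge_weight m m 0) AT
    (fun m => edge_weight_out s iA jA) (fun m' => edge_weight_out 0 mA mA).
  rewrite !edge_weight_sum !edge_weight_point Q => /(_ erefl).
  rewrite scale0r addr0 subr0 scale1r => /(_ erefl).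
  move=> /(edge_weight_support ij' s01)[/in2/orP[]/eqP h1 /in2/orP[]/eqP h2];
    by rewrite h1 h2 eqxx in ij'.
move=> [a [b [aAB bAB ab I0]]].
move: aAB bAB; rewrite !inE => /andP[aA aB] /andP[bA bB].
have : hull V [set a; b]%SET ((1 - s) *: V i + s *: V j) by rewrite -I0.
move=> [w [w0 wab w1 wE]].
have wA m : m \notin A -> w m = 0.
  move=> mA; apply: wab; rewrite !inE negb_or.
  by apply/andP; split; apply: contra mA => /eqP ->.
have := @barycentric_unique A (edge_weight i j s) w AT
    (fun m => edge_weight_out s iA jA) wA.
rewrite edge_weight_sum edge_weight_point w1 => /(_ erefl wE).
move=> /(edge_weight_support ij' s01)[wi wj].
have inB m : w m != 0 -> m \in B.
  move=> wm; have : m \in [set a; b]%SET by apply: contraT => /wab h; rewrite h eqxx in wm.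
  by rewrite !inE => /orP[] /eqP ->.
exact: (same B BT (inB _ wi) (inB _ wj)).
Qed.

End Triangulation.

(** * Linear relations between unit vectors *)

Section UnitVectors.
Context {R : realType}.
Implicit Types (u v : R * R).

Definition unit_vector u := u.1 ^+ 2 + u.2 ^+ 2 = 1.
Definition cross u v : R := u.1 * v.2 - u.2 * v.1.

Lemma unit_parallel u v : unit_vector u -> unit_vector v -> cross u v = 0 ->
  u = v \/ u = - v.
Proof.
case: u v => [a b] [c d]; rewrite /unit_vector /cross /= => h1 h2 h3.
have h4 : (a * c + b * d) ^+ 2 = 1.
  transitivity ((a ^+ 2 + b ^+ 2) * (c ^+ 2 + d ^+ 2) - (a * d - b * c) ^+ 2); first by ring.
  by rewrite h1 h2 h3 expr0n mulr1 subr0.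
have h5 : (a * c + b * d - 1) * (a * c + b * d + 1) = 0.
  by transitivity ((a * c + b * d) ^+ 2 - 1); [ring|rewrite h4 subrr].
have sq0 (x y : R) : x ^+ 2 + y ^+ 2 = 0 -> x = 0 /\ y = 0.
  move=> /eqP; rewrite paddr_eq0 ?sqr_ge0// !sqrf_eq0 => /andP[/eqP -> /eqP ->].
  by [].
move/eqP: h5; rewrite mulf_eq0 => /orP[] /eqP h; [left|right].
  have [] : a - c = 0 /\ b - d = 0.
    apply: sq0; transitivity ((a ^+ 2 + b ^+ 2) + (c ^+ 2 + d ^+ 2) - 2 * (a * c + b * d)); first by ring.
    by rewrite h1 h2; lra.
  by move=> e1 e2; congr (_, _); lra.
have [] : a + c = 0 /\ b + d = 0.
  apply: sq0; transitivity ((a ^+ 2 + b ^+ 2) + (c ^+ 2 + d ^+ 2) + 2 * (a * c + b * d)); first by ring.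
  by rewrite h1 h2; lra.
by move=> e1 e2; rewrite [RHS]surjective_pairing /=; congr (_, _); lra.
Qed.

(** A line contains only two unit vectors. If [u1] and [u2] were parallel, the relation with
    [l0 != 0] would put [u0] on the same line as a third one. *)
Lemma cross_neq0 u0 u1 u2 (l0 l1 l2 : R) :
  unit_vector u0 -> unit_vector u1 -> unit_vector u2 ->
  u0 <> u1 -> u0 <> u2 -> u1 <> u2 -> l0 != 0 ->
  l0 *: u0 + l1 *: u1 + l2 *: u2 = 0 -> cross u1 u2 != 0.
Proof.
move=> U0 U1 U2 n01 n02 n12 l00 E; apply/eqP => c0.
have [//|e12] := unit_parallel U1 U2 c0.
have : cross u0 u1 = 0.
  have E1 := congr1 fst E; have E2 := congr1 snd E.
  move: E1 E2; rewrite e12 /cross /= => E1 E2.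
  apply: (mulfI l00); rewrite mulr0.
  rewrite /GRing.scale /= in E1 E2.
  transitivity ((l0 * u0.1 + l1 * - u2.1 + l2 * u2.1) * (- u2.2) -
    (l0 * u0.2 + l1 * - u2.2 + l2 * u2.2) * (- u2.1)); first by ring.
  by rewrite E1 E2 !mul0r subrr.
by move=> /(unit_parallel U0 U1)[//|]; rewrite e12 opprK.
Qed.

(* The relations determine all values from the last two, going backwards. *)
Lemma common_tangent (m : nat) (U : nat -> R * R) (S : nat -> R) :
  (forall r, (r < m.+2)%N -> unit_vector (U r)) ->
  (forall r r', (r < r' < m.+2)%N -> U r <> U r') ->
  (m = 0%N -> cross (U 0%N) (U 1%N) != 0) ->
  (forall t, (t < m)%N -> exists l0 l1 l2, [/\ l0 != 0,
     l0 *: U t + l1 *: U t.+1 + l2 *: U t.+2 = 0 &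
     l0 * S t + l1 * S t.+1 + l2 * S t.+2 = 0]) ->
  exists a b, forall r, (r < m.+2)%N -> S r = a * (U r).1 + b * (U r).2.
Proof.
move=> unitU distU H0 H.
(* The last relation makes the last two directions independent; with only two directions there is no
   relation and the hypothesis is used. *)
have D0 : cross (U m) (U m.+1) != 0.
  case: m unitU distU H0 H => [|m] unitU distU H0 H; first exact: H0.
  have [l0 [l1 [l2 [l00 E _]]]] := H m (ltnSn _).
  apply: (cross_neq0 (u0 := U m) (l0 := l0) (l1 := l1) (l2 := l2)) => //;
    by [apply: unitU; lia|apply: distU; lia|].
pose u := U m; pose v := U m.+1; rewrite -/u -/v in D0.
pose a := (S m * v.2 - S m.+1 * u.2) / cross u v.
pose b := (S m.+1 * u.1 - S m * v.1) / cross u v.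
exists a, b.
have base : S m = a * u.1 + b * u.2 /\ S m.+1 = a * v.1 + b * v.2.
  by move: D0; rewrite /a /b /cross => D0; split; field.
have ind d : forall r, (r < m.+2)%N -> (m <= r + d)%N -> S r = a * (U r).1 + b * (U r).2.
  elim: d => [|d IH] r rm rd.
    have [->|->] : r = m \/ r = m.+1 by lia.
      by case: base.
    by case: base.
  have [rd'|rd'] := leqP m (r + d); first exact: IH.
  have rm' : (r < m)%N by lia.
  have [l0 [l1 [l2 [l00 E1 E2]]]] := H r rm'.
  rewrite (IH r.+1) ?(IH r.+2) in E2; try lia.
  have e1 := congr1 fst E1; have e2 := congr1 snd E1.
  rewrite /= /GRing.scale /= in e1 e2.
  apply: (mulfI l00).
  have -> : l0 * S r = - (l1 * (a * (U r.+1).1 + b * (U r.+1).2)) -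
     (l2 * (a * (U r.+2).1 + b * (U r.+2).2)) by lra.
  have -> : l0 * (a * (U r).1 + b * (U r).2) = a * (l0 * (U r).1) + b * (l0 * (U r).2) by ring.
  have -> : l0 * (U r).1 = - (l1 * (U r.+1).1) - l2 * (U r.+2).1 by lra.
  have -> : l0 * (U r).2 = - (l1 * (U r.+1).2) - l2 * (U r.+2).2 by lra.
  by ring.
by move=> r rm; apply: (ind m) => //; lia.
Qed.

End UnitVectors.

(** * Edges at a vertex and the basic networks *)

Section Edges.
Context {R : realType} {n : nat}.
Variables (V : 'I_n -> R * R) (T : {set {set 'I_n}}).
Hypothesis Vinj : injective V.
Hypothesis triT : triangulation V T.

Lemma enormN (P : R * R) : enorm (- P) = enorm P.
Proof. by rewrite /enorm /= !sqrrN. Qed.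

Lemma enormC (P Q : R * R) : enorm (P - Q) = enorm (Q - P).
Proof. by rewrite -opprB enormN. Qed.

Lemma enorm_gt0 i j : i != j -> 0 < enorm (V j - V i).
Proof.
move=> ij; rewrite /enorm sqrtr_gt0 lt_neqAle addr_ge0 ?sqr_ge0// andbT eq_sym.
rewrite paddr_eq0 ?sqr_ge0// !sqrf_eq0 /= !subr_eq0.
apply: contra ij => /andP[/eqP h1 /eqP h2]; apply/eqP/Vinj.
by rewrite (surjective_pairing (V i)) -h1 -h2 -surjective_pairing.
Qed.

Lemma enorm_sqr (P : R * R) : enorm P ^+ 2 = P.1 ^+ 2 + P.2 ^+ 2.
Proof. by rewrite /enorm sqr_sqrtr// addr_ge0// sqr_ge0. Qed.

Lemma udir_unit i j : i != j -> unit_vector (udir V i j).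
Proof.
move=> /enorm_gt0 e0; rewrite /unit_vector /udir /= /GRing.scale /= !exprMn -mulrDr.
by have := enorm_sqr (V j - V i); rewrite /= => <-; rewrite exprVn mulVf// expf_neq0// gt_eqF.
Qed.

Lemma adjC i j : adj T i j = adj T j i.
Proof.
rewrite /adj eq_sym; congr (_ && _); apply: eq_existsb => A.
by congr (_ && _); rewrite andbC.
Qed.

Lemma adj_neq i j : adj T i j -> i != j.
Proof. by case/andP. Qed.

Lemma mkedge_edges i j : adj T i j -> mkedge i j \in edges T.
Proof.
move=> a; have ij := adj_neq a; rewrite /mkedge; case: ltnP => ji; rewrite inE /=.
  by rewrite ji.
by rewrite ltn_neqAle ji eq_sym ij /= adjC.
Qed.

Lemma len_mkedge i j : len V (mkedge i j) = enorm (V j - V i).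
Proof. by rewrite /len /mkedge; case: ifP => //= _; rewrite enormC. Qed.

Lemma len_gt0 e : e \in edges T -> 0 < len V e.
Proof. by rewrite inE => /andP[_ /adj_neq]; exact: enorm_gt0. Qed.

Lemma mkedge_inj (i j k : 'I_n) : i != j -> i != k -> (mkedge i j == mkedge i k) = (j == k).
Proof.
move=> ij ik; apply/eqP/eqP => [|->//]; rewrite /mkedge.
case: ifP => _; case: ifP => _ [] //; first by move=> h; rewrite h eqxx in ik.
by move=> h; rewrite h eqxx in ij.
Qed.

Lemma mkedge_end (e : 'I_n * 'I_n) i j : i != j -> e = mkedge i j ->
  (e.1 == i /\ e.2 = j) \/ (e.1 == i = false /\ e.1 = j /\ e.2 = i).
Proof.
move=> ij ->; rewrite /mkedge; case: ifP => _ /=; first by left.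
by right; rewrite eq_sym (negbTE ij).
Qed.

Variable nb : 'I_n -> seq 'I_n.
Hypothesis nbT : edge_listing V T nb.

Lemma nth_nb_adj i r : (r < size (nb i))%N -> adj T i (nth i (nb i) r).
Proof. by move=> h; have [_ <- _] := nbT i; exact: mem_nth. Qed.

Lemma cos_eq1 (x : R) : 0 < x < 2 * pi -> cos x <> 1.
Proof.
move=> /andP[x0 x2] c1.
have : 0 < sin (x / 2) by apply: sin_gt0_pi; apply/andP; split; lra.
have := cos2Dsin2 (x / 2); have := cosD (x / 2) (x / 2).
rewrite -splitr c1 -!expr2 => h1 h2; have : sin (x / 2) ^+ 2 = 0 by lra.
by move=> /eqP; rewrite sqrf_eq0 => /eqP ->; rewrite ltxx.
Qed.

Lemma udir_neq i r r' : (r < r')%N -> (r' < size (nb i))%N ->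
  udir V i (nth i (nb i) r) <> udir V i (nth i (nb i) r').
Proof.
move=> rr' rs; have [_ _ [th [H1 H2]]] := nbT i.
rewrite !H1//; last exact: ltn_trans rs.
have [h1 h2] := H2 _ _ rr' rs.
move=> [e1 e2]; apply: (@cos_eq1 (th r - th r')); first by apply/andP; split; lra.
by rewrite cosB e1 e2 -!expr2 cos2Dsin2.
Qed.

Lemma triangle_cross i j k : area2 V i j k != 0 ->
  i != j -> i != k -> cross (udir V i j) (udir V i k) != 0.
Proof.
move=> a ij ik; rewrite /cross /udir /= /GRing.scale /=.
rewrite (_ : _ - _ = ((enorm (V j - V i))^-1 * (enorm (V k - V i))^-1) * area2 V i j k); last first.
  by rewrite /area2; ring.
by rewrite !mulf_neq0// invr_neq0// gt_eqF// enorm_gt0.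
Qed.

(** The other two vertices of a triangle at [V i]; its area is nonzero. *)
Lemma two_neighbours i : exists j k,
  [/\ j \in nb i, k \in nb i & cross (udir V i j) (udir V i k) != 0].
Proof.
have [_ _ /(_ i)[A AT iA]] := triT.
have [a [b [c [ab ac bc AE D]]]] := triangle_area Vinj triT AT.
have inA j k : j \in A -> k \in A -> j != k -> k \in nb j.
  move=> jA kA jk; have [_ -> _] := nbT j; rewrite /adj jk /=.
  by apply/existsP; exists A; rewrite AT jA kA.
have aA : a \in A by rewrite AE eqxx.
have bA : b \in A by rewrite AE eqxx orbT.
have cA : c \in A by rewrite AE eqxx !orbT.
have ba : b != a by rewrite eq_sym.
have ca : c != a by rewrite eq_sym.
have cb : c != b by rewrite eq_sym.
move: iA; rewrite AE => /or3P[] /eqP ->.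
- by exists b, c; split; [exact: inA|exact: inA|exact: triangle_cross].
- exists c, a; split; [exact: inA|exact: inA|apply: triangle_cross => //].
  by apply: contra D => /eqP E; apply/eqP; rewrite -E /area2; ring.
- exists a, b; split; [exact: inA|exact: inA|apply: triangle_cross => //].
  by apply: contra D => /eqP E; apply/eqP; rewrite -E /area2; ring.
Qed.

Lemma size_nb_ge2 i : (2 <= size (nb i))%N.
Proof.
have [j [k [ji ki c]]] := two_neighbours i.
case E : (nb i) => [|x [|y s]] //; first by rewrite E in ji.
rewrite E !inE in ji ki; move: c; rewrite (eqP ji) (eqP ki) /cross.
by rewrite mulrC subrr eqxx.
Qed.

Lemma cross_nb2 i : size (nb i) = 2%N ->
  cross (udir V i (nth i (nb i) 0)) (udir V i (nth i (nb i) 1)) != 0.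
Proof.
have [j [k [ji ki c]]] := two_neighbours i.
case E : (nb i) => [|x [|y [|]]] //= _; rewrite E !inE in ji ki.
have cxx u : cross u u != 0 :> R = false by rewrite /cross mulrC subrr eqxx.
case/orP: ji => /eqP ej; case/orP: ki => /eqP ek; move: c; rewrite ej ek //.
- by rewrite cxx.
- by apply: contra => /eqP c0; apply/eqP; rewrite -[RHS]oppr0 -c0 /cross; ring.
- by rewrite cxx.
Qed.

Variable lam : NB nb -> 'I_3 -> R.
Hypothesis lamE : basic_coefs V lam.
Hypothesis lam0 : forall k, lam k ord0 != 0.

Lemma tangent_plane i (S : 'I_n -> R) :
  (forall k : NB nb, tag k = i -> \sum_r lam k r * S (nbr k r) = 0) ->
  exists a b, forall j, j \in nb i -> S j = a * (udir V i j).1 + b * (udir V i j).2.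
Proof.
move=> H; have m2 := size_nb_ge2 i; pose m := (size (nb i) - 2)%N.
have mE : size (nb i) = m.+2 by rewrite /m; lia.
have [|||t tm|a [b Hab]] := @common_tangent R m
    (fun r => udir V i (nth i (nb i) r)) (fun r => S (nth i (nb i) r)).
- by move=> r; rewrite -mE => rm; apply: udir_unit; apply: adj_neq (nth_nb_adj rm).
- by move=> r r'; rewrite -mE => /andP[h1 h2]; exact: udir_neq.
- by move=> m0; apply: cross_nb2; rewrite mE m0.
- pose k : NB nb := Tagged (fun j => 'I_(size (nb j) - 2)) (Ordinal tm : 'I_(size (nb i) - 2)).
  exists (lam k ord0), (lam k (lift ord0 ord0)), (lam k (lift ord0 (lift ord0 ord0))).
  have [_ h1] := lamE k; have h2 := H k erefl.
  rewrite !big_ord_recl !big_ord0 !addr0 !addrA /nbr /= in h1 h2.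
  by split; [exact: lam0|move: h1|move: h2];
    rewrite /bump /= !addn0 ?addn1 ?(addnC _ 1) ?(addnC _ 2) //.
exists a, b => j jn; have := Hab (index j (nb i)).
by rewrite nth_index// -mE index_mem; apply.
Qed.

Lemma nbr_lt (k : NB nb) (r : 'I_3) : (tagged k + r < size (nb (tag k)))%N.
Proof. by have := ltn_ord (tagged k); have := ltn_ord r; lia. Qed.

Lemma nbr_adj (k : NB nb) r : adj T (tag k) (nbr k r).
Proof. by apply: nth_nb_adj; exact: nbr_lt. Qed.

Lemma nbr_eq (k l : NB nb) r r' : tag k = tag l ->
  (nbr k r == nbr l r') = (tagged k + r == tagged l + r')%N.
Proof.
have := nbr_lt k r; have := nbr_lt l r'.
case: k l => [i t] [j u] /= h1 h2 ij; subst j; rewrite /nbr /=.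
by have [un _ _] := nbT i; rewrite nth_uniq.
Qed.

Lemma basic_affine k e : exists a b, forall t, basic V lam k e t = a * t + b.
Proof.
pose a := if e.1 == tag k then 1 else -1 : R.
pose b := if e.1 == tag k then 0 else len V e.
exists (\sum_(r | e == mkedge (tag k) (nbr k r)) lam k r * - (a / len V e)).
exists (\sum_(r | e == mkedge (tag k) (nbr k r)) lam k r * (1 - b / len V e)).
move=> t; rewrite mulr_suml -big_split /=; apply: eq_bigr => r _.
have -> : dist_from V (tag k) e t = a * t + b.
  by rewrite /dist_from /a /b; case: ifP => _; ring.
ring.
Qed.

Lemma basic_continuous k : net_continuous (basic V lam k).
Proof.
move=> e; have [a [b E]] := basic_affine k e.
have -> : basic V lam k e = fun t => a * t + b by apply/funext.
move=> t; apply: cvgD; last exact: cvg_cst.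
by apply: cvgM; [exact: cvg_cst|exact: cvg_id].
Qed.

Definition end_param (i : 'I_n) (e : 'I_n * 'I_n) : R :=
  if e.1 == i then 0 else len V e.

Lemma basic_end k i j : adj T i j ->
  basic V lam k (mkedge i j) (end_param i (mkedge i j)) =
  if tag k == i then \sum_(r | nbr k r == j) lam k r else 0.
Proof.
move=> ij; have eE := mkedge_edges ij; have L0 := len_gt0 eE.
have nij := adj_neq ij; rewrite /basic; case: eqP => [ki|/eqP ki].
  apply: eq_big => [r|r _].
    rewrite ki mkedge_inj//; try by rewrite eq_sym.
    by rewrite -ki; exact: adj_neq (nbr_adj k r).
  rewrite ki /dist_from /end_param.
  by case: (_ == i); rewrite ?subrr mul0r subr0 mulr1.
apply: big1 => r /eqP E; rewrite /dist_from /end_param.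
have := mkedge_end (adj_neq (nbr_adj k r)) E.
have := mkedge_end nij erefl.
case=> [[/eqP h1 h2]|[h0 [h1 h2]]]; case=> [[/eqP g1 g2]|[g0 [g1 g2]]].
- by case/eqP: ki; rewrite -g1 h1.
- by rewrite g0 h1 eqxx subr0 divff ?gt_eqF// subrr mulr0.
- by rewrite h0 g1 eqxx divff ?gt_eqF// subrr mulr0.
- by case/eqP: ki; rewrite -g2 h2.
Qed.

(** The combination is affine on each edge, so it vanishes up to the end points. At the vertex of
    [k], on its first edge, networks of larger index are absent and those of smaller index have zero
    coefficient by induction; what remains is [c k] times the nonzero first coefficient. *)
Lemma basic_free (c : NB nb -> R) :
  (forall e t, e \in edges T -> 0 < t < len V e -> \sum_k c k * basic V lam k e t = 0) ->
  forall k, c k = 0.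
Proof.
move=> H.
have Hall e t : e \in edges T -> \sum_k c k * basic V lam k e t = 0.
  move=> eE; have L0 := len_gt0 eE.
  have /choice[a /choice[b E]] := fun k => basic_affine k e.
  pose A := \sum_k c k * a k; pose B := \sum_k c k * b k.
  have SE s : \sum_k c k * basic V lam k e s = A * s + B.
    rewrite mulr_suml -big_split /=; apply: eq_bigr => k _; rewrite E; ring.
  (* Two inner points determine the affine function. *)
  have e1 : A * (len V e / 3) + B = 0 by rewrite -SE H//; apply/andP; split; lra.
  have e2 : A * (2 * len V e / 3) + B = 0 by rewrite -SE H//; apply/andP; split; lra.
  have A0 : A = 0.
    by apply: (mulIf (lt0r_neq0 L0)); rewrite mul0r; lra.
  by rewrite SE A0 mul0r add0r; rewrite A0 mul0r add0r in e1.
have ind m : forall k : NB nb, (tagged k < m)%N -> c k = 0.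
  elim: m => [//|m IH] k km.
  have kadj := nbr_adj k ord0.
  have := Hall _ (end_param (tag k) (mkedge (tag k) (nbr k ord0))) (mkedge_edges kadj).
  rewrite (bigD1 k)//= basic_end// eqxx (bigD1 ord0)//= big1 ?addr0; last first.
    by move=> r /andP[+ r0]; rewrite nbr_eq// eqn_add2l => /eqP h; case/eqP: r0; apply: val_inj.
  rewrite big1 ?addr0; first by move/eqP; rewrite mulf_eq0 (negbTE (lam0 k)) orbF => /eqP.
  move=> l lk; rewrite basic_end//; case: eqP => [tl|]; last by rewrite mulr0.
  have [ltkl|lekl] := ltnP (tagged l) (tagged k).
    by rewrite IH ?mul0r// (leq_trans ltkl).
  rewrite big1 ?mulr0// => r; rewrite nbr_eq// => /eqP h.
  case/eqP: lk; have {lekl} h2 : tagged l = tagged k :> nat.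
    apply/eqP; rewrite eqn_leq lekl andbT -[X in (_ <= X)%N]addn0.
    by rewrite -[X in (_ <= _ + X)%N]/(@nat_of_ord 3 ord0) -h leq_addr.
  move: h2 {h}.
  case: l k tl {km kadj} => [i t] [j u] /= ij; subst j => tu.
  by congr (Tagged _ _); apply: val_inj.
by move=> k; apply: (ind (tagged k).+1).
Qed.

End Edges.

(** * Interpolating networks *)

Section IntegralIdentity.
Context {R : realType} {n : nat}.
Variables (V : 'I_n -> R * R) (z : 'I_n -> R) (T : {set {set 'I_n}}).
Variables (nb : 'I_n -> seq 'I_n) (lam : NB nb -> 'I_3 -> R).
Hypothesis Vinj : injective V.
Hypothesis nbT : edge_listing V T nb.
Variables (f g : network R n).
Hypothesis Df : forall e, e \in edges T -> derivative_on 0 (len V e) (f e) (g e).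
Hypothesis ACg : forall e, e \in edges T -> absolutely_continuous 0 (len V e) (g e).
Hypothesis mf : forall e, e \in edges T ->
  measurable_fun (`]0, len V e[%classic : set (measurableTypeR R)) (deriv2 f e).
Hypothesis fz : forall e, e \in edges T -> f e 0 = z e.1 /\ f e (len V e) = z e.2.
Notation lambda := (@lebesgue_measure R).

(* The derivative at V i in the direction of the edge, away from V i *)
Definition slope (i : 'I_n) (e : 'I_n * 'I_n) : R :=
  if e.1 == i then g e 0 else - g e (len V e).

Lemma edge_integral i j : adj T i j ->
  let e := mkedge i j in
  lambda.-integrable `[0, len V e]
    (EFin \o (fun t => deriv2 f e t * (1 - dist_from V i e t / len V e))) /\
  \int[lambda]_(t in `[0, len V e]) (deriv2 f e t * (1 - dist_from V i e t / len V e))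
    = (z j - z i) / enorm (V j - V i) - slope i e.
Proof.
move=> ij e; have eE := mkedge_edges ij; rewrite -/e in eE.
have L0 := len_gt0 Vinj eE.
have [i1 i2 e1 e2] := second_derivative_parts L0 (Df eE) (ACg eE) (mf eE).
have [f0 fL] := fz eE; rewrite -(len_mkedge V i j) -/e /slope /dist_from.
have mi : measurable (`[0, len V e]%classic : set (measurableTypeR R)).
  exact: measurable_itv.
case: (@mkedge_end _ e i j (adj_neq ij) erefl) => [[/eqP h1 h2]|[h0 [h1 h2]]].
  by split; rewrite h1 eqxx// e2 fL f0 h1 h2.
(* When [i] is the second end, the weight is 1 minus the weight of the first end, so its integral is
   a difference of two known ones. *)
have E t : deriv2 f e t - deriv2 f e t * (1 - t / len V e) =
    deriv2 f e t * (1 - (len V e - t) / len V e).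
  by field; rewrite gt_eqF.
rewrite h0; split.
  have := integrableB mi i1 i2; apply: eq_integrable => // t _ /=.
  by rewrite -EFinB E.
transitivity (\int[lambda]_(t in `[0, len V e])
   (deriv2 f e t - deriv2 f e t * (1 - t / len V e))).
  by apply: eq_Rintegral => t _; rewrite E.
by rewrite RintegralB// e1 e2 fL f0 h1 h2; ring.
Qed.

(** No common tangent plane is assumed, hence the defect term in the slopes. It is 0 for networks
    induced by C^1 functions, and for a solution of the system this identity shows that it is 0. *)
Lemma network_integral_identity l :
  net_integrable (edges T) (len V) (fun e t => deriv2 f e t * basic V lam l e t) /\
  net_integral (edges T) (len V) (fun e t => deriv2 f e t * basic V lam l e t) =
  basic_d V z lam l -
    \sum_r lam l r * slope (tag l) (mkedge (tag l) (nbr l r)).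
Proof.
pose b (r : 'I_3) : network R n := fun e t => if e == mkedge (tag l) (nbr l r) then
  deriv2 f e t * (1 - dist_from V (tag l) e t / len V e) else 0.
have bi r : net_integrable (edges T) (len V) (b r).
  move=> e eE; rewrite /b; case: eqP => [->|_].
    by have [] := edge_integral (nbr_adj nbT l r).
  apply: continuous_integrable_itv; exact: cst_continuous.
have [h1 h2] := net_integral_sum (lam l) bi.
have E : (fun e t => deriv2 f e t * basic V lam l e t) =
    (fun e t => \sum_r lam l r * b r e t) :> network R n.
  apply/funext => e; apply/funext => t; rewrite /basic mulr_sumr big_mkcond.
  by apply: eq_bigr => r _; rewrite /b; case: ifP => _; [ring|rewrite mulr0].
rewrite E; split=> //; rewrite h2 /basic_d -sumrB; apply: eq_bigr => r _.
have eE := mkedge_edges (nbr_adj nbT l r).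
rewrite /net_integral (bigD1 (mkedge (tag l) (nbr l r)))//= big1 ?addr0; last first.
  by move=> e /andP[_ /negbTE ne]; rewrite /b ne Rintegral_cst ?mul0r//; exact: measurable_itv.
have [_ e1] := edge_integral (nbr_adj nbT l r).
rewrite /b eqxx e1; ring.
Qed.

End IntegralIdentity.

(** * Integrating twice along an edge *)

Section Primitives.
Context {R : realType}.
Implicit Types (phi f g : R -> R).

Lemma primitive phi (a b : R) : continuous phi -> a < b -> exists F : R -> R,
  forall x, a < x < b -> is_derive x (1 : R) F (phi x).
Proof.
move=> cphi ab; exists (fun x => \int[lebesgue_measure]_(t in `[a, x]) phi t).
move=> x /andP[ax xb].
have [d e] := continuous_FTC1_closed xb (continuous_integrable_itv a b cphi) ax (cphi x).
apply: DeriveDef; first exact: d.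
by rewrite -derive1E e.
Qed.

Lemma clamp_continuous (a b : R) : continuous (clamp a b).
Proof.
move=> x; apply: continuous_max; first exact: cst_continuous.
by apply: continuous_min; [exact: cst_continuous|move=> u; exact: cvg_id].
Qed.

Lemma boundary_value_problem phi (L z0 zL : R) : continuous phi -> 0 < L ->
  exists f g : R -> R, [/\ f 0 = z0, f L = zL,
    forall x, 0 <= x <= L -> is_derive x (1 : R) f (g x) &
    forall x, 0 <= x <= L -> is_derive x (1 : R) g (phi x)].
Proof.
move=> cphi L0.
(* The interval is enlarged on both sides so that two-sided derivatives exist at 0 and [L]. Clamping
   [F1] half a unit beyond the edge gives a function continuous on the line, which can be integrated
   again. *)
have [|F1 D1] := @primitive phi (-1) (L + 1) cphi; first by lra.
pose h := F1 \o clamp (- 2^-1) (L + 2^-1).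
have hE x : - 2^-1 <= x <= L + 2^-1 -> h x = F1 x by move=> ?; rewrite /h /= clamp_id.
have hab : - 2^-1 <= L + 2^-1 by lra.
have ch : continuous h.
  move=> x; apply: continuous_comp; first exact: clamp_continuous.
  have /andP[h1 h2] := clamp_itv x hab.
  apply: (continuous_derivable (D1 (clamp (- 2^-1) (L + 2^-1) x) _)).
  by apply/andP; split; lra.
have [|F2 D2] := @primitive h (-1) (L + 1) ch; first by lra.
pose k := (zL - z0 - F2 L + F2 0) / L.
exists (fun x => F2 x + (k * x + (z0 - F2 0))), (fun x => F1 x + k); split.
- by ring.
- by rewrite /k; field; rewrite gt_eqF.
- move=> x /andP[x0 xL]; have -> : F1 x = h x by rewrite hE//; apply/andP; split; lra.
  apply: is_deriveD; last exact: is_derive_affine.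
  by apply: D2; apply/andP; split; lra.
move=> x /andP[x0 xL]; rewrite -[phi x]addr0.
have d1 : is_derive x (1 : R) F1 (phi x) by apply: D1; apply/andP; split; lra.
exact: is_deriveD d1 (is_derive_cst k x 1).
Qed.

Lemma derivative_on_is_derive (a b : R) f g :
  (forall x, a <= x <= b -> is_derive x (1 : R) f (g x)) -> derivative_on a b f g.
Proof.
move=> H t; rewrite in_itv /= => /H /is_derive_cvgE h.
exact: cvg_within_filter.
Qed.

Lemma lipschitz_ac (a b : R) g M : 0 <= M ->
  (forall c d, a <= c -> c <= d -> d <= b -> `|g d - g c| <= M * (d - c)) ->
  absolutely_continuous a b g.
Proof.
move=> M0 H; apply: (@ac_perturb _ a b (cst 0) g M) => //.
  move=> e e0; exists 1 => // N c d _ _ _; rewrite big1// => k _.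
  by rewrite subrr normr0.
by move=> c d ac cd db; rewrite subrr normr0 add0r H.
Qed.

Lemma C1_ac (a b : R) g phi : a <= b -> continuous phi -> derivative_on a b g phi ->
  absolutely_continuous a b g.
Proof.
move=> ab cphi D.
have cn : {within `[a, b], continuous (Num.norm \o phi)}.
  apply: continuous_subspaceT => t; apply: continuous_comp; first exact: cphi.
  exact: norm_continuous.
have [s _ sM] := EVT_max ab cn.
apply: (@lipschitz_ac a b g `|phi s|) => // c d ac cd db.
have [x xab ->] := derivative_on_MVT D ac cd db.
by rewrite normrM (ger0_norm (_ : 0 <= d - c)) ?subr_ge0// ler_wpM2r ?subr_ge0//; exact: sM.
Qed.

Lemma eq_derivative_on (a b : R) f h g : a < b ->
  (forall t, a <= t <= b -> f t = h t) -> derivative_on a b f g -> derivative_on a b h g.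
Proof.
move=> ab E D t tab; have := D t tab; apply: cvg_trans.
apply: near_eq_cvg; rewrite !near_withinE; apply: nearW => s _ sab.
by rewrite !E// -in_itv.
Qed.

Lemma eq_deriv2 (a b : R) f h : (forall t, a <= t <= b -> f t = h t) ->
  forall t, a < t < b -> derive1n 2 f t = derive1n 2 h t.
Proof.
move=> E.
have E1 t : a < t < b -> derive1 f t = derive1 h t.
  move=> tab; rewrite !derive1E; apply: near_eq_derive.
  have tab' : t \in `]a, b[ by rewrite in_itv.
  apply: filterS (near_in_itvoo tab') => s; rewrite in_itv /= => /andP[? ?].
  by apply: E; rewrite !ltW.
move=> t tab; rewrite !derive1nS !derive1n0 [LHS]derive1E [RHS]derive1E; apply: near_eq_derive.
have tab' : t \in `]a, b[ by rewrite in_itv.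
by apply: filterS (near_in_itvoo tab') => s; rewrite in_itv /=; exact: E1.
Qed.

Lemma grad_line (F : R * R -> R) (x y u v t a b : R) :
  grad_at F (x + t * u, y + t * v) a b ->
  is_derive t (1 : R) (fun s => F (x + s * u, y + s * v)) (a * u + b * v).
Proof.
move=> HF; apply/is_deriveP => e e0.
pose K := `|u| + `|v| + 1; have K0 : 0 < K by rewrite ltr_wpDl// addr_ge0.
have eK : 0 < e / K by rewrite divr_gt0.
have c : {for t, continuous (fun s : R => (x + s * u, y + s * v))}.
  have line (x' u' : R) : {for t, continuous (fun s : R => x' + s * u')}.
    by apply: cvgD; [exact: cvg_cst|apply: cvgM; [exact: cvg_id|exact: cvg_cst]].
  exact: (cvg_pair (line x u) (line y v)).
have n1 : \forall s \near t, `|F (x + s * u, y + s * v) - F (x + t * u, y + t * v) -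
    (a * (x + s * u - (x + t * u)) + b * (y + s * v - (y + t * v)))| <=
    e / K * `|(x + s * u, y + s * v) - (x + t * u, y + t * v)| := c _ (HF _ eK).
apply: filterS n1 => s /=.
have -> : a * (x + s * u - (x + t * u)) + b * (y + s * v - (y + t * v)) =
  (a * u + b * v) * (s - t) by ring.
move=> /le_trans; apply; rewrite prod_normE /= .
have -> : x + s * u - (x + t * u) = (s - t) * u by ring.
have -> : y + s * v - (y + t * v) = (s - t) * v by ring.
rewrite -mulrA (mulrC _^-1); apply: ler_wpM2l; first exact: ltW.
rewrite ler_pdivrMr// ge_max !normrM; apply/andP; split; apply: ler_wpM2l => //.
  by rewrite /K -addrA lerDl addr_ge0.
by rewrite /K addrAC lerDr addr_ge0.
Qed.

End Primitives.

(** * Extension of a network to the plane *)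

Section Extension.
Context {R : realType} {n : nat}.
Variables (V : 'I_n -> R * R) (z : 'I_n -> R) (T : {set {set 'I_n}}).
Variables (nb : 'I_n -> seq 'I_n) (lam : NB nb -> 'I_3 -> R).
Hypothesis Vinj : injective V.
Hypothesis triT : triangulation V T.
Hypothesis nbT : edge_listing V T nb.
Hypothesis lamE : basic_coefs V lam.
Hypothesis lam0 : forall k, lam k ord0 != 0.
Variable phi : network R n.
Hypothesis cphi : net_continuous phi.
Hypothesis phiE : forall l,
  net_integral (edges T) (len V) (fun e t => phi e t * basic V lam l e t) = basic_d V z lam l.

Let dir (e : 'I_n * 'I_n) := udir V e.1 e.2.

Lemma edge_neq e : e \in edges T -> e.1 != e.2.
Proof. by rewrite inE => /andP[_ /adj_neq]. Qed.

Lemma edge_adj e : e \in edges T -> adj T e.1 e.2.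
Proof. by rewrite inE => /andP[]. Qed.

Lemma edge_mkedge e : e \in edges T -> e = mkedge e.1 e.2.
Proof. by rewrite inE /mkedge => /andP[-> _]; case: e. Qed.

Lemma epointE e t : e \in edges T ->
  epoint V e t = ((V e.1).1 + t * (dir e).1, (V e.1).2 + t * (dir e).2).
Proof.
move=> eE; have L0 := len_gt0 Vinj eE.
rewrite /epoint /dir /udir -/(len V e) [LHS]surjective_pairing /= /GRing.scale /=.
by congr (_, _); field; rewrite gt_eqF.
Qed.

Lemma epoint0 e : epoint V e 0 = V e.1.
Proof. by rewrite /epoint mul0r subr0 scale1r scale0r addr0. Qed.

Lemma epointL e : e \in edges T -> epoint V e (len V e) = V e.2.
Proof.
move=> /(len_gt0 Vinj) L0.
by rewrite /epoint divff ?gt_eqF// subrr scale0r scale1r add0r.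
Qed.

Definition along e (P : R * R) : R := (dir e).1 * P.1 + (dir e).2 * P.2 +
  - ((dir e).1 * (V e.1).1 + (dir e).2 * (V e.1).2).
Definition across e (P : R * R) : R := - (dir e).2 * P.1 + (dir e).1 * P.2 +
  ((dir e).2 * (V e.1).1 - (dir e).1 * (V e.1).2).

Lemma dir_unit e : e \in edges T -> (dir e).1 ^+ 2 + (dir e).2 ^+ 2 = 1.
Proof. by move=> /edge_neq; exact: udir_unit. Qed.

Lemma along_epoint e t : e \in edges T ->
  along e (epoint V e t) = t /\ across e (epoint V e t) = 0.
Proof.
move=> eE; rewrite epointE// /along /across; have := dir_unit eE.
case: (dir e) => c s /= h; split; last by ring.
by transitivity (t * (c ^+ 2 + s ^+ 2)); [ring|rewrite h mulr1].
Qed.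

Lemma across_eq0 e P : e \in edges T -> across e P = 0 -> P = epoint V e (along e P).
Proof.
move=> eE; rewrite epointE// /along /across; have := dir_unit eE.
case: (dir e) => c s; case: (V e.1) => x y; case: P => a b /= h1 h2.
congr (_, _).
  transitivity (x + ((c ^+ 2 + s ^+ 2) * (a - x) + s * (- s * a + c * b + (s * x - c * y)))).
    by rewrite h2 h1; ring.
  by ring.
transitivity (y + ((c ^+ 2 + s ^+ 2) * (b - y) - c * (- s * a + c * b + (s * x - c * y)))).
  by rewrite h2 h1; ring.
by ring.
Qed.

(** No other edge meets the interior of [e], so each one avoids some lens around [e]; the smallest
    of the finitely many widths serves for all. *)
Lemma lens_width e : e \in edges T -> exists2 c, 0 < c &
  forall e' t, e' \in edges T -> e' != e -> 0 <= t <= len V e' ->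
  let P := epoint V e' t in
  0 < along e P < len V e -> c * (along e P * (len V e - along e P)) <= `|across e P|.
Proof.
move=> eE; have L0 := len_gt0 Vinj eE.
have H e' : exists c, 0 < c /\ (e' \in edges T -> e' != e -> forall t, 0 <= t <= len V e' ->
  let P := epoint V e' t in
  0 < along e P < len V e -> c * (along e P * (len V e - along e P)) <= `|across e P|).
  have [eE'|] := boolP (e' \in edges T); last by exists 1.
  have [->|e'e] := eqVneq e' e; first by exists 1.
  have L'0 := len_gt0 Vinj eE'.
  pose x0 := along e (V e'.1); pose x1 := along e (V e'.2) - x0.
  pose y0 := across e (V e'.1); pose y1 := across e (V e'.2) - y0.
  pose pt s := (1 - s) *: V e'.1 + s *: V e'.2.
  have Ex s : along e (pt s) = x0 + x1 * s.
    by rewrite /x1 /x0 /along /pt; case: (dir e) => d1 d2; rewrite /= /GRing.scale /=; ring.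
  have Ey s : across e (pt s) = y0 + y1 * s.
    by rewrite /y1 /y0 /across /pt; case: (dir e) => d1 d2; rewrite /= /GRing.scale /=; ring.
  have [|c c0 Hc] := @affine_separation R (len V e) x0 x1 y0 y1 L0.
    move=> s s01; rewrite -Ey -Ex => /(across_eq0 eE) E; apply/negP => /andP[a0 aL].
    have s01' : 0 < along e (pt s) / len V e < 1.
      by rewrite divr_gt0//= ltr_pdivrMr// mul1r.
    move/negP: e'e; apply; rewrite eq_sym; apply/eqP.
    apply: (edges_cross Vinj triT eE eE' s01' s01); exact: (esym E).
  exists c; split=> // _ _ t /andP[t0 tL] P.
  have PE : P = pt (t / len V e') by [].
  rewrite PE Ex Ey; apply: Hc.
  by rewrite divr_ge0 ?(ltW L'0)//= ler_pdivrMr// mul1r.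
have [c Hc] := choice H.
exists (\big[Num.min/1]_e' c e').
  apply: (big_ind (fun x => 0 < x)) => // [x y x0 y0|e' _]; last by have [] := Hc e'.
  by rewrite lt_min x0.
move=> e' t e'E e'e tL P aP; have [_ H1] := Hc e'.
apply: le_trans (H1 e'E e'e t tL aP); apply: ler_wpM2r; last exact: bigmin_le.
by case/andP: aP => a0 aL; apply: mulr_ge0; [exact: ltW|rewrite subr_ge0; exact: ltW].
Qed.

(** The function [G] has the values of [f] and its slopes along the edge at both ends, so [f - G]
    has the double zeros there that the lens construction requires. *)
Lemma edge_bump e (G Gx Gy : R * R -> R) (f g : R -> R) : e \in edges T ->
  C1plane G Gx Gy ->
  (forall t, 0 <= t <= len V e -> is_derive t (1 : R) f (g t)) ->
  (forall t, 0 <= t <= len V e -> {for t, continuous g}) ->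
  f 0 = G (V e.1) -> f (len V e) = G (V e.2) ->
  g 0 = Gx (V e.1) * (dir e).1 + Gy (V e.1) * (dir e).2 ->
  g (len V e) = Gx (V e.2) * (dir e).1 + Gy (V e.2) * (dir e).2 ->
  exists F Fx Fy, [/\ C1plane F Fx Fy,
    forall t, 0 <= t <= len V e -> F (epoint V e t) = f t - G (epoint V e t) &
    forall e' t, e' \in edges T -> e' != e -> 0 <= t <= len V e' ->
      F (epoint V e' t) = 0].
Proof.
move=> eE HG df cg f0 fL g0 gL; have L0 := len_gt0 Vinj eE.
have [c c0 Hc] := lens_width eE; have [cGx cGy gradG] := HG.
pose gam t := ((V e.1).1 + t * (dir e).1, (V e.1).2 + t * (dir e).2).
have gamE t : epoint V e t = gam t by rewrite epointE.
pose psi t := f t - G (gam t).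
pose psi' t := g t - (Gx (gam t) * (dir e).1 + Gy (gam t) * (dir e).2).
have dpsi t : 0 <= t <= len V e -> is_derive t (1 : R) psi (psi' t).
  by move=> tL; exact: is_deriveB (df t tL) (grad_line (gradG (gam t))).
have cgam : continuous gam.
  have line (x u t : R) : {for t, continuous (fun s : R => x + s * u)}.
    by apply: cvgD; [exact: cvg_cst|apply: cvgM; [exact: cvg_id|exact: cvg_cst]].
  by move=> t; exact: (cvg_pair (line _ _ t) (line _ _ t)).
have cpsi t : 0 <= t <= len V e -> {for t, continuous psi'}.
  move=> tL; apply: cvgB; first exact: cg.
  have c1 : {for t, continuous (Gx \o gam)}.
    by apply: continuous_comp; [exact: cgam|exact: cGx].
  have c2 : {for t, continuous (Gy \o gam)}.
    by apply: continuous_comp; [exact: cgam|exact: cGy].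
  by apply: cvgD; apply: cvgM; [exact: c1|exact: cvg_cst|exact: c2|exact: cvg_cst].
have gam0 : gam 0 = V e.1 by rewrite -gamE epoint0.
have gamL : gam (len V e) = V e.2 by rewrite -gamE epointL.
have psi0 : psi 0 = 0 /\ psi' 0 = 0.
  by rewrite /psi /psi' gam0 f0 g0 !subrr.
have psiL : psi (len V e) = 0 /\ psi' (len V e) = 0.
  by rewrite /psi /psi' gamL fL gL !subrr.
have := C1_lens L0 c0 dpsi cpsi psi0 psiL (dir e).1 (dir e).2
  (- ((dir e).1 * (V e.1).1 + (dir e).2 * (V e.1).2)) (- (dir e).2) (dir e).1
  ((dir e).2 * (V e.1).1 - (dir e).1 * (V e.1).2).
set F := lens _ _ _ _ _ _ _ _ _ => HF.
do 3 eexists; split; first exact: HF.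
- move=> t tL; have [al ac] := along_epoint t eE.
  rewrite /F (@lens_axis R psi psi' (len V e) c psi0 psiL)// -/(along e _) ?al//.
  by rewrite /psi gamE.
move=> e' t e'E e'e tL; apply: lens_outside => //; rewrite -/(along e _) -/(across e _).
exact: Hc.
Qed.

(* A Hermite interpolant [G] takes the tangent planes at the vertices; the
   remaining difference on each edge is added by a lens bump that vanishes on
   all the other edges. *)
Lemma network_extension : exists F : R * R -> R,
  [/\ forall i, F (V i) = z i, C1_on (domain V T) F &
   forall e, e \in edges T -> exists g,
     [/\ derivative_on 0 (len V e) (induced V F e) g,
         absolutely_continuous 0 (len V e) g &
         forall t, 0 < t < len V e -> deriv2 (induced V F) e t = phi e t]].
Proof.
have H0 e : exists fg : (R -> R) * (R -> R), e \in edges T ->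
    [/\ fg.1 0 = z e.1, fg.1 (len V e) = z e.2,
      forall x, 0 <= x <= len V e -> is_derive x (1 : R) fg.1 (fg.2 x) &
      forall x, 0 <= x <= len V e -> is_derive x (1 : R) fg.2 (phi e x)].
  have [eE|] := boolP (e \in edges T); last by exists (0, 0).
  have [f [g [h1 h2 h3 h4]]] := boundary_value_problem (z e.1) (z e.2) (@cphi e) (len_gt0 Vinj eE).
  by exists (f, g).
have [fg Hfg] := choice H0.
pose f : network R n := fun e => (fg e).1; pose g : network R n := fun e => (fg e).2.
have Df e : e \in edges T -> derivative_on 0 (len V e) (f e) (g e).
  by move=> eE; apply: derivative_on_is_derive; have [] := Hfg e eE.
have Dg e : e \in edges T -> derivative_on 0 (len V e) (g e) (phi e).
  by move=> eE; apply: derivative_on_is_derive; have [] := Hfg e eE.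
have ACg e : e \in edges T -> absolutely_continuous 0 (len V e) (g e).
  by move=> eE; apply: (C1_ac (ltW (len_gt0 Vinj eE)) (@cphi e) (Dg e eE)).
have f2 e t : e \in edges T -> 0 < t < len V e -> deriv2 f e t = phi e t.
  move=> eE tL; apply: (derive1n2_inner (Df e eE) tL).
  have [_ _ _ dg] := Hfg e eE; apply: dg.
  by case/andP: tL => ? ?; rewrite !ltW.
have mf e : e \in edges T ->
    measurable_fun (`]0, len V e[%classic : set (measurableTypeR R)) (deriv2 f e).
  move=> eE; apply: (eq_measurable_fun (phi e)).
    by move=> t; rewrite inE /= in_itv /= => tL; rewrite f2.
  apply: measurable_funTS; apply: continuous_measurable_fun; exact: cphi.
have fz e : e \in edges T -> f e 0 = z e.1 /\ f e (len V e) = z e.2.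
  by move=> eE; have [] := Hfg e eE.
(* Here the system enters: the integral equals [basic_d], so the defect term of the integral
   identity is 0. *)
have slopes l : \sum_r lam l r * slope V g (tag l) (mkedge (tag l) (nbr l r)) = 0.
  have [_ E] := network_integral_identity lam Vinj nbT Df ACg mf fz l.
  have E2 : net_integral (edges T) (len V) (fun e t => deriv2 f e t * basic V lam l e t) =
      basic_d V z lam l.
    rewrite -phiE; apply: eq_bigr => e eE.
    have L0 := len_gt0 Vinj eE.
    have cpb : continuous (fun t => phi e t * basic V lam l e t).
      by move=> t; apply: cvgM; [exact: cphi|exact: basic_continuous].
    have kp : {ae @lebesgue_measure R, forall t, 0 < t < len V e ->
        deriv2 f e t * basic V lam l e t = phi e t * basic V lam l e t}.
      by apply: aeW => t tL; rewrite f2.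
    have mk : measurable_fun (`]0, len V e[%classic : set (measurableTypeR R))
        (fun t => deriv2 f e t * basic V lam l e t).
      apply: measurable_funM; first exact: mf.
      apply: measurable_funTS; apply: continuous_measurable_fun; exact: basic_continuous.
    by have [] := Rintegral_open_ae_eq mk (continuous_integrable_itv _ _ cpb) kp.
  by move: E; rewrite E2 => /eqP; rewrite eq_sym subr_eq addrC -subr_eq subrr eq_sym => /eqP.
have /choice[ab Hab] : forall i, exists ab : R * R, forall j, j \in nb i ->
    slope V g i (mkedge i j) = ab.1 * (udir V i j).1 + ab.2 * (udir V i j).2.
  move=> i; have [|a [b Hab]] := @tangent_plane R n V T Vinj triT nb nbT lam lamE lam0 i
    (fun j => slope V g i (mkedge i j)).
    by move=> k ki; rewrite -[RHS](slopes k) ki.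
  by exists (a, b).
have [G [Gx [Gy [HG GV]]]] := C1_hermite Vinj z (fun i => (ab i).1) (fun i => (ab i).2).
(* Pairs that are not edges receive the zero bump, so that the sum can run over all pairs. *)
have H1 e : exists F : (R * R -> R) * ((R * R -> R) * (R * R -> R)),
  C1plane F.1 F.2.1 F.2.2 /\ (if e \in edges T then
    (forall t, 0 <= t <= len V e -> F.1 (epoint V e t) = f e t - G (epoint V e t)) /\
    (forall e' t, e' \in edges T -> e' != e -> 0 <= t <= len V e' ->
      F.1 (epoint V e' t) = 0) else F.1 = cst 0).
  have [eE|eE] := boolP (e \in edges T); last first.
    by exists (cst 0, (cst 0, cst 0)); split => //; exact: C1_cst.
  have [f0 fL df dg] := Hfg e eE.
  have [e1 e2 e3] := GV e.1; have [e4 e5 e6] := GV e.2.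
  have ne := edge_neq eE.
  have cg t : 0 <= t <= len V e -> {for t, continuous (g e)}.
    by move=> tL; exact: continuous_derivable (dg t tL).
  have [||||F [Fx [Fy [h1 h2 h3]]]] := @edge_bump e G Gx Gy (f e) (g e) eE HG df cg.
  - by rewrite e1.
  - by rewrite e4.
  - have := Hab e.1 e.2; rewrite -(edge_mkedge eE) e2 e3 /slope eqxx; apply.
    by have [_ -> _] := nbT e.1; exact: edge_adj.
  - have := Hab e.2 e.1; have [_ -> _] := nbT e.2; rewrite adjC (edge_adj eE) => /(_ isT).
    have <- : e = mkedge e.2 e.1.
      by rewrite {1}(edge_mkedge eE) /mkedge; case: ltngtP ne => // /val_inj ->; rewrite eqxx.
    rewrite /slope (negbTE ne) e5 e6 => gE.
    rewrite -[LHS]opprK gE /dir /udir -(opprB (V e.2)) enormN /= /GRing.scale /=; ring.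
  by exists (F, (Fx, Fy)).
have [Phi HPhi] := choice H1.
have HS : C1plane (fun Q => \sum_e (Phi e).1 Q) (fun Q => \sum_e (Phi e).2.1 Q)
   (fun Q => \sum_e (Phi e).2.2 Q) by apply: C1_sum => e; have [] := HPhi e.
pose F Q := G Q + \sum_e (Phi e).1 Q.
have HF := C1D HG HS.
have Fe e t : e \in edges T -> 0 <= t <= len V e -> induced V F e t = f e t.
  move=> eE tL; rewrite /induced /F (bigD1 e)//= big1 ?addr0; last first.
    move=> e' e'e; have [_] := HPhi e'; case: ifPn => [e'E [_ h]|_ -> //].
    by apply: h => //; rewrite eq_sym.
  by have [_] := HPhi e; rewrite eE => -[-> // _]; ring.
exists F; split.
- move=> i; have [j [_ [ji _ _]]] := two_neighbours Vinj triT nbT i.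
  have ij : adj T i j by have [_ <- _] := nbT i.
  have eE := mkedge_edges ij; have [f0 fL] := fz _ eE.
  have L0 := len_gt0 Vinj eE.
  case: (@mkedge_end _ _ i j (adj_neq ij) erefl) => [[/eqP h1 h2]|[h0 [h1 h2]]].
    by rewrite -h1 -f0 -epoint0 -Fe// lexx ltW.
  by rewrite -h2 -fL -(epointL eE) -Fe// lexx ltW.
- exact: C1plane_on HF.
move=> e eE; have L0 := len_gt0 Vinj eE; exists (g e); split.
- by apply: eq_derivative_on L0 _ (Df e eE) => t tL; rewrite Fe.
- exact: ACg.
move=> t tL; rewrite -(f2 e t eE tL).
exact: (eq_deriv2 (fun s sL => Fe e s eE sL) tL).
Qed.

End Extension.

(** * The extremal problem *)

Section DirectionalDerivative.
Context {R : realType}.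
Notation lambda := (@lebesgue_measure R).
Notation mR := (measurableTypeR R).

Lemma Lfun_restrict (k : R -> R) (a b p : R) : 1 <= p ->
  k \_ `[a, b] \in Lfun lambda p%:E <->
  measurable_fun (`[a, b]%classic : set mR) k /\
  lambda.-integrable `[a, b] (EFin \o (fun t => `|k t| `^ p)).
Proof.
move=> p1; have p0 : p != 0 by rewrite gt_eqF// (lt_le_trans _ p1).
have mi := measurable_itv_mR a b.
have E : (EFin \o (fun t => `|k t| `^ p)) \_ `[a, b]
    = EFin \o (fun t => `|(k \_ `[a, b]) t| `^ p) :> (R -> \bar R).
  by apply/funext => t; rewrite /= !patchE; case: ifP => // _; rewrite normr0 powR0.
split.
  move=> kp; split.
    by move: kp; rewrite inE => /andP[/[!inE]/= mf _]; exact/(measurable_restrictT _ mi).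
  apply/(integrable_mkcond _ mi); rewrite E.
  exact: Lfun_integrable.
move=> [mk /(integrable_mkcond _ mi)]; rewrite E => /integrableP[_ hi].
rewrite inE; apply/andP; split; rewrite inE/=.
  exact/(measurable_restrictT _ mi).
rewrite /finite_norm unlock; apply: poweR_lty.
move: hi; congr (_ < _)%E; apply: eq_integral => t _ /=.
by rewrite ger0_norm// powR_ge0.
Qed.

(** The gradient is relative to [D], and at an end of the edge only a one-sided derivative along the
    edge exists. Both limits are therefore compared along the edge. *)
Lemma C1_on_directional (D : set (R * R)) (F Fx Fy : R * R -> R) (P w : R * R)
    (a b : R) (c : R -> R * R) g t : a < b -> a <= t <= b ->
  (F Q - F P - (Fx P * (Q.1 - P.1) + Fy P * (Q.2 - P.2)))
            / enorm (Q - P) @[Q --> within D P^'] --> (0 : R) ->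
  (forall s, a <= s <= b -> D (c s)) -> w.1 ^+ 2 + w.2 ^+ 2 = 1 ->
  (forall s, c s = (P.1 + (s - t) * w.1, P.2 + (s - t) * w.2)) ->
  derivative_on a b (F \o c) g ->
  g t = Fx P * w.1 + Fy P * w.2.
Proof.
move=> ab tab HF Dc w1 cE Dg.
have tab' : t \in `[a, b] by rewrite in_itv.
(* Uniqueness of limits needs a proper filter: the left one at [b], the right one elsewhere. *)
have [G PG Gw] : exists2 G : set_system R, ProperFilter G & within `[a, b] t^' `<=` G.
  case/andP: (tab); rewrite [t <= b]le_eqVlt => at' /predU1P[->|tb].
    exists (b^'-); first exact: at_left_proper_filter.
    move=> A; rewrite /= -nearE !near_withinE => HA.
    apply: filterS2 HA (lt_nbhsr ab) => s HA s1 s2; apply: HA; first by rewrite lt_eqF.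
    by rewrite /= in_itv /=; apply/andP; split; exact: ltW.
  exists (t^'+); first exact: at_right_proper_filter.
  move=> A; rewrite /= -nearE !near_withinE => HA.
  apply: filterS2 HA (lt_nbhsl tb) => s {}HA sb ts; apply: HA; first by rewrite gt_eqF.
  by rewrite /= in_itv /= (le_trans at' (ltW ts)) ltW.
have cont : c s @[s --> t] --> P.
  have line (x' u' : R) : (x' + (s - t) * u' @[s --> t] --> x').
    have c1 : s - t @[s --> t] --> t - t by apply: cvgB; [exact: cvg_id|exact: cvg_cst].
    have c2 : x' + (s - t) * u' @[s --> t] --> x' + (t - t) * u'.
      apply: cvgD; first exact: cvg_cst.
      exact: (cvgM c1 (cvg_cst u')).
    by rewrite subrr mul0r addr0 in c2.
  rewrite (surjective_pairing P).
  rewrite (_ : c = fun s => (P.1 + (s - t) * w.1, P.2 + (s - t) * w.2)); last exact/funext.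
  exact: (cvg_pair (line P.1 w.1) (line P.2 w.2)).
have ct : c t = P by rewrite cE subrr !mul0r !addr0 -surjective_pairing.
have D1 : ((F \o c) s - (F \o c) t) / (s - t) @[s --> G] --> g t.
  by move=> A /(Dg _ tab'); exact: Gw.
have D2 : ((F \o c) s - (F \o c) t) / (s - t) @[s --> G] --> Fx P * w.1 + Fy P * w.2.
  2: exact: (cvg_unique _ D1 D2).
apply/cvgrPdist_lt => e e0; apply: Gw.
move/cvgrPdist_lt : HF => /(_ _ e0).
rewrite /= -!nearE !near_withinE => H.
have H' : \forall s \near t, c s != P -> D (c s) ->
    `|0 - (F (c s) - F P - (Fx P * ((c s).1 - P.1) + Fy P * ((c s).2 - P.2)))
            / enorm (c s - P)| < e.
  exact: (cont _ H).
apply: filterS H' => s /= H' st sab; move: H'.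
rewrite in_itv/= in sab.
have nE : enorm (c s - P) = `|s - t|.
  rewrite /enorm cE /= ![_ + _ - _]addrAC !subrr !add0r !exprMn -mulrDr w1 mulr1.
  by rewrite sqrtr_sqr.
have st0 : s - t != 0 by rewrite subr_eq0.
have cP : c s != P.
  apply: contra_neq st0 => cP; move: nE; rewrite cP subrr /enorm /= !expr0n /= addr0 sqrtr0.
  by move/esym/normr0_eq0.
move=> /(_ cP (Dc _ sab)); apply: le_lt_trans; rewrite ct nE sub0r normrN.
rewrite cE /= ![_ + _ - P.1]addrAC ![_ + _ - P.2]addrAC !subrr !add0r.
rewrite [in leRHS]normrM normfV normr_id -normfV -normrM distrC.
rewrite le_eqVlt; apply/orP; left; apply/eqP.
by congr `|_|; field.
Qed.
End DirectionalDerivative.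

(** * Minimality from convexity *)

Section Minimization.
Context {R : realType} {I : finType}.
Variables (E : {set I}) (L : I -> R) (p : R).
Hypothesis p1 : 1 < p.
Notation lambda := (@lebesgue_measure R).
Notation mR := (measurableTypeR R).
Notation netI := (net_integral E L).

Lemma ae_net_integral f g : 
  (forall e, e \in E -> measurable_fun (`[0, L e]%classic : set mR) (f e)) ->
  net_integrable E L g ->
  (forall e, e \in E -> {ae lambda, forall t, t \in `[0, L e] -> f e t = g e t}) ->
  net_integrable E L f /\ netI f = netI g.
Proof.
move=> mf gi fg.
have H e : e \in E -> lambda.-integrable `[0, L e] (EFin \o f e) /\
    \int[lambda]_(t in `[0, L e]) f e t = \int[lambda]_(t in `[0, L e]) g e t.
  move=> eE; apply: Rintegral_open_ae_eq (gi e eE) _.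
    by apply: measurable_funS (mf e eE); [exact: measurable_itv|exact: subset_itv_oo_cc].
  have := fg e eE; apply: ae_imp => t h /andP[t0 tL]; apply: h.
  by rewrite in_itv /= !ltW.
split; first by move=> e /H[].
by apply: eq_bigr => e /H[].
Qed.

Lemma net_integral_eq0_ae f : net_integrable E L f ->
  (forall e t, e \in E -> 0 <= t <= L e -> 0 <= f e t) -> netI f = 0 ->
  forall e, e \in E -> {ae lambda, forall t, t \in `[0, L e] -> f e t = 0}.
Proof.
move=> fi f0 /eqP; rewrite psumr_eq0; last first.
  by move=> e eE; apply: Rintegral_ge0 => t; rewrite /= in_itv /=; exact: f0.
move=> /allP H e eE.
have {H}/implyP/(_ eE)/eqP fE := H e (mem_index_enum e).
have mi := measurable_itv_mR 0 (L e).
have A : ae_eq lambda (`[0, L e]%classic : set mR) (EFin \o f e) (cst 0%E).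
  apply/(ae_eq_integral_abs _ mi (measurable_int _ (fi e eE))).
  transitivity (\int[lambda]_(t in `[0%R, L e]) (f e t)%:E)%E.
    apply: eq_integral => t; rewrite inE /= in_itv /= => tL.
    by rewrite ger0_norm// f0.
  by rewrite -[LHS]fineK; [congr EFin|exact: integrable_fin_num (fi e eE)].
by move: A; apply: ae_imp => t h tL; have [] := h tL.
Qed.

(* The excess of the integrands over the tangent line is nonnegative, and its
   integral is the difference of the two power integrals. *)
Lemma power_integral_min (h phi S : I -> R -> R) :
  net_continuous phi -> net_continuous S ->
  (forall e t, S e t = spow (p - 1) (phi e t)) ->
  net_integrable E L (fun e t => `|h e t| `^ p) ->
  net_integrable E L (fun e t => h e t * S e t) ->
  netI (fun e t => h e t * S e t) = netI (fun e t => phi e t * S e t) ->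
  netI (fun e t => `|phi e t| `^ p) <= netI (fun e t => `|h e t| `^ p) /\
  (netI (fun e t => `|phi e t| `^ p) = netI (fun e t => `|h e t| `^ p) ->
   forall e, e \in E -> {ae lambda, forall t, t \in `[0, L e] -> h e t = phi e t}).
Proof.
move=> cphi cS SE hi hSi hS.
have phii : net_integrable E L (fun e t => `|phi e t| `^ p).
  apply: net_continuous_integrable => e t.
  apply: (@continuous_comp _ _ _ (phi e) (fun x => `|x| `^ p)).
    exact: cphi.
  exact: powR_norm_continuous.
have phiSi : net_integrable E L (fun e t => phi e t * S e t).
  by apply: net_continuous_integrable => e t; apply: cvgM; [exact: cphi|exact: cS].
pose D e t := (`|h e t| `^ p + -1 * `|phi e t| `^ p) +
  (- p * (h e t * S e t) + p * (phi e t * S e t)).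
have Z c k ki := @net_integrableZ _ _ E L c k ki.
have i1 := net_integrableD hi (Z (-1) _ phii).
have i2 := net_integrableD (Z (- p) _ hSi) (Z p _ phiSi).
have Di : net_integrable E L D := net_integrableD i1 i2.
have DE : netI D = netI (fun e t => `|h e t| `^ p) - netI (fun e t => `|phi e t| `^ p).
  rewrite (net_integralD i1 i2) (net_integralD hi (Z _ _ phii)).
  rewrite (net_integralD (Z _ _ hSi) (Z _ _ phiSi)).
  rewrite (net_integralZ (-1) phii) (net_integralZ (- p) hSi) (net_integralZ p phiSi).
  by rewrite hS; move: (netI _) (netI _) (netI _) => x y w; ring.
have DE' e t : D e t = `|h e t| `^ p - `|phi e t| `^ p -
    p * (spow (p - 1) (phi e t) * (h e t - phi e t)).
  by rewrite /D SE; ring.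
have D0 e t : 0 <= D e t by rewrite DE' subr_ge0; exact: powR_convex.
split.
  rewrite -subr_ge0 -DE; apply: sumr_ge0 => e eE.
  by apply: Rintegral_ge0 => t _; exact: D0.
move=> hphi e eE; have De := net_integral_eq0_ae Di (fun e t _ _ => D0 e t).
have Dz : netI D = 0 by rewrite DE hphi subrr.
move: (De Dz e eE).
apply: ae_imp => t H tL; apply/eqP; apply/negPn/negP => ne.
have := H tL; rewrite DE' => /eqP; rewrite subr_eq0 => /eqP E0.
by have := powR_strictly_convex p1 ne; rewrite E0 ltxx.
Qed.

End Minimization.

(** * Characterization of the minimizers *)

Section ExtremalProblem.
Context {R : realType} {n : nat}.
Variables (V : 'I_n -> R * R) (z : 'I_n -> R) (T : {set {set 'I_n}}).
Variables (nb : 'I_n -> seq 'I_n) (lam : NB nb -> 'I_3 -> R) (p q : R).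
Hypothesis Vinj : injective V.
Hypothesis triT : triangulation V T.
Hypothesis nbT : edge_listing V T nb.
Hypothesis lamE : basic_coefs V lam.
Hypothesis lam0 : forall k, lam k ord0 != 0.
Hypothesis p1 : 1 < p.
Hypothesis pq : p^-1 + q^-1 = 1.
Notation lambda := (@lebesgue_measure R).
Notation mR := (measurableTypeR R).
Notation net_integrable := (net_integrable (edges T) (len V)).
Notation netI := (net_integral (edges T) (len V)).

Lemma network_intE (f : network R n) : net_integrable f ->
  network_int V T f = (netI f)%:E.
Proof.
move=> fi; rewrite /network_int /net_integral -sumEFin; apply: eq_bigr => e eE.
by rewrite /Rintegral fineK//; exact: integrable_fin_num (fi e eE).
Qed.

Lemma network_normE (f : network R n) : net_integrable (fun e t => `|f e t| `^ p) ->
  network_norm V T p f = ((netI (fun e t => `|f e t| `^ p)) `^ p^-1)%:E.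
Proof. by move=> fi; rewrite /network_norm network_intE// poweR_EFin. Qed.

Lemma epoint_domain e t : e \in edges T -> 0 <= t <= len V e ->
  domain V T (epoint V e t).
Proof.
move=> eE /andP[t0 tL]; have L0 := len_gt0 Vinj eE.
have /andP[_ /existsP[A /and3P[AT iA jA]]] := edge_adj eE.
exists A => //; apply: edge_hull => //.
by rewrite divr_ge0 ?ler_pdivrMr ?mul1r// ltW.
Qed.

(** The slopes at a vertex are a linear function, given by the gradient, of the edge directions,
    which satisfy the relation by the choice of the coefficients. *)
Lemma slope_relation F g : C1_on (domain V T) F ->
  (forall e, e \in edges T -> derivative_on 0 (len V e) (induced V F e) (g e)) ->
  forall l : NB nb, \sum_r lam l r * slope V g (tag l) (mkedge (tag l) (nbr l r)) = 0.
Proof.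
move=> [Fx [Fy [_ _ HF]]] Dg l.
have D e t : e \in edges T -> 0 <= t <= len V e ->
    g e t = Fx (epoint V e t) * (udir V e.1 e.2).1 + Fy (epoint V e t) * (udir V e.1 e.2).2.
  move=> eE tL; have L0 := len_gt0 Vinj eE.
  apply: (C1_on_directional L0 tL (HF _ (epoint_domain eE tL))
    (fun s sL => epoint_domain eE sL) _ _ (Dg e eE)).
    exact: udir_unit (edge_neq eE).
  by move=> s; rewrite !(epointE Vinj _ eE) /=; congr (_, _); ring.
have S i j : adj T i j -> slope V g i (mkedge i j) =
    Fx (V i) * (udir V i j).1 + Fy (V i) * (udir V i j).2.
  move=> ij; have eE := mkedge_edges ij; have L0 := len_gt0 Vinj eE.
  rewrite /slope; case: (@mkedge_end _ _ i j (adj_neq ij) erefl) => [[h1 h2]|[h0 [h1 h2]]].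
    rewrite h1 D ?lexx ?ltW// epoint0 h2; by move/eqP : h1 => ->.
  rewrite h0 D ?lexx ?ltW// (epointL Vinj eE) h1 h2 /udir -(opprB (V i)) enormN /=.
  by rewrite /GRing.scale /=; ring.
under eq_bigr => r _ do rewrite S ?(nbr_adj nbT)//.
pose lin (P : R * R) := Fx (V (tag l)) * P.1 + Fy (V (tag l)) * P.2.
have [_ E] := lamE l.
transitivity (lin (\sum_r lam l r *: udir V (tag l) (nbr l r))).
  rewrite (big_morph lin (op1 := +%R) (id1 := 0)); first last.
  - by rewrite /lin /= !mulr0 addr0.
  - by move=> P Q; rewrite /lin /=; ring.
  by apply: eq_bigr => r _; rewrite /lin /= /GRing.scale /=; ring.
by rewrite E /lin /= !mulr0 addr0.
Qed.

(** A member of [Cp] is arbitrary outside the edges. Equality with the induced network on each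
    closed edge transfers one-sided derivatives, and on the open edge it transfers second
    derivatives. *)
Lemma Cp_integrals f : Cp V z T p f ->
  [/\ forall e, e \in edges T -> measurable_fun (`[0, len V e]%classic : set mR) (deriv2 f e),
      net_integrable (fun e t => `|deriv2 f e t| `^ p) &
      forall l, net_integrable (fun e t => deriv2 f e t * basic V lam l e t) /\
        netI (fun e t => deriv2 f e t * basic V lam l e t) = basic_d V z lam l].
Proof.
move=> [F [Fz FC HF] fE].
have /choice[g Hg] : forall e, exists g, e \in edges T ->
    [/\ derivative_on 0 (len V e) (induced V F e) g, absolutely_continuous 0 (len V e) g,
      measurable_fun (`[0, len V e]%classic : set mR) (deriv2 (induced V F) e) &
      lambda.-integrable `[0, len V e]
        (EFin \o (fun t => `|deriv2 (induced V F) e t| `^ p))].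
  move=> e; case: (boolP (e \in edges T)) => [eE|_]; last by exists (cst 0).
  have [[g g1 g2] /(Lfun_restrict _ _ _ (ltW p1))[m i]] := HF e eE.
  by exists g.
have fE' e : e \in edges T -> forall t, 0 <= t <= len V e -> f e t = induced V F e t.
  by move=> eE t tL; apply: fE => //; rewrite in_itv.
have dE e : e \in edges T -> forall t, 0 < t < len V e ->
    deriv2 f e t = deriv2 (induced V F) e t.
  by move=> eE; exact: eq_deriv2 (fE' e eE).
have mo e : e \in edges T ->
    measurable_fun (`]0, len V e[%classic : set mR) (deriv2 f e).
  move=> eE; have [_ _ m _] := Hg e eE.
  apply: (eq_measurable_fun (deriv2 (induced V F) e)).
    by move=> t; rewrite inE /= in_itv /= => tL; rewrite dE.
  by apply: measurable_funS m; [exact: measurable_itv|exact: subset_itv_oo_cc].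
split.
- by move=> e /mo; exact: measurable_fun_itv_cc.
- move=> e eE; have [_ _ _ i] := Hg e eE.
  have [] // := @Rintegral_open_ae_eq _ _ (fun t => `|deriv2 f e t| `^ p) _ _ i.
    have mp : measurable_fun (setT : set mR) (fun x : mR => `|x : R| `^ p : mR).
      by apply: continuous_measurable_fun; exact: powR_norm_continuous.
    exact: (measurableT_comp mp (mo e eE)).
  by apply: aeW => t tL; rewrite dE.
move=> l.
have Df e : e \in edges T -> derivative_on 0 (len V e) (f e) (g e).
  move=> eE; have [D _ _ _] := Hg e eE.
  apply: (eq_derivative_on (len_gt0 Vinj eE) _ D) => t tL.
  by rewrite fE'.
have ACg e : e \in edges T -> absolutely_continuous 0 (len V e) (g e).
  by move=> /Hg[].
have fz e : e \in edges T -> f e 0 = z e.1 /\ f e (len V e) = z e.2.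
  move=> eE; have L0 := len_gt0 Vinj eE.
  by rewrite !fE' ?lexx ?ltW//= /induced epoint0 (epointL Vinj eE) !Fz.
have [i ->] := network_integral_identity lam Vinj nbT Df ACg mo fz l.
split=> //; rewrite (slope_relation FC) ?subr0// => e eE.
by have [] := Hg e eE.
Qed.

Let L0 e : e \in edges T -> 0 < len V e. Proof. exact: len_gt0. Qed.

Let cB (k : NB nb) : net_continuous (basic V lam k).
Proof. exact: basic_continuous. Qed.

Let q1 : 1 < q. Proof. by have [] := conjugate_gt1 p1 pq. Qed.

Lemma basic_pow_continuous alpha : net_continuous (basic_pow V lam q alpha).
Proof. exact: (@spow_comb_continuous _ _ _ _ _ cB q1 alpha). Qed.

Lemma basic_powM_integrable alpha l :
  net_integrable (fun e t => basic_pow V lam q alpha e t * basic V lam l e t).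
Proof.
apply: net_continuous_integrable => e t.
by apply: cvgM; [exact: basic_pow_continuous|exact: cB].
Qed.

Lemma basic_systemP alpha : basic_system V z T lam q alpha <->
  forall l, netI (fun e t => basic_pow V lam q alpha e t * basic V lam l e t) =
    basic_d V z lam l.
Proof.
split => H l; have := H l; rewrite (network_intE (basic_powM_integrable alpha l)).
  by move=> [].
by move=> ->.
Qed.

Lemma basic_system_unique alpha beta : basic_system V z T lam q alpha ->
  basic_system V z T lam q beta -> beta = alpha.
Proof.
move=> /basic_systemP Ha /basic_systemP Hb; apply/ffunP => k.
have freeB := basic_free Vinj nbT lam0.
apply: (nonlinear_system_unique cB q1 freeB (a := beta) (b := alpha)) => l.
exact: etrans (Hb l) (esym (Ha l)).
Qed.

Lemma basic_system_solvable : exists alpha, basic_system V z T lam q alpha.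
Proof.
have freeB := basic_free Vinj nbT lam0.
have [a Ha] := nonlinear_system_exists L0 cB q1 freeB (basic_d V z lam).
exists [ffun k => a k]; apply/basic_systemP => l; rewrite -Ha.
apply: eq_net_integral => e t _ _; congr (spow _ _ * _).
by apply: eq_bigr => k _; rewrite ffunE.
Qed.

(** Any coefficients that represent some [F''] solve the system; the integral identity for [f]
    supplies the right-hand side. *)
Lemma aeq_basic_system f beta : Cp V z T p f ->
  network_aeq V T (deriv2 f) (basic_pow V lam q beta) -> basic_system V z T lam q beta.
Proof.
move=> /Cp_integrals[mf _ fd] fb; apply/basic_systemP => l.
have [_ <-] := fd l.
have [] // := @ae_net_integral _ _ (edges T) (len V)
  (fun e t => deriv2 f e t * basic V lam l e t)
  (fun e t => basic_pow V lam q beta e t * basic V lam l e t) _ (basic_powM_integrable beta l).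
- move=> e eE; apply: measurable_funM; first exact: mf.
  by apply: measurable_funTS; apply: continuous_measurable_fun; exact: cB.
- by move=> e /fb; apply: ae_imp => t H tL; rewrite H.
Qed.

Lemma basic_system_min alpha h : basic_system V z T lam q alpha -> Cp V z T p h ->
  netI (fun e t => `|basic_pow V lam q alpha e t| `^ p) <=
    netI (fun e t => `|deriv2 h e t| `^ p) /\
  (netI (fun e t => `|basic_pow V lam q alpha e t| `^ p) =
    netI (fun e t => `|deriv2 h e t| `^ p) ->
   network_aeq V T (deriv2 h) (basic_pow V lam q alpha)).
Proof.
move=> /basic_systemP Ha /Cp_integrals[_ hp hd].
pose S : network R n := fun e t => \sum_k alpha k * basic V lam k e t.
have SE e t : S e t = spow (p - 1) (basic_pow V lam q alpha e t).
  have [_ _ _ pq1] := conjugate_gt1 p1 pq.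
  by rewrite /basic_pow spow_spow ?subr_gt0// mulrC pq1 spow1.
have sumE (k : network R n) : (fun e t => k e t * S e t) =
    (fun e t => \sum_l alpha l * (k e t * basic V lam l e t)) :> network R n.
  apply/funext => e; apply/funext => t; rewrite /S mulr_sumr.
  by apply: eq_bigr => l _; rewrite mulrCA.
have [i1 e1] := net_integral_sum alpha (fun l => (hd l).1).
have [i2 e2] := net_integral_sum alpha (basic_powM_integrable alpha).
have cS : net_continuous S by exact: (@comb_continuous _ _ _ _ cB alpha).
apply: (power_integral_min p1 (@basic_pow_continuous alpha) cS SE hp).
  by rewrite sumE.
rewrite !sumE e1 e2; apply: eq_bigr => l _.
by rewrite (hd l).2 Ha.
Qed.

Lemma minimizer_exists alpha : basic_system V z T lam q alpha ->
  exists2 f, Cp V z T p f & network_aeq V T (deriv2 f) (basic_pow V lam q alpha).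
Proof.
move=> /basic_systemP Ha.
have [F [Fz FC HF]] := network_extension Vinj triT nbT lamE lam0
  (@basic_pow_continuous alpha) Ha.
have aeF : network_aeq V T (deriv2 (induced V F)) (basic_pow V lam q alpha).
  move=> e eE; apply: ae_open_closed; apply: aeW => t.
  by have [g [_ _]] := HF e eE; apply.
exists (induced V F) => //; exists F => //; split=> // e eE.
have [g [g1 g2 g3]] := HF e eE; split; first by exists g.
have mo : measurable_fun (`]0, len V e[%classic : set mR) (deriv2 (induced V F) e).
  apply: (eq_measurable_fun (basic_pow V lam q alpha e)).
    by move=> t; rewrite inE /= in_itv /= => tL; rewrite g3.
  by apply: measurable_funTS; apply: continuous_measurable_fun; exact: basic_pow_continuous.
apply/(Lfun_restrict _ _ _ (ltW p1)); split; first exact: measurable_fun_itv_cc mo.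
have mp : measurable_fun (setT : set mR) (fun x : mR => `|x : R| `^ p : mR).
  by apply: continuous_measurable_fun; exact: powR_norm_continuous.
have i : lambda.-integrable `[0, len V e] (EFin \o (fun t => `|basic_pow V lam q alpha e t| `^ p)).
  apply: continuous_integrable_itv => t.
  apply: (@continuous_comp _ _ _ (basic_pow V lam q alpha e) (fun x => `|x| `^ p)).
    exact: basic_pow_continuous.
  exact: powR_norm_continuous.
have [] // := Rintegral_open_ae_eq (measurableT_comp mp mo) i.
by apply: aeW => t tL /=; rewrite g3.
Qed.

Lemma power_integral_ge0 (f : network R n) : 0 <= netI (fun e t => `|f e t| `^ p).
Proof.
apply: sumr_ge0 => e eE.
by apply: Rintegral_ge0 => t _; exact: powR_ge0.
Qed.

Lemma aeq_power_integral alpha f : Cp V z T p f ->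
  network_aeq V T (deriv2 f) (basic_pow V lam q alpha) ->
  netI (fun e t => `|basic_pow V lam q alpha e t| `^ p) =
  netI (fun e t => `|deriv2 f e t| `^ p).
Proof.
move=> /Cp_integrals[_ fp _] fa; apply: eq_bigr => e eE; apply: (congr1 fine).
apply: ae_eq_integral; first exact: measurable_itv_mR.
- apply/measurable_EFinP.
  apply: measurable_funTS; apply: continuous_measurable_fun => t.
  apply: (@continuous_comp _ _ _ (basic_pow V lam q alpha e) (fun x => `|x| `^ p)).
    exact: basic_pow_continuous.
  exact: powR_norm_continuous.
- exact: measurable_int (fp e eE).
- by have := fa e eE; apply: ae_imp => t H tL /=; rewrite H.
Qed.

(** The network built from [alpha] attains the lower bound [N] of the power integrals, so the
    infimum is [N ^ p^-1]. Since this root is injective, [f] solves the problem exactly when its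
    power integral is [N], the equality case of the minimization. *)
Lemma solvesP alpha f : basic_system V z T lam q alpha -> Cp V z T p f ->
  solves V z T p f <-> network_aeq V T (deriv2 f) (basic_pow V lam q alpha).
Proof.
move=> Ha Cf; have [g Cg ga] := minimizer_exists Ha.
set N := netI (fun e t => `|basic_pow V lam q alpha e t| `^ p).
have pV0 : 0 < p^-1 by rewrite invr_gt0 (lt_trans ltr01 p1).
have N0 : 0 <= N := power_integral_ge0 _.
have normE h : Cp V z T p h -> exists M, [/\ 0 <= M, N <= M,
    network_norm V T p (deriv2 h) = (M `^ p^-1)%:E &
    N = M <-> network_aeq V T (deriv2 h) (basic_pow V lam q alpha)].
  move=> Ch; have [_ hp _] := Cp_integrals Ch.
  have [le_h eq_h] := basic_system_min Ha Ch.
  exists (netI (fun e t => `|deriv2 h e t| `^ p)); split.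
  - exact: power_integral_ge0.
  - exact: le_h.
  - exact: network_normE hp.
  - by split; [exact: eq_h|exact: aeq_power_integral].
have infE : ereal_inf [set network_norm V T p (deriv2 h) | h in Cp V z T p] =
    (N `^ p^-1)%:E.
  apply: le_anti; apply/andP; split.
    apply: ereal_inf_lbound; exists g => //.
    have [M [_ _ ME MP]] := normE g Cg; rewrite ME.
    by move/MP : ga => ->.
  apply: le_ereal_inf_tmp => _ [h Ch <-].
  have [M [M0 NM -> _]] := normE h Ch; rewrite lee_fin.
  exact: (ge0_ler_powR (ltW pV0) N0 M0 NM).
have [M [M0 NM ME <-]] := normE f Cf; rewrite /solves infE ME.
split=> [[/(powR_injective pV0 M0 N0)->//]|-> //].
Qed.

End ExtremalProblem.

Theorem theorem3 (R : realType) (n : nat) (V : 'I_n -> R * R) (z : 'I_n -> R)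
    (T : {set {set 'I_n}}) (nb : 'I_n -> seq 'I_n) (lam : NB nb -> 'I_3 -> R)
    (p q : R) :
  (3 <= n)%N ->
  injective V ->
  ~ collinear V finset.setT ->
  triangulation V T ->
  edge_listing V T nb ->
  basic_coefs V lam ->
  (forall k, lam k ord0 != 0) ->
  1 < p ->
  p^-1 + q^-1 = 1 ->
  (forall f : network R n, Cp V z T p f ->
     (solves V z T p f <->
      exists alpha : {ffun NB nb -> R},
        network_aeq V T (deriv2 f) (basic_pow V lam q alpha)))
  /\
  exists alpha : {ffun NB nb -> R},
    [/\ basic_system V z T lam q alpha,
        forall beta, basic_system V z T lam q beta -> beta = alpha &
        forall (f : network R n) (beta : {ffun NB nb -> R}), Cp V z T p f ->
          network_aeq V T (deriv2 f) (basic_pow V lam q beta) -> beta = alpha].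
Proof.
move=> _ Vinj _ triT nbT lamE lam0 p1 pq.
have [alpha Ha] := basic_system_solvable z Vinj nbT lam0 p1 pq.
(* Whatever coefficients represent [f''], they solve the system and hence equal [alpha]; this
   reduces the existential in the equivalence to [alpha]. *)
have uniq_alpha f beta : Cp V z T p f ->
    network_aeq V T (deriv2 f) (basic_pow V lam q beta) -> beta = alpha.
  move=> Cf fb; apply: (basic_system_unique Vinj nbT lam0 p1 pq Ha).
  exact: (aeq_basic_system Vinj nbT lamE p1 pq Cf fb).
split=> [f Cf|]; last first.
  exists alpha; split=> // [beta Hb].
  exact: (basic_system_unique Vinj nbT lam0 p1 pq Ha Hb).
have P := solvesP Vinj triT nbT lamE lam0 p1 pq Ha Cf.
split=> [/P fa|[beta fb]]; first by exists alpha.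
by apply/P; rewrite -(uniq_alpha f beta Cf fb).
Qed.
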